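(* Let $\alpha\in(0,1)$, and let $N\ge2$ be an integer and $\beta\in\mathbb{C}$ such that $\mathrm{Re}\big((-i)^N\beta y^N\big)\le0$ for all $y\in\mathbb{R}$. Let $f:\mathbb{R}\to\mathbb{R}$ be an analytic function that is the Fourier transform of a bounded complex Borel measure $\mu_f$ on $\mathbb{R}$ with compact support, i.e. $f(x)=\int_{\mathbb{R}}e^{-i\lambda x}\,d\mu_f(\lambda)$, extended to an entire function on $\mathbb{C}$ by the same formula. Then the solution of the initial value problem $$\mathbf{D}_t^\alpha u(t,x)=A_{N,\beta}u(t,x),\qquad u(0,x)=f(x),$$ is given by $$u(t,x)=\lim_{n\to\infty}\mathbb{E}\big[f\big(x+W_n^{N,\beta}(L^\alpha(t))\big)\big].$$
   Context: $A_{N,\beta}=\frac{\beta}{N!}\partial_x^N$. $\mathbf{D}_t^\alpha$ is the Caputo derivative: $\mathbf{D}_t^\alpha v(t)=\frac1{\Gamma(1-\alpha)}\int_0^t(t-s)^{-\alpha}\frac{\partial}{\partial s}v(s)\,ds$ for $\alpha\in(0,1)$; equivalently, it is the function with Laplace transform $\lambda^\alpha\tilde v(\lambda)-\lambda^{\alpha-1}v(0^+)$. Random walks: let $\xi_{N,\beta}$ be uniformly distributed on the $N$-th roots of $\beta$, i.e. $\mathbb{E}[g(\xi_{N,\beta})]=\frac1N\sum_{k=0}^{N-1}g(\beta^{1/N}e^{2\pi i k/N})$ for every $g:\mathbb{C}\to\mathbb{C}$ (with $\beta^{1/N}$ a fixed $N$-th root). Let $(\xi_j)_{j\ge1}$ be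 i.i.d. copies and $W_n^{N,\beta}(t)=n^{-1/N}\sum_{j=1}^{\lfloor nt\rfloor}\xi_j$, $t\ge0$. Inverse stable subordinator: $H^\alpha$ is the $\alpha$-stable subordinator, with $\mathbb{E}[e^{-\lambda H^\alpha(t)}]=e^{-t\lambda^\alpha}$ for $\lambda>0$, and $L^\alpha(t)=\inf\{s\ge0: H^\alpha(s)\ge t\}$. The process $L^\alpha$ is independent of $(\xi_j)$. *)

(* Defs.v *)
From mathcomp Require Import all_boot all_order all_algebra.
From mathcomp Require Export complex.
From mathcomp Require Import all_classical all_reals all_analysis.

Set Implicit Arguments.
Unset Strict Implicit.
Unset Printing Implicit Defensive.

Import Order.TTheory GRing.Theory Num.Theory.
Import numFieldNormedType.Exports.

Local Open Scope classical_set_scope.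
Local Open Scope ring_scope.
Local Open Scope complex_scope.

Section Complex.
Context {R : realType}.
Implicit Types (z : R[i]).

Definition cexp z : R[i] :=
  (expR (complex.Re z) * cos (complex.Im z))
    +i* (expR (complex.Re z) * sin (complex.Im z)).

Definition cpair z : measurableTypeR R * measurableTypeR R :=
  (complex.Re z, complex.Im z).

(* R[i] carries neither a topology nor a structure of normed R-module here:
   notions for complex-valued functions of a real variable, and limits of
   complex sequences, are taken on real and imaginary parts. *)
Definition reim {A : Type} (Q : (A -> R) -> Prop) (v : A -> R[i]) : Prop :=
  Q (fun a => complex.Re (v a)) /\ Q (fun a => complex.Im (v a)).

Definition ccvg (z_ : nat -> R[i]) (l : R[i]) : Prop :=
  ((fun n => complex.Re (z_ n)) @ \oo --> complex.Re l) /\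
  ((fun n => complex.Im (z_ n)) @ \oo --> complex.Im l).

Definition cderive (n : nat) (v : R -> R[i]) (x : R) : R[i] :=
  (derive1n n (fun y => complex.Re (v y)) x)
    +i* (derive1n n (fun y => complex.Im (v y)) x).

End Complex.

Section ComplexMeasure.
Context {R : realType}.

(* A charge is finite-valued and countably additive, so a pair of charges is
   exactly a (necessarily bounded) complex Borel measure on R. *)
Record complex_measure := ComplexMeasure {
  cm_re : {charge set (measurableTypeR R) -> \bar R} ;
  cm_im : {charge set (measurableTypeR R) -> \bar R} }.

Definition compact_support (mu : complex_measure) : Prop :=
  exists2 K : set R, compact K &
    forall A : set (measurableTypeR R), measurable A -> A `&` K = set0 ->
      cm_re mu A = 0%E /\ cm_im mu A = 0%E.

(* Integral against the Jordan decomposition; the Jordan parts, hence the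
   integral, do not depend on the Hahn decomposition that is picked. *)
Definition charge_int (nu : {charge set (measurableTypeR R) -> \bar R})
    (g : R -> R) : R :=
  let PN := projT2 (cid (projT2 (cid (Hahn_decomposition nu)))) in
  Rintegral (jordan_pos PN) setT g - Rintegral (jordan_neg PN) setT g.

Definition complex_int (mu : complex_measure) (g : R -> R[i]) : R[i] :=
  let gr := fun l => complex.Re (g l) in
  let gi := fun l => complex.Im (g l) in
  (charge_int (cm_re mu) gr - charge_int (cm_im mu) gi)
    +i* (charge_int (cm_im mu) gr + charge_int (cm_re mu) gi).

(* For compactly supported mu this is entire in z. *)
Definition fourier (mu : complex_measure) (z : R[i]) : R[i] :=
  complex_int mu (fun l : R => cexp (- 'i%C * l%:C * z)).

End ComplexMeasure.
Arguments complex_measure : clear implicits.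

Section Probability.
Context {d : measure_display} {T : measurableType d} {R : realType}.
Variable P : probability T R.

Definition cexpectation (Z : T -> R[i]) : R[i] :=
  fine ('E_P[fun w => complex.Re (Z w)])
    +i* fine ('E_P[fun w => complex.Im (Z w)]).

Definition cintegrable (Z : T -> R[i]) : Prop :=
  reim (fun X : T -> R => P.-integrable setT (EFin \o X)) Z.

Definition sigma_of {I : Type} {d' : measure_display} {U : measurableType d'}
    (D : set I) (X : I -> T -> U) : set (set T) :=
  <<s \bigcup_(i in D) preimage_set_system setT (X i) measurable >>.

Definition indep_systems (F G : set (set T)) : Prop :=
  forall A B, F A -> G B -> P (A `&` B) = (P A * P B)%E.

Definition mutually_indep (F : nat -> set (set T)) : Prop :=
  forall (s : seq nat) (A : nat -> set T), uniq s ->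
    (forall i, i \in s -> F i (A i)) ->
    fine (P (\bigcap_(i in [set` s]) A i)) = \prod_(i <- s) fine (P (A i)).

Definition complex_rv (Z : T -> R[i]) : Prop := measurable_fun setT (cpair \o Z).

(* The roots of X^N - b ^+ N are b * exp(2 i pi k / N), k < N, counted with
   multiplicity (they are all 0 when b = 0). *)
Definition uniform_on_roots (N : nat) (b : R[i]) (Z : T -> R[i]) : Prop :=
  forall g : R[i] -> R[i],
    cexpectation (g \o Z) =
    N%:R^-1 * \sum_(k < N) g (b * cexp ((2 * pi * k%:R / N%:R)%:C * 'i%C)).

Definition iid_uniform_on_roots (N : nat) (b : R[i]) (xi : nat -> T -> R[i]) :
    Prop :=
  [/\ forall j, complex_rv (xi j),
      forall j, uniform_on_roots N b (xi j) &
      mutually_indep (fun j => sigma_of [set j] (fun i => cpair \o xi i))].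

(* The steps are indexed from 0 rather than from 1. *)
Definition walk (N : nat) (xi : nat -> T -> R[i]) (n : nat) (t : R) (w : T) :
    R[i] :=
  (n%:R `^ (- N%:R^-1))%:C * \sum_(j < Num.truncn (n%:R * t)) xi j w.

(* Only the restriction of H to nonnegative times matters. *)
Record stable_subordinator (alpha : R) (H : R -> {RV P >-> R}) : Prop := {
  subord0 : forall w, H 0 w = 0 ;
  subord_nondecreasing : forall w (s t : R), 0 <= s <= t -> H s w <= H t w ;
  subord_right_continuous : forall w (t : R), 0 <= t ->
    H s w @[s --> t^'+] --> H t w ;
  subord_independent_increments : forall s t : R, 0 <= s <= t ->
    indep_systems (sigma_of `[0, s] (fun r => H r : T -> measurableTypeR R))
                  (sigma_of [set tt]
                    (fun _ => (fun w => H t w - H s w) : T -> measurableTypeR R)) ;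
  subord_stationary_increments : forall (s t : R) (B : set (measurableTypeR R)),
    0 <= s <= t -> measurable B ->
    P ((fun w => H t w - H s w) @^-1` B) = P (H (t - s) @^-1` B) ;
  subord_laplace : forall lambda t : R, 0 < lambda -> 0 <= t ->
    ('E_P[fun w => expR (- lambda * H t w)] =
      (expR (- t * lambda `^ alpha))%:E)%E }.

Definition inverse_subordinator (H : R -> {RV P >-> R}) (t : R) (w : T) : R :=
  inf [set s | 0 <= s /\ t <= H s w].

End Probability.

Section CaputoProblem.
Context {R : realType}.

Definition Gamma (s : R) : R :=
  \int[lebesgue_measure]_(x in `]0, +oo[) (x `^ (s - 1) * expR (- x)).

Definition caputo_integrand (alpha t : R) (v : R -> R) (s : R) : R :=
  (t - s) `^ (- alpha) * derive1 v s.

Definition caputo (alpha : R) (v : R -> R) (t : R) : R :=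
  (Gamma (1 - alpha))^-1 *
  \int[lebesgue_measure]_(s in `[0, t]) caputo_integrand alpha t v s.

Definition ccaputo (alpha : R) (v : R -> R[i]) (t : R) : R[i] :=
  caputo alpha (fun s => complex.Re (v s)) t
    +i* caputo alpha (fun s => complex.Im (v s)) t.

Definition opA (N : nat) (beta : R[i]) (v : R -> R[i]) (x : R) : R[i] :=
  beta / (N`!)%:R * cderive N v x.

(* Classical solutions: continuous on [0, +oo[ and C^1 on ]0, +oo[ in time, with
   an absolutely convergent Caputo integral, and N times differentiable in
   space. *)
Record caputo_solution (alpha : R) (N : nat) (beta : R[i]) (f : R -> R)
    (u : R -> R -> R[i]) : Prop := {
  sol_initial : forall x, u 0 x = (f x)%:C ;
  sol_time_continuous : forall x,
    reim (fun v : R -> R => {within `[0, +oo[, continuous v}) (u^~ x) ;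
  sol_time_C1 : forall x,
    reim (fun v : R -> R => forall t : R, 0 < t ->
      derivable v t 1 /\ {for t, continuous (derive1 v)}) (u^~ x) ;
  sol_caputo_integrable : forall t x : R, 0 < t ->
    reim (fun v : R -> R => lebesgue_measure.-integrable `[0, t]
      (EFin \o caputo_integrand alpha t v)) (u^~ x) ;
  sol_space_derivable : forall t : R, 0 < t ->
    reim (fun v : R -> R => forall k x, (k < N)%N ->
      derivable (derive1n k v) x 1)
      (u t) ;
  sol_equation : forall t x : R, 0 < t ->
    ccaputo alpha (u^~ x) t = opA N beta (u t) x }.

(* By Bernstein's inequality, |v^(k)| <= C r^k on R for all k says that v is a
   bounded function of exponential type at most r. Functions that are Fourier
   transforms of complex measures supported in [-r, r] are of this kind. Some
   such growth restriction is needed for uniqueness: for beta != 0, as for the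
   heat equation, there are nonzero Tychonoff-type solutions growing rapidly in
   x with zero initial value. *)
Definition bounded_exp_type (u : R -> R -> R[i]) : Prop :=
  forall tmax : R, exists C r : R, forall t : R, 0 <= t <= tmax ->
    reim (fun v : R -> R => forall k x,
      derivable (derive1n k v) x 1 /\ `|derive1n k v x| <= C * r ^+ k) (u t).

Definition the_caputo_solution (alpha : R) (N : nat) (beta : R[i]) (f : R -> R)
    (u : R -> R -> R[i]) : Prop :=
  [/\ caputo_solution alpha N beta f u,
      bounded_exp_type u &
      forall v, caputo_solution alpha N beta f v -> bounded_exp_type v ->
        forall t x : R, 0 <= t -> v t x = u t x].

End CaputoProblem.

(* Main.v *)
(** Write [f x = mu (e^(-i l x))] with [mu] carried by [-r, r] and put
    [p l = beta (-i l)^N / N!], so that the operator [A = A_{N,beta}] multiplies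
    [e^(-i l x)] by [p l].  The series
      [u t x = sum_k t^(alpha k) / Gamma (alpha k + 1) (A^k f) x]
    converges since [|A^k f| <= C K^k], and solves the Caputo problem term by term, by the
    Beta integral.

    Uniqueness: let [w] be a solution with zero initial value and [|w^(k)| <= C r^k], and let
    [b t] be the solution of [D^alpha b = K b], [b 0 = 1].  If [|w| <= C q b] holds for all
    such [w], then, applied to difference quotients in [x], it bounds [|w^(N)|] by
    [C r^N q b], and a maximum principle for the Caputo derivative improves the bound to
    [|w| <= C (q / 2) b] when [K] is large; hence [w = 0].

    The walk: the mean of [e^(z xi)] over the [N]-th roots of [beta] is
    [1 + beta z^N / N! + O(z^(2 N))], because the intermediate power sums of the roots of unity
    vanish; for [z = -i l n^(-1/N)] its power of exponent [floor (n s)] tends to [e^(s p l)].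
    Conditioning on [L t], which is independent of the steps, the expectations converge to
    [E mu (e^(-i l x + L t p l))], and this is [u t x] because
    [E (L t)^k = k! t^(alpha k) / Gamma (alpha k + 1)].  Indeed [{L t > s} = {H s < t}] up to a
    null set, so by Tonelli both sides have Laplace transform [k! lambda^(- alpha k - 1)];
    integrating against [1 - exp (- e^(- n (x - t)))], a series of exponentials in [x] which
    tends to the indicator of [x < t] (Phragmen), shows that they coincide. *)
Require Import Defs.
From mathcomp Require Import all_boot all_order all_algebra.
From mathcomp Require Import complex ring lra.
From mathcomp Require Import all_classical all_reals all_analysis.
From mathcomp Require Import measurable_realfun.

Set Implicit Arguments.
Unset Strict Implicit.
Unset Printing Implicit Defensive.

Import Order.TTheory GRing.Theory Num.Theory.
Import numFieldNormedType.Exports.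

Local Open Scope classical_set_scope.
Local Open Scope ring_scope.
Local Open Scope complex_scope.

(** * Complex numbers and roots of unity *)

(** The integral against [mu] is handled only through its linearity over finite sums and a bound by
    the supremum over [[-r, r]]. Derivatives in [x], power series and walk asymptotics therefore all
    come from explicit remainder estimates, uniform in [l] on the support. In the uniqueness proof
    difference quotients replace derivatives in [x] because they are evidently solutions again,
    whereas for derivatives [d/dx] would first have to be exchanged with the Caputo operator. The
    limit at the random time needs one dominating function for all [n]. The mean of the walk at time
    [s] is at most [C e^(K s)] with [K] independent of [n], so it suffices that [L t] has all
    exponential moments; these follow from its power moments because the Mittag-Leffler series is
    entire. The hypotheses on the steps concern only their laws and independence, so the steps lie
    among the roots only almost surely; pointwise estimates are made on the event [regular]. *)

Section ComplexNorm.
Context {R : realType}.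
Implicit Types (z w : R[i]).

(** The l1 norm: submultiplicative, free of square roots, and a bound for both real and imaginary
    parts, the only data through which limits are defined here. *)
Definition cnorm z : R := `|complex.Re z| + `|complex.Im z|.

Lemma cnorm_ge0 z : 0 <= cnorm z. Proof. exact: addr_ge0. Qed.

Lemma ReD z w : complex.Re (z + w) = complex.Re z + complex.Re w.
Proof. by case: z; case: w. Qed.

Lemma ImD z w : complex.Im (z + w) = complex.Im z + complex.Im w.
Proof. by case: z; case: w. Qed.

Lemma ReN z : complex.Re (- z) = - complex.Re z. Proof. by case: z. Qed.

Lemma ImN z : complex.Im (- z) = - complex.Im z. Proof. by case: z. Qed.

Lemma ReB z w : complex.Re (z - w) = complex.Re z - complex.Re w.
Proof. by rewrite ReD ReN. Qed.

Lemma ImB z w : complex.Im (z - w) = complex.Im z - complex.Im w.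
Proof. by rewrite ImD ImN. Qed.

Lemma ReM z w : complex.Re (z * w) =
  complex.Re z * complex.Re w - complex.Im z * complex.Im w.
Proof. by case: z; case: w. Qed.

Lemma ImM z w : complex.Im (z * w) =
  complex.Re z * complex.Im w + complex.Im z * complex.Re w.
Proof. by case: z; case: w. Qed.

Lemma ReZ (a : R) z : complex.Re (a%:C * z) = a * complex.Re z.
Proof. by rewrite ReM /= mul0r subr0. Qed.

Lemma ImZ (a : R) z : complex.Im (a%:C * z) = a * complex.Im z.
Proof. by rewrite ImM /= mul0r addr0. Qed.

Lemma Re_sum I (s : seq I) (Q : pred I) (F : I -> R[i]) :
  complex.Re (\sum_(i <- s | Q i) F i) = \sum_(i <- s | Q i) complex.Re (F i).
Proof. exact: (big_morph _ ReD (erefl _)). Qed.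

Lemma Im_sum I (s : seq I) (Q : pred I) (F : I -> R[i]) :
  complex.Im (\sum_(i <- s | Q i) F i) = \sum_(i <- s | Q i) complex.Im (F i).
Proof. exact: (big_morph _ ImD (erefl _)). Qed.

Lemma complex_eta z : complex.Re z +i* complex.Im z = z.
Proof. by case: z. Qed.

Lemma complexP z w :
  complex.Re z = complex.Re w -> complex.Im z = complex.Im w -> z = w.
Proof. by case: z => a b; case: w => c d /= -> ->. Qed.

Lemma le_Re_cnorm z : `|complex.Re z| <= cnorm z.
Proof. by rewrite lerDl. Qed.

Lemma le_Im_cnorm z : `|complex.Im z| <= cnorm z.
Proof. by rewrite lerDr. Qed.

Lemma cnorm0 : cnorm 0 = 0. Proof. by rewrite /cnorm /= normr0 addr0. Qed.

Lemma cnorm1 : cnorm 1 = 1. Proof. by rewrite /cnorm /= normr0 normr1 addr0. Qed.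

Lemma cnormR (a : R) : cnorm a%:C = `|a|.
Proof. by rewrite /cnorm /= normr0 addr0. Qed.

Lemma cnormi : cnorm 'i%C = 1 :> R.
Proof. by rewrite /cnorm /= normr0 normr1 add0r. Qed.

Lemma cnormN z : cnorm (- z) = cnorm z.
Proof. by rewrite /cnorm ReN ImN !normrN. Qed.

Lemma cnormD z w : cnorm (z + w) <= cnorm z + cnorm w.
Proof. by rewrite /cnorm ReD ImD addrACA lerD// ler_normD. Qed.

Lemma cnormB z w : cnorm (z - w) <= cnorm z + cnorm w.
Proof. by rewrite -(cnormN w) cnormD. Qed.

Lemma cnormM z w : cnorm (z * w) <= cnorm z * cnorm w.
Proof.
rewrite /cnorm ReM ImM mulrDl !mulrDr -!normrM.
apply: (le_trans (lerD (ler_normB _ _) (ler_normD _ _))).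
by rewrite le_eqVlt; apply/orP; left; apply/eqP; ring.
Qed.

Lemma cnormZ (a : R) z : cnorm (a%:C * z) = `|a| * cnorm z.
Proof. by rewrite /cnorm ReZ ImZ !normrM mulrDr. Qed.

Lemma cnormX z n : cnorm (z ^+ n) <= cnorm z ^+ n.
Proof.
elim: n => [|n ih]; first by rewrite !expr0 cnorm1.
by rewrite !exprS (le_trans (cnormM _ _))// ler_wpM2l// cnorm_ge0.
Qed.

Lemma cnorm_sum I (s : seq I) (Q : pred I) (F : I -> R[i]) :
  cnorm (\sum_(i <- s | Q i) F i) <= \sum_(i <- s | Q i) cnorm (F i).
Proof.
elim/big_ind2 : _ => // [|a a' b b' ha hb]; first by rewrite cnorm0.
by rewrite (le_trans (cnormD _ _))// lerD.
Qed.

(** The l1 norm is the maximum of [s1 Re + s2 Im] over signs [s1], [s2]. Fixing the signs reduces a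
    complex estimate to a real-valued function, to which the mean value theorem applies. *)
Lemma cnorm_le (z : R[i]) (B : R) :
  (forall s1 s2 : R, s1 ^+ 2 = 1 -> s2 ^+ 2 = 1 ->
    s1 * complex.Re z + s2 * complex.Im z <= B) -> cnorm z <= B.
Proof.
move=> h; rewrite /cnorm.
have e (a : R) : exists s : R, s ^+ 2 = 1 /\ `|a| = s * a.
  have [a0|a0] := lerP 0 a; [exists 1|exists (-1)].
    by rewrite expr1n mul1r ger0_norm.
  by rewrite sqrrN expr1n mulN1r ltr0_norm.
have [s1 [s1E ->]] := e (complex.Re z).
have [s2 [s2E ->]] := e (complex.Im z).
exact: h.
Qed.

Lemma sign_le_cnorm z (s1 s2 : R) : s1 ^+ 2 = 1 -> s2 ^+ 2 = 1 ->
  s1 * complex.Re z + s2 * complex.Im z <= cnorm z.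
Proof.
have e (s a : R) : s ^+ 2 = 1 -> s * a <= `|a|.
  move=> /eqP; rewrite sqrf_eq1 => /orP[]/eqP ->.
    by rewrite mul1r ler_norm.
  by rewrite mulN1r -normrN ler_norm.
by move=> h1 h2; apply: lerD; apply: e.
Qed.

Lemma ccvg_cnorm (z_ : nat -> R[i]) l (e_ : nat -> R) :
  (\forall n \near \oo, cnorm (z_ n - l) <= e_ n) -> e_ @ \oo --> 0 -> ccvg z_ l.
Proof.
move=> h e0.
suff H (q : R[i] -> R) : (forall z w, q (z - w) = q z - q w) ->
    (forall z, `|q z| <= cnorm z) -> (fun n => q (z_ n)) @ \oo --> q l.
  by split; apply: H => //; [exact: ReB|exact: le_Re_cnorm|exact: ImB|exact: le_Im_cnorm].
move=> qB qle; apply/cvgrPdist_le => eps eps0.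
move/cvgrPdist_le : e0 => /(_ _ eps0) e0.
near=> n.
rewrite distrC -qB (le_trans (qle _))//.
apply: (@le_trans _ _ (e_ n)); first by near: n.
have : `|0 - e_ n| <= eps by near: n.
by rewrite sub0r normrN; apply: le_trans; exact: ler_norm.
Unshelve. all: by end_near. Qed.

End ComplexNorm.

(** * Taylor estimates for the complex exponential *)

Section ComplexExponential.
Context {R : realType}.
Implicit Types (z w : R[i]).

Lemma cexp0 : cexp (0 : R[i]) = 1.
Proof. by rewrite /cexp /= expR0 cos0 sin0 mulr1 mulr0. Qed.

Lemma cexpD z w : cexp (z + w) = cexp z * cexp w.
Proof.
apply: complexP; rewrite /cexp ?ReM ?ImM /= ReD ImD expRD ?cosD ?sinD; ring.
Qed.

Lemma cexpMn z n : cexp (n%:R * z) = cexp z ^+ n.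
Proof.
elim: n => [|n ih]; first by rewrite mul0r cexp0 expr0.
by rewrite -natr1 mulrDl mul1r cexpD ih exprSr.
Qed.

(** The imaginary part has to enter the bound: in the l1 norm a number of modulus 1 may exceed 1,
    and [|cos y| + |sin y| <= 1 + |y| <= e^|y|]. *)
Lemma cnorm_cexp z : cnorm (cexp z) <= expR (cnorm z).
Proof.
have e0 := expR_gt0 (complex.Re z).
rewrite /cnorm /= !normrM (gtr0_norm e0) -mulrDr expRD ler_pM//.
- by rewrite ler_expR ler_norm.
- rewrite (le_trans _ (expR_ge1Dx _))// lerD ?cos_max//.
  move: (complex.Im z) => b.
  suff H (x : R) : 0 <= x -> `|sin x| <= x.
    have [b0|b0] := lerP 0 b; first by rewrite (ger0_norm b0) H.
    by rewrite -normrN -sinN (ltr0_norm b0) H// oppr_ge0 ltW.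
  rewrite le_eqVlt => /predU1P[<-|x0]; first by rewrite sin0 normr0.
  have [c _] : exists2 c : R, c \in `]0, x[ & sin x - sin 0 = cos c * (x - 0).
    apply: (@MVT _ sin cos) => //.
    by apply: continuous_subspaceT => y; exact: continuous_sin.
  by rewrite sin0 !subr0 => ->; rewrite normrM (gtr0_norm x0) ler_piMl ?cos_max// ltW.
Qed.

Lemma ge0_derive_le (f g f' g' : R -> R) (a b : R) : a <= b ->
  (forall x : R, is_derive x 1 f (f' x)) -> (forall x : R, is_derive x 1 g (g' x)) ->
  (forall x, a < x < b -> f' x <= g' x) -> f a <= g a -> f b <= g b.
Proof.
rewrite le_eqVlt => /predU1P[->//|ab] df dg fg fga.
have dh (x : R) : is_derive x 1 (g \- f) (g' x - f' x) by exact: is_deriveB.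
have [c /andP cab] : exists2 c : R, c \in `]a, b[ &
    (g \- f) b - (g \- f) a = (g' c - f' c) * (b - a).
  apply: (@MVT _ (g \- f) (g' \- f') a b) => //.
  by apply/continuous_subspaceT => x; apply/differentiable_continuous/derivable1_diffP.
rewrite /= => h.
have : 0 <= (g' c - f' c) * (b - a).
  by rewrite mulr_ge0 ?subr_ge0 ?(ltW ab)// fg//; case: cab; rewrite !bnd_simp => -> ->.
by rewrite -h; lra.
Qed.

Lemma is_derive_cexp_line z (s1 s2 t : R) :
  is_derive t (1 : R) (fun t => s1 * complex.Re (cexp (t%:C * z)) +
                                s2 * complex.Im (cexp (t%:C * z)))
    (s1 * complex.Re (z * cexp (t%:C * z)) + s2 * complex.Im (z * cexp (t%:C * z))).
Proof.
case: z => a b.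
have -> : (fun t : R => s1 * complex.Re (cexp (t%:C * (a +i* b))) +
    s2 * complex.Im (cexp (t%:C * (a +i* b)))) = (fun t : R => s1 * (expR (t * a) * cos (t * b)) +
    s2 * (expR (t * a) * sin (t * b))).
  by apply/funext => x /=; rewrite !mul0r subr0 addr0.
apply: is_derive_eq => /=.
rewrite !mul0r ?subr0 ?addr0 /GRing.scale /=; ring.
Qed.

Lemma is_derive_monomial n (c x : R) :
  is_derive x (1 : R) (fun x => x ^+ n * c) (n%:R * x ^+ n.-1 * c).
Proof.
have h := is_deriveZ c (is_deriveX n (is_derive_id x (1 : R))).
have -> : (fun x : R => x ^+ n * c) = c \*: (id ^+ n : R -> R).
  by apply/funext => y; rewrite /GRing.scale /= mulrC exprfctE.
by apply: (is_derive_eq h); rewrite /GRing.scale /= mulr1 mulrC.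
Qed.

Definition ctaylor n z : R[i] := \sum_(j < n) (j`!%:R^-1 : R)%:C * z ^+ j.

(** Induction on [n] along the segment from [0] to [z]: the [t]-derivative of the remainder of order
    [n + 1] is [z] times the remainder of order [n], and the right-hand sides are related by the
    same differentiation. *)
Lemma cexp_taylor_line n z (t : R) : 0 <= t <= 1 ->
  cnorm (cexp (t%:C * z) - ctaylor n (t%:C * z)) <=
  (t * cnorm z) ^+ n / n`!%:R * expR (cnorm z).
Proof.
elim: n t => [|n ih] t /andP[t0 t1].
  rewrite /ctaylor big_ord0 subr0 expr0 fact0 divr1 mul1r.
  rewrite (le_trans (cnorm_cexp _))// ler_expR cnormZ ger0_norm//.
  by rewrite ler_piMl// cnorm_ge0.
apply: cnorm_le => s1 s2 hs1 hs2.
pose T m (t : R) := s1 * complex.Re (z * ctaylor m (t%:C * z)) + s2 * complex.Im (z * ctaylor m (t%:C * z)).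
(* With the signs fixed, [f] and [g] are the two sides to be compared and [f'], [g'] their
   derivatives; the induction hypothesis gives [f' <= g']. *)
pose f t := s1 * complex.Re (cexp (t%:C * z) - ctaylor n.+1 (t%:C * z)) +
            s2 * complex.Im (cexp (t%:C * z) - ctaylor n.+1 (t%:C * z)).
pose f' t := s1 * complex.Re (z * (cexp (t%:C * z) - ctaylor n (t%:C * z))) +
            s2 * complex.Im (z * (cexp (t%:C * z) - ctaylor n (t%:C * z))).
pose g (t : R) := (t * cnorm z) ^+ n.+1 / (n.+1)`!%:R * expR (cnorm z).
pose g' (t : R) := cnorm z * ((t * cnorm z) ^+ n / n`!%:R * expR (cnorm z)).
apply: (@ge0_derive_le f g f' g' 0 t) => //.
- move=> x.
  have -> : f = (fun x => s1 * complex.Re (cexp (x%:C * z)) + s2 * complex.Im (cexp (x%:C * z))) \-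
     (fun x => \sum_(j < n.+1) (x ^+ j * (s1 * complex.Re ((j`!%:R^-1 : R)%:C * z ^+ j) +
       s2 * complex.Im ((j`!%:R^-1 : R)%:C * z ^+ j)))).
    apply/funext => y; rewrite /f ReB ImB !mulrBr addrACA -opprD.
    rewrite /ctaylor Re_sum Im_sum.
    congr (_ - _); rewrite !mulr_sumr -big_split /=; apply: eq_bigr => j _.
    by rewrite exprMn -rmorphXn /= mulrCA !ReZ !ImZ; ring.
  have -> : f' x = s1 * complex.Re (z * cexp (x%:C * z)) + s2 * complex.Im (z * cexp (x%:C * z))
     - \sum_(j < n.+1) (j%:R * x ^+ j.-1 * (s1 * complex.Re ((j`!%:R^-1 : R)%:C * z ^+ j) +
       s2 * complex.Im ((j`!%:R^-1 : R)%:C * z ^+ j))).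
    rewrite /f' mulrBr ReB ImB !mulrBr addrACA -opprD.
    congr (_ - _); rewrite big_ord_recl !mul0r add0r /ctaylor mulr_sumr Re_sum Im_sum !mulr_sumr -big_split /=.
    apply: eq_bigr => j _.
    rewrite /bump leq0n add0n add1n factS natrM invfM.
    rewrite (_ : z * _ = (j`!%:R^-1 * x ^+ j)%:C * z ^+ j.+1); last first.
      by rewrite exprMn exprS rmorphM rmorphXn /=; ring.
    rewrite !ReZ !ImZ; set A := complex.Re _; set B := complex.Im _.
    have j0 : j.+1%:R != 0 :> R by rewrite pnatr_eq0.
    have f0 : j`!%:R != 0 :> R by rewrite pnatr_eq0 -lt0n fact_gt0.
    by move: (_ `!%:R) (_.+1%:R) f0 j0 => F J F0 J0; field; rewrite F0 J0.
  apply: is_deriveB; first exact: is_derive_cexp_line.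
  rewrite -[X in is_derive _ _ X _]fct_sumE.
  apply: is_derive_sum => j.
  exact: is_derive_monomial.
- move=> x; have := @is_derive_monomial n.+1 (cnorm z ^+ n.+1 / (n.+1)`!%:R * expR (cnorm z)) x.
  have -> : (fun x : R => x ^+ n.+1 * (cnorm z ^+ n.+1 / (n.+1)`!%:R * expR (cnorm z))) = g.
    by apply/funext => y; rewrite /g exprMn; ring.
  move=> h; apply: (is_derive_eq h); rewrite /g' /= exprMn exprS.
  rewrite factS natrM invfM.
  have j0 : n.+1%:R != 0 :> R by rewrite pnatr_eq0.
  have f0 : n`!%:R != 0 :> R by rewrite pnatr_eq0 -lt0n fact_gt0.
  move: (_ `!%:R) (_.+1%:R) f0 j0 => F J F0 J0.
  by field; rewrite F0 J0.
- move=> x /andP[x0 xt]; rewrite /f' /g'.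
  rewrite (le_trans (sign_le_cnorm _ hs1 hs2))// (le_trans (cnormM _ _))//.
  rewrite ler_wpM2l ?cnorm_ge0// ih// (ltW x0)/=.
  by rewrite (le_trans (ltW xt)).
- rewrite /f /g mul0r cexp0 /ctaylor big_ord_recl mul0r expr0 fact0 invr1 mulr1.
  rewrite big1 ?addr0 ?subrr; last by move=> j _; rewrite expr0n /= mulr0.
  by rewrite /= !mulr0 addr0 expr0n /= !mul0r.
Qed.

Lemma cexp_taylor n z :
  cnorm (cexp z - ctaylor n z) <= cnorm z ^+ n / n`!%:R * expR (cnorm z).
Proof.
by have := @cexp_taylor_line n z 1; rewrite ler01 lexx !mul1r; apply.
Qed.

Lemma expR_ge_term n (K : R) : 0 <= K -> K ^+ n / n`!%:R <= expR K.
Proof.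
case: n => [|n] K0; first by rewrite expr0 fact0 divr1 (le_trans _ (expR_ge1Dx K))// lerDl.
by rewrite (le_trans _ (expR_ge1Dxn n K0))// lerDr.
Qed.

Lemma sum_expR_le n (K : R) : 0 <= K -> \sum_(j < n) K ^+ j / j`!%:R <= expR K.
Proof.
move=> K0; rewrite -(big_mkord xpredT (fun j => K ^+ j / j`!%:R)).
have := nondecreasing_cvgn_le _ (is_cvg_series_exp_coeff K) n; apply.
by apply: nondecreasing_series => k _ _; rewrite exp_coeff_ge0.
Qed.

End ComplexExponential.

(** * Power sums of the roots of unity and the mean of the exponential over the roots *)

Section RootsOfUnity.
Context {R : realType}.
Variable (N : nat).
Hypothesis N0 : (0 < N)%N.

Definition unity_root (k : nat) : R[i] :=
  cexp ((2 * pi * k%:R / N%:R)%:C * 'i%C).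

Let NR : N%:R != 0 :> R. Proof. by rewrite pnatr_eq0 -lt0n. Qed.

Lemma unity_rootX k : unity_root k = unity_root 1 ^+ k.
Proof.
rewrite /unity_root -cexpMn; congr cexp.
rewrite mulrA; congr (_ * _).
rewrite -(rmorph_nat (real_complex R)) -rmorphM /=; congr (_%:C).
by rewrite mulr1 !mulrA; congr (_ / _); ring.
Qed.

Lemma unity_root_period : unity_root N = 1.
Proof.
rewrite /unity_root mulfK//; apply: complexP; rewrite /cexp /= !mul0r !mulr0 subrr.
  by rewrite expR0 mul1r addr0 mulr1 mulr_natl cos2pi.
by rewrite expR0 mul1r addr0 mulr1 mulr_natl sin2pi.
Qed.

(** With [y = pi k / N], a real part equal to 1 means [cos (2 y) = 1], so [sin y = 0], which is
    impossible for [0 < y < pi]. *)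
Lemma unity_root_neq1 k : (0 < k < N)%N -> unity_root k != 1.
Proof.
move=> /andP[k0 kN]; apply/negP => /eqP /(congr1 (@complex.Re R)).
rewrite /unity_root /cexp /= !mul0r !mulr0 subrr expR0 mul1r addr0 mulr1.
set y : R := pi * k%:R / N%:R.
have -> : 2 * pi * k%:R / N%:R = y *+ 2 by rewrite -mulr_natl /y; ring.
rewrite cos_mulr2n cos2sin2 => h.
have : sin y ^+ 2 = 0 by move: h; rewrite -[in LHS]mulr_natl; lra.
move/eqP; rewrite expf_eq0 /= => /eqP sy.
have : 0 < sin y.
  apply: sin_gt0_pi; rewrite /y divr_gt0 ?mulr_gt0 ?pi_gt0 ?ltr0n//=.
  by rewrite ltr_pdivrMr ?ltr0n// ltr_pM2l ?pi_gt0// ltr_nat.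
by rewrite sy ltxx.
Qed.

(** A geometric sum of ratio [unity_root (j %% N)]; for a ratio other than 1 it telescopes to zero
    after multiplication by the ratio minus 1. *)
Lemma sum_unity_root j :
  \sum_(k < N) unity_root k ^+ j = if (N %| j)%N then N%:R else 0.
Proof.
have e (k : nat) : unity_root k ^+ j = unity_root (j %% N) ^+ k.
  rewrite [in LHS]unity_rootX [in RHS]unity_rootX -!exprM.
  rewrite {1}(divn_eq j N) mulnDr exprD mulnA mulnC exprM mulnC.
  by rewrite -!unity_rootX unity_root_period expr1n mul1r mulnC.
under eq_bigr do rewrite e.
case: ifPn => [/eqP ->|Nj].
  by under eq_bigr do rewrite unity_rootX expr0 expr1n; rewrite sumr_const card_ord.
have jN : unity_root (j %% N) != 1.
  by apply: unity_root_neq1; rewrite ltn_mod N0 lt0n Nj.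
apply: (mulfI (x := unity_root (j %% N) - 1)); first by rewrite subr_eq0.
by rewrite -subrX1 -e unity_root_period expr1n subrr mulr0.
Qed.

(** The price of the l1 norm for a number of modulus 1, and the source of the factors 2 in later
    constants. *)
Lemma cnorm_unity_root k : cnorm (unity_root k) <= 2.
Proof.
rewrite /cnorm /unity_root /cexp /= !mul0r !mulr0 subrr expR0 !mul1r.
by rewrite (le_trans (lerD (cos_max _) (sin_max _))).
Qed.

Definition root_mean (b z : R[i]) : R[i] :=
  N%:R^-1 * \sum_(k < N) cexp (z * (b * unity_root k)).

(** Below degree [2 N] only the degrees [0] and [N] are divisible by [N], and all other power sums
    vanish. *)
Lemma ctaylor_root_mean (b z : R[i]) :
  N%:R^-1 * \sum_(k < N) ctaylor (2 * N) (z * (b * unity_root k)) =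
  1 + z ^+ N * b ^+ N / N`!%:R.
Proof.
rewrite /ctaylor exchange_big /= mulr_sumr.
under eq_bigr => j _.
  under eq_bigr => k _ do rewrite !exprMn mulrA mulrA.
  rewrite -mulr_sumr sum_unity_root.
  over.
have NC : N%:R != 0 :> R[i] by rewrite pnatr_eq0 -lt0n.
have N2 : (N < 2 * N)%N by rewrite mul2n -addnn -ltn_psubLR// subnn.
have z2 : (0 < 2 * N)%N by rewrite muln_gt0.
rewrite (bigD1 (Ordinal z2))//= dvdn0 fact0 !expr0 invr1 !mulr1 mul1r mulVf//.
rewrite (bigD1 (Ordinal N2))/=; last by rewrite -val_eqE /= -lt0n.
rewrite dvdnn big1 ?addr0.
  congr (_ + _); rewrite mulrC mulfK// fmorphV /= rmorph_nat mulrC//.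
move=> j /andP[j0 jN]; case: ifPn => [/dvdnP[q jq]|]; last by rewrite !mulr0.
exfalso; move: (ltn_ord j) j0 jN; rewrite -!val_eqE /= jq ltn_pmul2r//.
by case: q {jq} => [|[|]]//; rewrite ?mul0n ?mul1n ?eqxx.
Qed.

(** The step size [h] is kept apart from [z] so that the error is uniform on the support. For
    [h = n^(-1/N)] it is [O(n^-2)], which survives about [n] multiplications. *)
Lemma root_mean_expansion (b z : R[i]) (B r h : R) : cnorm b <= B -> 0 <= r ->
  0 <= h <= 1 -> cnorm z <= r ->
  cnorm (root_mean b (h%:C * z) - (1 + (h ^+ N)%:C * (z ^+ N * b ^+ N / N`!%:R))) <=
  h ^+ (2 * N) * ((2 * r * B) ^+ (2 * N) * expR (2 * r * B)).
Proof.
move=> bB r0 /andP[h0 h1] zr.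
have B0 : 0 <= B by rewrite (le_trans (cnorm_ge0 b)).
have zb k : cnorm (z * (b * unity_root k)) <= 2 * r * B.
  rewrite (le_trans (cnormM _ _))// mulrAC mulrC ler_pM ?cnorm_ge0//.
  by rewrite (le_trans (cnormM _ _))// mulrC ler_pM ?cnorm_ge0// cnorm_unity_root.
have -> : 1 + (h ^+ N)%:C * (z ^+ N * b ^+ N / N`!%:R) =
    1 + (h%:C * z) ^+ N * b ^+ N / N`!%:R.
  by rewrite exprMn rmorphXn /= !mulrA.
rewrite -ctaylor_root_mean /root_mean -mulrBr -sumrB.
rewrite -(rmorph_nat (real_complex R)) -fmorphV cnormZ ger0_norm ?invr_ge0 ?ler0n//.
rewrite mulrC ler_pdivrMr ?ltr0n//.
rewrite (le_trans (cnorm_sum _ _ _))//.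
rewrite mulr_natr -[X in _ *+ X]card_ord -sumr_const; apply: ler_sum => k _.
rewrite (le_trans (cexp_taylor _ _))//.
rewrite -[_ * z * _]mulrA cnormZ ger0_norm// exprMn -!mulrA ler_wpM2l ?exprn_ge0//.
have c0 := cnorm_ge0 (z * (b * unity_root k)).
rewrite (mulrA 2 r B) ler_pM ?exprn_ge0 ?mulr_ge0 ?invr_ge0 ?expR_ge0 ?ler0n//.
  by rewrite lerXn2r ?nnegrE ?mulr_ge0// (le_trans c0).
rewrite -[leRHS]mul1r ler_pM ?invr_ge0 ?expR_ge0 ?ler0n//.
  by rewrite invf_le1 ?ltr0n ?fact_gt0// ler1n fact_gt0.
by rewrite ler_expR (le_trans _ (zb k))// ler_piMl.
Qed.

End RootsOfUnity.

(** * Integration against a complex measure *)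

Section ComplexMeasurable.
Context {R : realType} {d : measure_display} {T : measurableType d}.
Implicit Types (g h : T -> R[i]).

Definition cmeasurable g : Prop :=
  reim (fun v : T -> R => measurable_fun [set: T] v) g.

Lemma cmeasurable_cst c : cmeasurable (fun=> c).
Proof. by split; exact: measurable_cst. Qed.

Lemma cmeasurableR (f : T -> R) : measurable_fun [set: T] f ->
  cmeasurable (fun x => (f x)%:C).
Proof. by move=> mf; split => //=; exact: measurable_cst. Qed.

Lemma cmeasurableD g h : cmeasurable g -> cmeasurable h ->
  cmeasurable (fun x => g x + h x).
Proof.
move=> [g1 g2] [h1 h2]; split.
  by under eq_fun do rewrite ReD; exact: measurable_funD.
by under eq_fun do rewrite ImD; exact: measurable_funD.
Qed.

Lemma cmeasurableM g h : cmeasurable g -> cmeasurable h ->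
  cmeasurable (fun x => g x * h x).
Proof.
move=> [g1 g2] [h1 h2]; split.
  by under eq_fun do rewrite ReM; apply: measurable_funB; exact: measurable_funM.
by under eq_fun do rewrite ImM; apply: measurable_funD; exact: measurable_funM.
Qed.

Lemma cmeasurableX g n : cmeasurable g -> cmeasurable (fun x => g x ^+ n).
Proof.
move=> mg; elim: n => [|n ih].
  by under eq_fun do rewrite expr0; exact: cmeasurable_cst.
by under eq_fun do rewrite exprS; exact: cmeasurableM.
Qed.

Lemma cmeasurable_sum I (s : seq I) (F : I -> T -> R[i]) :
  (forall i, cmeasurable (F i)) -> cmeasurable (fun x => \sum_(i <- s) F i x).
Proof.
move=> mF; elim: s => [|i s ih].
  by under eq_fun do rewrite big_nil; exact: cmeasurable_cst.
by under eq_fun do rewrite big_cons; exact: cmeasurableD.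
Qed.

Lemma cmeasurable_cexp g : cmeasurable g -> cmeasurable (fun x => cexp (g x)).
Proof.
move=> [g1 g2].
have mE : measurable_fun [set: T] (fun x => expR (complex.Re (g x))).
  by apply: measurableT_comp => //; exact: measurable_expR.
split => /=; apply: measurable_funM => //; apply: measurableT_comp => //.
  by apply: continuous_measurable_fun; exact: continuous_cos.
by apply: continuous_measurable_fun; exact: continuous_sin.
Qed.

Lemma cmeasurable_cvg (h : nat -> T -> R[i]) g :
  (forall n, cmeasurable (h n)) -> (forall x, ccvg (fun n => h n x) (g x)) ->
  cmeasurable g.
Proof.
move=> mh hg; split.
  apply: (@measurable_fun_cvg _ _ _ setT (fun n x => complex.Re (h n x))) => [n|x _].
    exact: (mh n).1.
  exact: (hg x).1.
apply: (@measurable_fun_cvg _ _ _ setT (fun n x => complex.Im (h n x))) => [n|x _].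
  exact: (mh n).2.
exact: (hg x).2.
Qed.

End ComplexMeasurable.

(** * Integrals against a charge of bounded support *)

Section ChargeIntegral.
Context {R : realType}.
Implicit Types (g h : R -> R).
Local Notation RT := (measurableTypeR R).

(** The bound on [g] is asked only on the support, because [e^(-i l z)] with non-real [z] is
    unbounded in [l]. *)
Lemma integrable_of_support (m : {finite_measure set RT -> \bar R}) (r C : R) g :
  m (~` `[- r, r]%classic) = 0%E -> measurable_fun [set: RT] (g : RT -> RT) ->
  (forall l, `|l| <= r -> `|g l| <= C) ->
  m.-integrable setT (EFin \o g) /\
  `|\int[m]_(l in setT) g l| <= C * fine (m setT).
Proof.
move=> m0 mg gC; set K := `[- r, r]%classic in m0.
have mK : measurable (K : set RT) by exact: measurable_itv.
have mCK : measurable (~` (K : set RT)) by exact: measurableC.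
have TK : setT `\` (~` K) = K by rewrite setTD setCK.
have KE l : K l -> `|l| <= r by rewrite /K /= in_itv /= ler_norml.
have mEg : measurable_fun [set: RT] (EFin \o (g : RT -> RT)) by exact/measurable_EFinP.
have iK : m.-integrable K (EFin \o g).
  apply: measurable_bounded_integrable => //.
  - by rewrite ltey_eq fin_num_measure.
  - exact: measurable_funTS.
  - exists C; split; first by rewrite num_real.
    move=> M CM l /KE lr; exact: le_trans (gC _ lr) (ltW CM).
have iT : m.-integrable setT (EFin \o g).
  by apply/(negligible_integrable mCK measurableT mEg m0); rewrite TK.
split=> //.
rewrite /Rintegral (negligible_integral mCK)// TK.
apply: (le_trans (le_normr_Rintegral mK iK)).
have Kfin : m K \is a fin_num by rewrite fin_num_measure.
have KT : fine (m K) = fine (m setT).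
  have : m ((K : set RT) `|` ~` (K : set RT)) = (m K + m (~` (K : set RT)))%E.
    by rewrite measureU ?setICr.
  by rewrite setUv => ->; rewrite [X in (_ + X)%E]m0 adde0.
rewrite -KT -Rintegral_cst//; apply: le_Rintegral => //.
- exact: integrable_norm.
- exact: finite_measure_integrable_cst.
- by move=> l /KE /gC.
Qed.

Variables (nu : {charge set RT -> \bar R}) (r : R).
Hypothesis nu0 : forall A : set RT, measurable A ->
  A `&` `[- r, r]%classic = set0 -> nu A = 0%E.

Let PN := projT2 (cid (projT2 (cid (Hahn_decomposition nu)))).
Let mC : measurable (~` (`[- r, r]%classic : set RT)).
Proof. by apply: measurableC; exact: measurable_itv. Qed.

(** A Jordan part evaluates [nu] on the intersection with a Hahn set, so the support condition is
    applied to a subset of the complement of [[-r, r]]. *)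
Let pos0 : jordan_pos PN (~` `[- r, r]%classic) = 0%E.
Proof.
rewrite jordan_posE cjordan_posE /crestr0 mem_set// /crestr.
have [[mP _] _ _ _] := PN.
apply: nu0; first exact: measurableI.
by rewrite setIAC setICl set0I.
Qed.

Let neg0 : jordan_neg PN (~` `[- r, r]%classic) = 0%E.
Proof.
rewrite jordan_negE cjordan_negE /crestr0 mem_set// /crestr.
have [_ [mN _] _ _] := PN.
rewrite nu0 ?oppe0//; first exact: measurableI.
by rewrite setIAC setICl set0I.
Qed.

Definition charge_mass : R := fine (jordan_pos PN setT) + fine (jordan_neg PN setT).

Lemma charge_mass_ge0 : 0 <= charge_mass.
Proof. by rewrite addr_ge0// fine_ge0. Qed.

Definition charge_admissible g : Prop :=
  measurable_fun [set: RT] (g : RT -> RT) /\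
  exists C, forall l, `|l| <= r -> `|g l| <= C.

Lemma charge_int_le g C : measurable_fun [set: RT] (g : RT -> RT) ->
  (forall l, `|l| <= r -> `|g l| <= C) -> `|charge_int nu g| <= charge_mass * C.
Proof.
move=> mg gC; rewrite /charge_int -/PN.
have [_ h1] := integrable_of_support pos0 mg gC.
have [_ h2] := integrable_of_support neg0 mg gC.
by rewrite (le_trans (ler_normB _ _))// mulrDl mulrC (mulrC (fine _)) lerD.
Qed.

Lemma charge_intD g h : charge_admissible g -> charge_admissible h ->
  charge_int nu (fun l => g l + h l) = charge_int nu g + charge_int nu h.
Proof.
move=> [mg [C gC]] [mh [D hD]]; rewrite /charge_int -/PN.
have [i1 _] := integrable_of_support pos0 mg gC.
have [i2 _] := integrable_of_support neg0 mg gC.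
have [i3 _] := integrable_of_support pos0 mh hD.
have [i4 _] := integrable_of_support neg0 mh hD.
by rewrite !RintegralD//; ring.
Qed.

Lemma charge_intZ a g : charge_admissible g ->
  charge_int nu (fun l => a * g l) = a * charge_int nu g.
Proof.
move=> [mg [C gC]]; rewrite /charge_int -/PN.
have [i1 _] := integrable_of_support pos0 mg gC.
have [i2 _] := integrable_of_support neg0 mg gC.
by rewrite !RintegralZl//; ring.
Qed.

Lemma charge_admissibleZ a g : charge_admissible g ->
  charge_admissible (fun l => a * g l).
Proof.
move=> [mg [C gC]]; split; first by apply: measurable_funM => //; exact: measurable_cst.
by exists (`|a| * C) => l /gC h; rewrite normrM ler_wpM2l.
Qed.

End ChargeIntegral.

Section ComplexIntegral.
Context {R : realType}.
Implicit Types (g h : R -> R[i]).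
Local Notation RT := (measurableTypeR R).
Variables (mu : complex_measure R) (r : R).
Hypothesis supp_mu : forall A : set RT, measurable A ->
  A `&` `[- r, r]%classic = set0 -> cm_re mu A = 0%E /\ cm_im mu A = 0%E.

Let s1 (A : set RT) : measurable A -> A `&` `[- r, r]%classic = set0 -> cm_re mu A = 0%E.
Proof. by move=> mA /(supp_mu mA)[]. Qed.

Let s2 (A : set RT) : measurable A -> A `&` `[- r, r]%classic = set0 -> cm_im mu A = 0%E.
Proof. by move=> mA /(supp_mu mA)[]. Qed.

(** This class contains the constants and [l], is closed under sums, products and [cexp], and on it
    the integral is linear; all integrands below belong to it. *)
Definition admissible g : Prop := @cmeasurable R _ RT g /\
  exists C, forall l, `|l| <= r -> cnorm (g l) <= C.

Lemma admissible_Re g : admissible g -> charge_admissible r (fun l => complex.Re (g l)).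
Proof.
move=> [[m1 m2] [C gC]]; split=> //; exists C => l /gC; apply: le_trans.
exact: le_Re_cnorm.
Qed.

Lemma admissible_Im g : admissible g -> charge_admissible r (fun l => complex.Im (g l)).
Proof.
move=> [[m1 m2] [C gC]]; split=> //; exists C => l /gC; apply: le_trans.
exact: le_Im_cnorm.
Qed.

Lemma admissibleD g h : admissible g -> admissible h -> admissible (fun l => g l + h l).
Proof.
move=> [mg [C gC]] [mh [D hD]]; split; first exact: cmeasurableD.
exists (C + D) => l lr; rewrite (le_trans (cnormD _ _))// lerD//; by [exact: gC|exact: hD].
Qed.

Lemma admissibleM g h : admissible g -> admissible h -> admissible (fun l => g l * h l).
Proof.
move=> [mg [C gC]] [mh [D hD]]; split; first exact: cmeasurableM.
exists (C * D) => l lr; rewrite (le_trans (cnormM _ _))// ler_pM ?cnorm_ge0//; by [exact: gC|exact: hD].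
Qed.

Lemma admissible_cst c : admissible (fun=> c).
Proof. by split; [exact: cmeasurable_cst|exists (cnorm c)]. Qed.

Lemma admissible_id : admissible (fun l => l%:C).
Proof.
split; first by apply: cmeasurableR; exact: measurable_id.
by exists r => l; rewrite cnormR.
Qed.

Lemma admissibleX g n : admissible g -> admissible (fun l => g l ^+ n).
Proof.
move=> ag; elim: n => [|n ih].
  by under eq_fun do rewrite expr0; exact: admissible_cst.
by under eq_fun do rewrite exprS; exact: admissibleM.
Qed.

Lemma admissible_sum I (s : seq I) (F : I -> R -> R[i]) :
  (forall i, admissible (F i)) -> admissible (fun l => \sum_(i <- s) F i l).
Proof.
move=> mF; elim: s => [|i s ih].
  by under eq_fun do rewrite big_nil; exact: admissible_cst.
by under eq_fun do rewrite big_cons; exact: admissibleD.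
Qed.

Lemma admissible_cexp g : admissible g -> admissible (fun l => cexp (g l)).
Proof.
move=> [mg [C gC]]; split; first exact: cmeasurable_cexp.
by exists (expR C) => l /gC h; rewrite (le_trans (cnorm_cexp _))// ler_expR.
Qed.

(** The factor 2 appears because each of the two charges is integrated against both the real and the
    imaginary part. *)
Definition complex_mass : R := 2 * (charge_mass (cm_re mu) + charge_mass (cm_im mu)).

Lemma complex_mass_ge0 : 0 <= complex_mass.
Proof. by rewrite mulr_ge0// addr_ge0// charge_mass_ge0. Qed.

Lemma complex_int_le g C : admissible g ->
  (forall l, `|l| <= r -> cnorm (g l) <= C) ->
  cnorm (complex_int mu g) <= complex_mass * C.
Proof.
move=> [[m1 m2] _] gC.
have gC1 l : `|l| <= r -> `|complex.Re (g l)| <= C.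
  by move=> /gC; apply: le_trans; exact: le_Re_cnorm.
have gC2 l : `|l| <= r -> `|complex.Im (g l)| <= C.
  by move=> /gC; apply: le_trans; exact: le_Im_cnorm.
have h1 := charge_int_le s1 m1 gC1.
have h2 := charge_int_le s2 m1 gC1.
have h3 := charge_int_le s1 m2 gC2.
have h4 := charge_int_le s2 m2 gC2.
rewrite /cnorm /complex_int /= /complex_mass.
apply: (le_trans (lerD (ler_normB _ _) (ler_normD _ _))).
by lra.
Qed.

Lemma complex_intD g h : admissible g -> admissible h ->
  complex_int mu (fun l => g l + h l) = complex_int mu g + complex_int mu h.
Proof.
move=> ag ah.
have [gr gi hr hi] := And4 (admissible_Re ag) (admissible_Im ag) (admissible_Re ah) (admissible_Im ah).
rewrite /complex_int.
under [X in charge_int _ X]eq_fun do rewrite ReD.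
under [X in _ - charge_int _ X]eq_fun do rewrite ImD.
under [X in _ +i* (charge_int _ X + _)]eq_fun do rewrite ReD.
under [X in _ +i* (_ + charge_int _ X)]eq_fun do rewrite ImD.
rewrite (charge_intD s1 gr hr) (charge_intD s2 gi hi) (charge_intD s2 gr hr) (charge_intD s1 gi hi).
by apply: complexP => /=; ring.
Qed.

Lemma complex_intZ c g : admissible g ->
  complex_int mu (fun l => c * g l) = c * complex_int mu g.
Proof.
move=> ag; have [gr gi] := conj (admissible_Re ag) (admissible_Im ag).
case: c => a b; rewrite /complex_int.
under [X in charge_int _ X]eq_fun do rewrite ReM -mulNr /=.
under [X in _ - charge_int _ X]eq_fun do rewrite ImM /=.
under [X in _ +i* (charge_int _ X + _)]eq_fun do rewrite ReM -mulNr /=.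
under [X in _ +i* (_ + charge_int _ X)]eq_fun do rewrite ImM /=.
have Z (k : R) (f : R -> R) : charge_admissible r f -> charge_admissible r (fun l => k * f l).
  by move=> af; exact: charge_admissibleZ.
rewrite (charge_intD s1 (Z _ _ gr) (Z _ _ gi)) (charge_intD s2 (Z _ _ gi) (Z _ _ gr)).
rewrite (charge_intD s2 (Z _ _ gr) (Z _ _ gi)) (charge_intD s1 (Z _ _ gi) (Z _ _ gr)).
rewrite !(charge_intZ s1 _ gr) !(charge_intZ s1 _ gi) !(charge_intZ s2 _ gr) !(charge_intZ s2 _ gi).
by apply: complexP => /=; ring.
Qed.

Lemma complex_int0 : complex_int mu (fun=> 0) = 0.
Proof.
have := @complex_intZ 0 (fun=> 0) (admissible_cst 0).
by under [X in complex_int mu X]eq_fun do rewrite mul0r; rewrite mul0r.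
Qed.

Lemma complex_int_sum I (s : seq I) (F : I -> R -> R[i]) :
  (forall i, admissible (F i)) ->
  complex_int mu (fun l => \sum_(i <- s) F i l) = \sum_(i <- s) complex_int mu (F i).
Proof.
move=> aF; elim: s => [|i s ih].
  by under eq_fun do rewrite big_nil; rewrite big_nil complex_int0.
under [X in complex_int mu X]eq_fun do rewrite big_cons.
by rewrite complex_intD ?ih ?big_cons//; exact: admissible_sum.
Qed.

Lemma complex_intB g h : admissible g -> admissible h ->
  complex_int mu (fun l => g l - h l) = complex_int mu g - complex_int mu h.
Proof.
move=> ag ah; under eq_fun do rewrite -(mulN1r (h _)).
rewrite complex_intD ?complex_intZ ?mulN1r//.
by apply: admissibleM => //; exact: admissible_cst.
Qed.

End ComplexIntegral.

Section QuadraticDerivative.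
Context {R : realType}.

(** Quadratic remainders can be summed and integrated, unlike differentiability itself; this is how
    series with moments as coefficients are differentiated. *)
Lemma is_derive_quadratic (f : R -> R) (x a K : R) :
  (forall h, `|h| <= 1 -> `|f (x + h) - f x - h * a| <= K * h ^+ 2) ->
  is_derive x 1 f a.
Proof.
move=> fK.
have K0 : 0 <= K.
  by have := fK 1; rewrite normr1 expr1n mulr1 lexx => /(_ isT); exact: le_trans.
have H : h^-1 *: ((f \o shift x) (h *: 1) - f x) @[h --> (0 : R)^'] --> a.
  apply/cvgrPdist_le => e e0; near=> h.
  have h0 : h != 0 by near: h; exact: nbhs_dnbhs_neq.
  have h1 : `|h| <= 1 by near: h; apply: dnbhs0_le.
  have h2 : `|h| <= e / (K + 1).
    by near: h; apply: dnbhs0_le; rewrite divr_gt0// ltr_wpDl.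
  rewrite distrC /GRing.scale /= mulr1 (addrC h).
  have -> : h^-1 * (f (x + h) - f x) - a = h^-1 * (f (x + h) - f x - h * a).
    by rewrite [in RHS]mulrBr mulKf.
  rewrite normrM normfV mulrC ler_pdivrMr ?normr_gt0//.
  rewrite (le_trans (fK _ h1))// -real_normK ?num_real// expr2 mulrA ler_wpM2r//.
  have : (K + 1) * `|h| <= e by rewrite mulrC -ler_pdivlMr// ltr_wpDl.
  apply: le_trans; rewrite ler_wpM2r//; lra.
apply: DeriveDef; first by apply/cvg_ex; exists a.
exact: cvg_lim H.
Unshelve. all: by end_near. Qed.

End QuadraticDerivative.

(** * The Fourier transform of a compactly supported measure and its derivatives *)

Section FourierMoments.
Context {R : realType}.
Local Notation RT := (measurableTypeR R).
Variables (mu : complex_measure R) (r : R).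
Hypothesis supp_mu : forall A : set RT, measurable A ->
  A `&` `[- r, r]%classic = set0 -> cm_re mu A = 0%E /\ cm_im mu A = 0%E.

(** The symbol of [d/dx]: differentiating [e^(-i l x)] multiplies it by [- i l]. *)
Definition iota_ (l : R) : R[i] := - 'i%C * l%:C.

Lemma cnorm_iota l : cnorm (iota_ l) = `|l|.
Proof. by rewrite /iota_ mulrC cnormZ cnormN cnormi mulr1. Qed.

Lemma cnorm_cexp_iota l (x : R) : cnorm (cexp (iota_ l * x%:C)) <= 2.
Proof.
have e : iota_ l * x%:C = (- (l * x))%:C * 'i%C.
  by rewrite /iota_ rmorphN rmorphM /=; ring.
rewrite e /cnorm /cexp /= !mul0r !mulr0 subrr expR0 !mul1r.
by rewrite (le_trans (lerD (cos_max _) (sin_max _))).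
Qed.

Lemma admissible_iota : admissible r iota_.
Proof. by apply: admissibleM; [exact: admissible_cst|exact: admissible_id]. Qed.

Lemma admissible_cexp_iota z : admissible r (fun l => cexp (iota_ l * z)).
Proof.
apply: admissible_cexp; apply: admissibleM; first exact: admissible_iota.
exact: admissible_cst.
Qed.

(* For j = 0 this is the Fourier transform, for j > 0 its j-th derivative. *)
Definition moment (j : nat) (z : R[i]) : R[i] :=
  complex_int mu (fun l => iota_ l ^+ j * cexp (iota_ l * z)).

Lemma fourierE z : fourier mu z = moment 0 z.
Proof. by rewrite /fourier /moment; under [in RHS]eq_fun do rewrite expr0 mul1r. Qed.

Lemma admissible_moment j z : admissible r (fun l => iota_ l ^+ j * cexp (iota_ l * z)).
Proof.
apply: admissibleM; last exact: admissible_cexp_iota.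
by apply: admissibleX; exact: admissible_iota.
Qed.

Lemma iotaX_le j l : `|l| <= r -> cnorm (iota_ l ^+ j) <= r ^+ j.
Proof.
move=> lr; rewrite (le_trans (cnormX _ _))// cnorm_iota lerXn2r ?nnegrE//.
exact: le_trans lr.
Qed.

Let V := complex_mass mu * 2.

Lemma moment_le j (x : R) : cnorm (moment j x%:C) <= V * r ^+ j.
Proof.
rewrite /V -mulrA; apply: (complex_int_le supp_mu); first exact: admissible_moment.
move=> l lr; rewrite (le_trans (cnormM _ _))// mulrC ler_pM ?cnorm_ge0//.
  exact: cnorm_cexp_iota.
exact: iotaX_le.
Qed.

(** The Taylor estimate of the exponential under the integral. Order 0 bounds the growth on the
    complex plane, order 2 gives differentiability in [x], and all orders together give the entire
    power series. *)
Lemma moment_taylor n j (x : R) z :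
  cnorm (moment j (x%:C + z) - \sum_(i < n) (i`!%:R^-1 : R)%:C * z ^+ i * moment (j + i) x%:C) <=
  V * r ^+ j * ((r * cnorm z) ^+ n / n`!%:R * expR (r * cnorm z)).
Proof.
rewrite /moment.
under eq_bigr => i _.
  rewrite -(complex_intZ supp_mu); last exact: admissible_moment.
  over.
rewrite -(complex_int_sum supp_mu); last first.
  move=> i; apply: admissibleM; first exact: admissible_cst.
  exact: admissible_moment.
rewrite -(complex_intB supp_mu); first last.
- apply: admissible_sum => i; apply: admissibleM; first exact: admissible_cst.
  exact: admissible_moment.
- exact: admissible_moment.
rewrite /V -2!mulrA; apply: (complex_int_le supp_mu).
  apply: admissibleD; first exact: admissible_moment.
  under eq_fun do rewrite -mulN1r.
  apply: admissibleM; first exact: admissible_cst.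
  apply: admissible_sum => i; apply: admissibleM; first exact: admissible_cst.
  exact: admissible_moment.
move=> l lr.
have r0 : 0 <= r by exact: le_trans lr.
rewrite (_ : _ - _ = iota_ l ^+ j * (cexp (iota_ l * x%:C) *
    (cexp (iota_ l * z) - ctaylor n (iota_ l * z)))); last first.
  rewrite mulrDr cexpD !mulrBr; congr (_ - _).
  rewrite /ctaylor !mulr_sumr; apply: eq_bigr => i _.
  have aux (c a b d e : R[i]) : c * a * ((b * d) * e) = b * (e * (c * (d * a))) by ring.
  by rewrite exprD [(iota_ l * z) ^+ i]exprMn; exact: aux.
rewrite mulrCA (le_trans (cnormM _ _))// ler_pM ?cnorm_ge0// ?cnorm_cexp_iota//.
rewrite (le_trans (cnormM _ _))// ler_pM ?cnorm_ge0// ?iotaX_le//.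
rewrite (le_trans (cexp_taylor _ _))//.
have zr : cnorm (iota_ l * z) <= r * cnorm z.
  by rewrite (le_trans (cnormM _ _))// cnorm_iota ler_wpM2r ?cnorm_ge0.
rewrite ler_pM ?mulr_ge0 ?exprn_ge0 ?cnorm_ge0 ?invr_ge0 ?expR_ge0 ?ler_expR//.
by rewrite ler_wpM2r ?invr_ge0// lerXn2r ?nnegrE ?mulr_ge0 ?cnorm_ge0.
Qed.

Lemma moment_diff_le j (x h : R) : `|h| <= 1 ->
  cnorm (moment j (x + h)%:C - moment j x%:C - h%:C * moment j.+1 x%:C) <=
  V * r ^+ j * (r ^+ 2 / 2 * expR `|r|) * h ^+ 2.
Proof.
move=> h1; have := @moment_taylor 2 j x h%:C.
rewrite big_ord_recl big_ord1 /= /bump /= addn0 addn1 expr0 expr1 fact0 invr1.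
rewrite rmorph1 !mul1r opprD addrA -rmorphD /=.
move=> /le_trans; apply.
have V0 : 0 <= V by rewrite mulr_ge0 ?complex_mass_ge0.
have Vr : 0 <= V * r ^+ j.
  by have := moment_le j 0; apply: le_trans; exact: cnorm_ge0.
rewrite -[leRHS]mulrA ler_wpM2l// cnormR exprMn real_normK ?num_real//.
rewrite (_ : 2`!%:R = 2)// [leLHS](_ : _ = r ^+ 2 * 2^-1 * h ^+ 2 * expR (r * `|h|)); last ring.
rewrite [leRHS](_ : _ = r ^+ 2 * 2^-1 * h ^+ 2 * expR `|r|); last ring.
apply: ler_wpM2l; first by rewrite mulr_ge0 ?sqr_ge0// mulr_ge0 ?sqr_ge0// invr_ge0.
rewrite ler_expR.
by rewrite (le_trans (ler_norm _))// normrM normr_id ler_piMr.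
Qed.

Lemma cvg_exp_tail (K C : R) : (fun n => C * (K ^+ n / n`!%:R)) @ \oo --> 0.
Proof.
rewrite -(mulr0 C); apply: cvgM; first exact: cvg_cst.
by have := @cvg_series_cvg_0 _ _ _ (is_cvg_series_exp_coeff K).
Qed.

Lemma fourier_ccvg (x : R) z :
  ccvg (fun n => \sum_(i < n) (i`!%:R^-1 : R)%:C * z ^+ i * moment i x%:C) (fourier mu (x%:C + z)).
Proof.
have h := @cvg_exp_tail (r * cnorm z) (V * expR (r * cnorm z)).
apply: ccvg_cnorm h; apply: nearW => n.
rewrite -cnormN opprB fourierE (le_trans (moment_taylor n 0 x z))//.
by rewrite expr0 mulr1 le_eqVlt -[X in _ || X]/(_ < _) mulrA mulrAC eqxx.
Qed.

Lemma fourier_le z : cnorm (fourier mu z) <= V * expR (r * cnorm z).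
Proof.
have := moment_taylor 0 0 0 z.
by rewrite big_ord0 subr0 !expr0 mulr1 fact0 divr1 mul1r add0r -fourierE.
Qed.

(** The composition is a pointwise limit of polynomials in [g], so measurability follows from
    closure under sums, products and limits. *)
Lemma cmeasurable_fourier {d} {T : measurableType d} (g : T -> R[i]) (x : R) :
  cmeasurable g -> cmeasurable (fun w => fourier mu (x%:C + g w)).
Proof.
move=> mg; apply: cmeasurable_cvg => [|w]; last exact: fourier_ccvg.
move=> n; apply: cmeasurable_sum => i; apply: cmeasurableM; last exact: cmeasurable_cst.
by apply: cmeasurableM; [exact: cmeasurable_cst|exact: cmeasurableX].
Qed.

End FourierMoments.

(** * Gamma and Beta integrals *)

Section AffineSubstitution.
Context {R : realType}.
Local Notation mu := (@lebesgue_measure R).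
Local Notation RT := (measurableTypeR R).
Local Open Scope ereal_scope.

(** The rescaled pushforward is a measure that agrees with Lebesgue measure on half-open intervals,
    hence everywhere. *)
Lemma lebesgue_measure_affine (c e : R) (A : set RT) : (0 < c)%R -> measurable A ->
  c%:E * pushforward mu (fun x : RT => (c * x + e)%R : RT) A = mu A.
Proof.
move=> c0 mA.
have mphi : measurable_fun [set: RT] (fun x : RT => (c * x + e)%R : RT).
  by apply: measurable_funD => //; apply: measurable_funM.
pose m := mscale (NngNum (ltW c0))
  (measure_function_pushforward__canonical__measure_function_Measure mu mphi).
apply/esym; apply: (@lebesgue_measure_unique _ m) => // _ [[a b]] _ <-.
have E : (fun x : RT => (c * x + e)%R) @^-1` [set` `]a, b]] =
    [set` `](c^-1 * (a - e))%R, (c^-1 * (b - e))%R]].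
  apply/seteqP; split => x /=; rewrite !in_itv/= => /andP[h1 h2]; apply/andP.
    by rewrite ltr_pdivrMl// ler_pdivlMl//; split; lra.
  by move: h1 h2; rewrite ltr_pdivrMl// ler_pdivlMl// => h1 h2; split; lra.
rewrite [RHS](_ : _ = c%:E * mu [set` `](c^-1 * (a - e))%R, (c^-1 * (b - e))%R]]); last by rewrite -E.
rewrite !lebesgue_measure_itv/= !lte_fin ltr_pM2l ?invr_gt0// ltrD2r.
case: ifPn => // _; last by rewrite mule0.
by rewrite -!EFinB -EFinM; congr EFin; field; rewrite gt_eqF.
Qed.

Lemma integral_affine (c e : R) (f : R -> \bar R) : (0 < c)%R ->
  measurable_fun [set: RT] (f : RT -> \bar R) -> (forall x, 0 <= f x) ->
  \int[mu]_x f x = c%:E * \int[mu]_x f (c * x + e)%R.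
Proof.
move=> c0 mf f0.
have mphi : measurable_fun [set: RT] (fun x : RT => (c * x + e)%R : RT).
  by apply: measurable_funD => //; apply: measurable_funM.
pose m := mscale (NngNum (ltW c0))
  (measure_function_pushforward__canonical__measure_function_Measure mu mphi).
transitivity (\int[m]_x f x).
  apply: eq_measure_integral => A mA _.
  exact/esym/lebesgue_measure_affine.
rewrite ge0_integral_mscale//; congr (_ * _).
by rewrite ge0_integral_pushforward.
Qed.

End AffineSubstitution.

Section ImproperFTC.
Context {R : realType}.
Local Notation mu := (@lebesgue_measure R).

(** The integrand may blow up at [a], as [x^(a - 1)] does at [0] for [a < 1]. The theorem for
    [[u n, b]] with [u n] decreasing to [a] passes to the limit by monotone convergence. *)
Lemma ge0_FTC2_left (f F : R -> R) (a b : R) : a < b ->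
  (forall x, a < x <= b -> 0 <= f x) ->
  (forall x, a < x -> {for x, continuous f}) ->
  (forall x, a < x -> is_derive x 1 F (f x)) ->
  F x @[x --> a^'+] --> F a ->
  (\int[mu]_(x in `]a, b]) (f x)%:E = (F b - F a)%:E)%E.
Proof.
move=> ab f0 cf dF Fa.
pose u (n : nat) : R := a + (b - a) / n.+2%:R.
have ba0 : 0 < b - a by rewrite subr_gt0.
have au n : a < u n by rewrite /u ltrDl divr_gt0.
have ub n : u n < b.
  rewrite /u -ltrBrDl ltr_pdivrMr// ltr_pMr// ltr1n//.
have un : {homo u : m n / (m <= n)%N >-> n <= m}.
  move=> m n mn; rewrite /u lerD2l ler_wpM2l ?(ltW ba0)// lef_pV2 ?posrE//.
  by rewrite ler_nat.
have ua : u @ \oo --> a.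
  rewrite -[X in _ --> X]addr0; apply: cvgD; first exact: cvg_cst.
  rewrite -(mulr0 (b - a)); apply: cvgM; first exact: cvg_cst.
  have := @cvg_harmonic R; rewrite -(cvg_shiftn 1) /= /harmonic.
  by under eq_fun do rewrite addn1.
pose D n : set R := `[u n, b]%classic.
have DU : \bigcup_n D n = `]a, b]%classic.
  apply/seteqP; split => x.
    case=> n _; rewrite /D /= !in_itv/= => /andP[h1 ->]; rewrite andbT.
    exact: lt_le_trans (au n) h1.
  rewrite /= in_itv/= => /andP[ax xb].
  have : \forall n \near \oo, u n < x by exact: (cvgr_lt a).
  case=> n _ /(_ n (leqnn _)) ux; exists n => //.
  by rewrite /D /= in_itv/= xb (ltW ux).
have mf : measurable_fun `]a, b] (EFin \o f).
  apply/measurable_EFinP.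
  apply: (@measurable_funS _ _ _ _ `]a, +oo[%classic) => //.
    by apply: subset_itvl; rewrite bnd_simp.
  apply: open_continuous_measurable_fun => // x; rewrite inE/= in_itv/= andbT.
  exact: cf.
have Dc n : {within `[u n, b], continuous f}.
  apply: continuous_in_subspaceT => x; rewrite inE/= in_itv/= => /andP[h1 _].
  by apply: cf; exact: lt_le_trans (au n) h1.
have FD n : (\int[mu]_(x in D n) (f x)%:E = (F b - F (u n))%:E)%E.
  rewrite (@continuous_FTC2 _ f F)//.
  - split.
    + move=> x; rewrite in_itv/= => /andP[h1 _].
      by have [] := dF x (lt_trans (au n) h1).
    + apply: cvg_at_right_filter; have [dFu _] := dF _ (au n).
      by apply: differentiable_continuous; exact/derivable1_diffP.
    + apply: cvg_at_left_filter; have [dFu _] := dF _ ab.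
      by apply: differentiable_continuous; exact/derivable1_diffP.
  - move=> x; rewrite in_itv/= => /andP[h1 _]; rewrite derive1E.
    by have [_ ->] := dF x (lt_trans (au n) h1).
have : (\int[mu]_(x in D n) (f x)%:E)%E @[n --> \oo] --> (\int[mu]_(x in `]a, b]) (f x)%:E)%E.
  rewrite -DU; apply: ge0_nondecreasing_set_cvg_integral.
  - move=> m n mn; apply/subsetPset => x; rewrite /D /= !in_itv/= => /andP[h1 ->].
    by rewrite andbT (le_trans _ h1)// un.
  - by move=> n; exact: measurable_itv.
  - move=> n; apply: measurable_funS mf => //.
    by apply: subset_itvr; rewrite bnd_simp.
  - move=> n x; rewrite /D /= in_itv/= => /andP[h1 h2].
    by rewrite lee_fin f0// h2 (lt_le_trans (au n) h1).
move/cvg_lim => <-//; apply/cvg_lim => //.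
under eq_fun do rewrite FD.
apply: cvg_EFin; first exact: nearW.
apply: cvgB; first exact: cvg_cst.
by move/cvg_at_rightP : Fa; apply.
Qed.

Lemma integral_powR (a u : R) : 0 < a -> 0 < u ->
  (\int[mu]_(x in `]0%R, u]) (x `^ (a - 1))%:E = (a^-1 * u `^ a)%:E)%E.
Proof.
move=> a0 u0.
have -> : a^-1 * u `^ a = a^-1 * u `^ a - a^-1 * 0 `^ a.
  by rewrite powR0 ?gt_eqF// mulr0 subr0.
apply: (@ge0_FTC2_left (fun x => x `^ (a - 1)) (fun x => a^-1 * x `^ a)) => //.
- by move=> x _; exact: powR_ge0.
- by move=> x x0; apply: differentiable_continuous; apply/derivable1_diffP; apply: derivable_powR; rewrite in_itv/= x0.
- move=> x x0; apply: (is_derive_eq (is_deriveZ a^-1 (is_derive1_powR a x0))).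
  by rewrite /GRing.scale /= mulKf ?gt_eqF.
- rewrite powR0 ?gt_eqF// mulr0 -[X in _ --> X](mulr0 a^-1).
  by apply: cvgM; [exact: cvg_cst|exact: powR_cvg0].
Qed.

Lemma integral_expR_Iy (c u : R) : 0 < c ->
  (\int[mu]_(x in `[u, +oo[) (expR (- (c * x)))%:E = (c^-1 * expR (- (c * u)))%:E)%E.
Proof.
move=> c0.
have dF (x : R) : is_derive x 1 (fun x => - (c^-1 * expR (- (c * x)))) (expR (- (c * x))).
  apply: is_derive_eq; rewrite /GRing.scale /= ?mulr1 ?mulr0 ?addr0.
  by field; rewrite gt_eqF.
have cF (x : R) : {for x, continuous (fun x : R => expR (- (c * x)))}.
  apply: continuous_comp; last exact: continuous_expR.
  by apply: continuousN; apply: continuousM; [exact: cst_continuous|exact: cvg_id].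
rewrite (@ge0_continuous_FTC2y _ _ (fun x => - (c^-1 * expR (- (c * x)))) _ 0)//.
- by rewrite -EFinB sub0r opprK.
- by apply: continuous_subspaceT => x; exact: cF.
- rewrite -oppr0 -(mulr0 c^-1); apply: cvgN; apply: cvgM; first exact: cvg_cst.
  have h : c * x @[x --> +oo] --> +oo by apply: gt0_cvgMry => //; exact: cvg_id.
  exact: (cvg_comp _ _ h (@cvgr_expR R)).
- by apply: cvg_at_right_filter; apply: cvgN; apply: cvgM; [exact: cvg_cst|exact: cF].
- by move=> x _; rewrite derive1E; have [_ ->] := dF x.
Qed.

End ImproperFTC.

(** * The Gamma function, its Laplace transform formula and the Beta integral *)

Section GammaFunction.
Context {R : realType}.
Local Notation mu := (@lebesgue_measure R).
Local Notation RT := (measurableTypeR R).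
Implicit Types (a b x t : R).

(** Extended by zero to the line, so that translations and convolutions are integrals over the whole
    line. *)
Definition gamma_density a : R -> R :=
  (fun x => x `^ (a - 1) * expR (- x)) \_ `]0, +oo[.

Lemma gamma_densityE a x : 0 < x -> gamma_density a x = x `^ (a - 1) * expR (- x).
Proof. by move=> x0; rewrite /gamma_density patchE mem_set//= in_itv/= x0. Qed.

Lemma gamma_density0 a x : x <= 0 -> gamma_density a x = 0.
Proof.
move=> x0; rewrite /gamma_density patchE memNset//= in_itv/= andbT.
by apply/negP; rewrite -leNgt.
Qed.

Lemma gamma_density_ge0 a x : 0 <= gamma_density a x.
Proof.
have [/gamma_density0 ->//|x0] := leP x 0.
by rewrite gamma_densityE// mulr_ge0 ?powR_ge0 ?expR_ge0.
Qed.

Lemma measurable_gamma_density a : measurable_fun [set: RT] (gamma_density a : RT -> RT).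
Proof.
apply/measurable_restrict => //; apply: measurable_funTS.
apply: measurable_funM; first exact: measurable_powR.
by apply: measurableT_comp; [exact: measurable_expR|exact: measurable_funN].
Qed.

Definition egamma a : \bar R := (\int[mu]_x (gamma_density a x)%:E)%E.

Lemma egamma_ge0 a : (0 <= egamma a)%E.
Proof. by apply: integral_ge0 => x _; rewrite lee_fin gamma_density_ge0. Qed.

Lemma egamma_fin a : 0 < a -> egamma a \is a fin_num.
Proof.
move=> a0; rewrite ge0_fin_numE ?egamma_ge0//.
(* Since [n >= a - 1], one has [x^(a - 1) <= x^n] for [x >= 1], and [x^n <= n! 2^n e^(x / 2)] spends
   half of the exponential decay; this is the constant [C]. *)
pose n := (Num.truncn a).+1.
pose f1 : R -> R := (fun x => x `^ (a - 1)) \_ `]0, 1].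
pose C : R := n`!%:R * 2 ^+ n.
pose f2 : R -> R := (fun x => C * expR (- (2^-1 * x))) \_ `[1, +oo[.
have m1 : measurable_fun [set: RT] (f1 : RT -> RT).
  by apply/measurable_restrict => //; apply: measurable_funTS; exact: measurable_powR.
have m2 : measurable_fun [set: RT] (fun x : RT => C * expR (- (2^-1 * x)) : RT).
  apply: measurable_funM => //; apply: measurableT_comp; first exact: measurable_expR.
  by apply: measurableT_comp => //; exact: measurable_funM.
have m2' : measurable_fun [set: RT] (f2 : RT -> RT).
  by apply/measurable_restrict => //; exact: measurable_funTS.
have C0 : 0 <= C by rewrite mulr_ge0// exprn_ge0.
have f10 x : 0 <= f1 x by apply: restrict_ge0 => y _; exact: powR_ge0.
have f20 x : 0 <= f2 x by apply: restrict_ge0 => y _; rewrite mulr_ge0// expR_ge0.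
apply: (@le_lt_trans _ _ (\int[mu]_x ((f1 x)%:E + (f2 x)%:E))%E).
  apply: ge0_le_integral => //.
  - by move=> x _; rewrite lee_fin gamma_density_ge0.
  - by apply/measurable_EFinP; exact: measurable_gamma_density.
  - by apply: emeasurable_funD; apply/measurable_EFinP.
  - move=> x _; rewrite -EFinD lee_fin.
    have [x0|x0] := leP x 0; first by rewrite gamma_density0// addr_ge0.
    rewrite gamma_densityE//; have [x1|x1] := leP x 1.
      apply: ler_wpDr => //; rewrite /f1 patchE mem_set/=; last by rewrite in_itv/= x0.
      by rewrite ler_piMr ?powR_ge0// expR_le1 oppr_le0 ltW.
    apply: ler_wpDl => //; rewrite /f2 patchE mem_set/=; last by rewrite in_itv/= ltW.
    have -> : expR (- x) = expR (- (2^-1 * x)) * expR (- (2^-1 * x)) by rewrite -expRD; congr expR; lra.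
    rewrite mulrA ler_wpM2r ?expR_ge0// expRN ler_pdivrMr ?expR_gt0//.
    apply: (@le_trans _ _ (x ^+ n)).
      rewrite -powR_mulrn ?(ltW x0)// ler_powR ?(ltW x1)//.
      have := truncnS_gt a; rewrite -/n; lra.
    rewrite -[x in x ^+ n](_ : 2 * (2^-1 * x) = x); last by lra.
    rewrite exprMn /C -mulrA mulrCA ler_wpM2l ?exprn_ge0// mulrC -?mulrA.
    rewrite (mulrC x).
    by rewrite [leRHS]mulrC -ler_pdivrMr ?ltr0n ?fact_gt0//; apply: expR_ge_term; lra.
rewrite ge0_integralD//=; first last.
- by apply/measurable_EFinP.
- by move=> x _; rewrite lee_fin.
- by apply/measurable_EFinP.
- by move=> x _; rewrite lee_fin.
have -> : (\int[mu]_x (f1 x)%:E = (a^-1)%:E)%E.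
  have := integral_powR a0 ltr01; rewrite powR1 mulr1 => <-.
  rewrite [RHS]integral_mkcond; apply: eq_integral => x _.
  by rewrite /f1 !patchE; case: ifP.
have -> : (\int[mu]_x (f2 x)%:E = \int[mu]_(x in `[1%R, +oo[) (C * expR (- (2^-1 * x)))%:E)%E.
  rewrite [RHS]integral_mkcond; apply: eq_integral => x _.
  by rewrite /f2 !patchE; case: ifP.
under eq_integral do rewrite EFinM.
rewrite ge0_integralZl//; first last.
- apply: measurable_funTS; apply/measurable_EFinP; apply: measurableT_comp; first exact: measurable_expR.
  by apply: measurableT_comp => //; exact: measurable_funM.
by rewrite integral_expR_Iy// -EFinM -EFinD ltry.
Qed.

Lemma GammaE a : Gamma a = fine (egamma a).
Proof.
rewrite /Gamma /Rintegral /egamma integral_mkcond; congr fine.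
apply: eq_integral => x _; rewrite /gamma_density !patchE.
by case: ifP.
Qed.

Lemma egammaE a : 0 < a -> egamma a = (Gamma a)%:E.
Proof. by move=> a0; rewrite GammaE fineK// egamma_fin. Qed.

(** Only the part of the integral over []M, M + 1]] is kept. The freedom in [M] later shows that
    Gamma outgrows every geometric sequence. *)
Lemma Gamma_lb a (M c : R) : 0 < a -> 0 <= M -> 0 <= c ->
  (forall x, M < x <= M + 1 -> c <= x `^ (a - 1)) -> c * expR (- (M + 1)) <= Gamma a.
Proof.
move=> a0 M0 c0 h; rewrite -lee_fin -egammaE//.
apply: (@le_trans _ _ (\int[mu]_(x in `]M, (M + 1)%R]) (c * expR (- (M + 1)))%:E)%E).
  rewrite integral_cst//= lebesgue_measure_itv/= lte_fin ltrDl ltr01.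
  by rewrite -EFinB addrAC subrr add0r mule1.
rewrite /egamma integral_mkcond; apply: ge0_le_integral => //.
- move=> x _; rewrite patchE; case: ifP => // _.
  by rewrite lee_fin mulr_ge0 ?expR_ge0.
- by apply/(measurable_restrictT _ _).1 => //; exact: measurable_cst.
- by apply/measurable_EFinP; exact: measurable_gamma_density.
- move=> x _; rewrite patchE; case: ifPn => [|_]; last by rewrite lee_fin gamma_density_ge0.
  rewrite inE /= in_itv/= => /andP[Mx xM].
  have x0 : 0 < x by exact: le_lt_trans Mx.
  rewrite gamma_densityE// lee_fin ler_pM ?expR_ge0 ?h ?Mx//.
  by rewrite ler_expR lerN2.
Qed.

Lemma Gamma_ge a (M : R) : 1 <= a -> 0 <= M -> M `^ (a - 1) * expR (- (M + 1)) <= Gamma a.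
Proof.
move=> a1 M0; apply: Gamma_lb => //; [lra|exact: powR_ge0|].
move=> x /andP[Mx _]; rewrite ge0_ler_powR ?nnegrE//; [lra|lra|exact: ltW].
Qed.

Lemma Gamma_gt0 a : 0 < a -> 0 < Gamma a.
Proof.
move=> a0; have [a1|a1] := leP 1 a.
  apply: lt_le_trans (Gamma_ge a1 ler01).
  by rewrite powR1 mul1r expR_gt0.
apply: lt_le_trans (@Gamma_lb a 1 (2 `^ (a - 1)) _ _ _ _) => //.
- move=> x /andP[x1 x2].
  have -> : a - 1 = - (1 - a) by lra.
  rewrite !powRN lef_pV2 ?posrE ?powR_gt0//; last lra.
  by rewrite ge0_ler_powR ?nnegrE//; lra.
Qed.

Lemma laplace_powR a (l : R) : 0 < a -> 0 < l ->
  (\int[mu]_(x in `]0%R, +oo[) (expR (- (l * x)) * x `^ (a - 1))%:E =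
    (Gamma a * l `^ (- a))%:E)%E.
Proof.
move=> a0 l0; rewrite EFinM -egammaE// /egamma (integral_affine 0 l0); first last.
- by move=> x; rewrite lee_fin gamma_density_ge0.
- by apply/measurable_EFinP; exact: measurable_gamma_density.
rewrite integral_mkcond -muleA [X in _ = (_ * X)%E]muleC muleA -EFinM.
rewrite -ge0_integralZl//; first last.
- by rewrite lee_fin mulr_ge0 ?powR_ge0// ltW.
- by move=> x _; rewrite lee_fin gamma_density_ge0.
- apply/measurable_EFinP; apply: (@measurableT_comp _ _ _ _ _ _ (gamma_density a)).
    exact: measurable_gamma_density.
  by apply: measurable_funD => //; exact: measurable_funM.
apply: eq_integral => x _; rewrite patchE addr0; case: ifPn.
  rewrite inE /= in_itv/= andbT => x0; rewrite gamma_densityE ?mulr_gt0// -EFinM.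
  congr EFin; rewrite powRM ?(ltW l0) ?(ltW x0)//.
  have -> : l * l `^ (- a) = l `^ (1 - a).
    rewrite -[X in X * _](powRr1 (ltW l0)) -powRD//.
    by rewrite (gt_eqF l0) implybT.
  rewrite mulrA mulrA -powRD ?(gt_eqF l0) ?implybT//.
  by rewrite (_ : 1 - a + (a - 1) = 0) ?powRr0 ?mul1r; [rewrite mulrC|lra].
rewrite notin_setE /= in_itv/= andbT => /negP; rewrite -leNgt => x0.
by rewrite gamma_density0 ?mule0// pmulr_rle0.
Qed.

Definition beta_integrand a b t : R -> R :=
  (fun s => s `^ (a - 1) * (t - s) `^ (b - 1)) \_ `]0, t[.

Lemma beta_integrandE a b t s : 0 < s < t ->
  beta_integrand a b t s = s `^ (a - 1) * (t - s) `^ (b - 1).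
Proof. by move=> st; rewrite /beta_integrand patchE mem_set//= in_itv/= st. Qed.

Lemma beta_integrand0 a b t s : ~~ (0 < s < t) -> beta_integrand a b t s = 0.
Proof.
by move=> st; rewrite /beta_integrand patchE memNset//= in_itv/= => h; rewrite h in st.
Qed.

Lemma beta_integrand_ge0 a b t s : 0 <= beta_integrand a b t s.
Proof. by apply: restrict_ge0 => x _; rewrite mulr_ge0 ?powR_ge0. Qed.

Lemma measurable_beta_integrand a b t :
  measurable_fun [set: RT] (beta_integrand a b t : RT -> RT).
Proof.
apply/measurable_restrict => //; apply: measurable_funTS.
apply: measurable_funM; first exact: measurable_powR.
apply: (@measurableT_comp _ _ _ _ _ _ (fun x => x `^ (b - 1))); first exact: measurable_powR.
exact: measurable_funB.
Qed.

Lemma gamma_density_conv a b t x :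
  gamma_density a x * gamma_density b (t - x) = beta_integrand a b t x * expR (- t).
Proof.
have [x0|x0] := leP x 0.
  by rewrite gamma_density0// beta_integrand0 ?mul0r// negb_and -leNgt x0.
have [tx|xt] := leP t x.
  by rewrite [gamma_density b _]gamma_density0 ?subr_le0// mulr0 beta_integrand0 ?mul0r// negb_and -!leNgt tx orbT.
rewrite !gamma_densityE ?subr_gt0// beta_integrandE ?x0// mulrACA; congr (_ * _).
by rewrite -expRD; congr expR; lra.
Qed.

Definition ebeta a b : \bar R := (\int[mu]_s (beta_integrand a b 1 s)%:E)%E.

Lemma ebeta_scale a b t : 0 < t ->
  (\int[mu]_s (beta_integrand a b t s)%:E = (t `^ (a + b - 1))%:E * ebeta a b)%E.
Proof.
move=> t0; rewrite (integral_affine 0 t0); first last.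
- by move=> x; rewrite lee_fin beta_integrand_ge0.
- by apply/measurable_EFinP; exact: measurable_beta_integrand.
have E (x : R) : beta_integrand a b t (t * x + 0) =
    t `^ (a + b - 2) * beta_integrand a b 1 x.
  rewrite addr0; have [x01|x01] := boolP (0 < x < 1).
    have /andP[x0 x1] := x01.
    rewrite !beta_integrandE//; last by rewrite mulr_gt0//= gtr_pMr.
    rewrite -[X in X - t * x]mulr1 -mulrBr !powRM ?(ltW t0) ?(ltW x0) ?subr_ge0 ?(ltW x1)//.
    rewrite mulrACA -powRD ?(gt_eqF t0) ?implybT//; congr (_ `^ _ * _); lra.
  rewrite !beta_integrand0 ?mulr0//.
  by move: x01; rewrite pmulr_rgt0// gtr_pMr.
under eq_integral do rewrite E EFinM.
rewrite ge0_integralZl//; first last.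
- by rewrite lee_fin powR_ge0.
- by move=> x _; rewrite lee_fin beta_integrand_ge0.
- by apply/measurable_EFinP; exact: measurable_beta_integrand.
rewrite muleA -EFinM; congr (_%:E * _)%E.
rewrite -[X in X * _](powRr1 (ltW t0)) -powRD ?(gt_eqF t0) ?implybT//; congr (_ `^ _); lra.
Qed.

(** Tonelli for the convolution of two Gamma densities: the exponentials multiply to [e^(-t)],
    independent of the inner variable, and the inner integral scales as [t^(a + b - 1)]. *)
Lemma egamma_mul a b : 0 < a -> 0 < b ->
  (egamma a * egamma b = ebeta a b * egamma (a + b))%E.
Proof.
move=> a0 b0.
have mg c : measurable_fun [set: RT] (EFin \o (gamma_density c : RT -> RT)).
  by apply/measurable_EFinP; exact: measurable_gamma_density.
have g0 c x : (0 <= (gamma_density c x)%:E)%E by rewrite lee_fin gamma_density_ge0.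
pose f (z : RT * RT) : \bar R := (gamma_density a z.1 * gamma_density b (z.2 - z.1))%:E.
have mf : measurable_fun [set: RT * RT] f.
  apply/measurable_EFinP; apply: measurable_funM.
    apply: (@measurableT_comp _ _ _ _ _ _ (gamma_density a)) => //.
    exact: measurable_gamma_density.
  apply: (@measurableT_comp _ _ _ _ _ _ (gamma_density b)).
    exact: measurable_gamma_density.
  exact: measurable_funB.
have f0 z : (0 <= f z)%E by rewrite lee_fin mulr_ge0 ?gamma_density_ge0.
have := @fubini_tonelli _ _ _ _ _ mu mu f mf f0.
rewrite /fubini_F /fubini_G /f /=.
have -> : (\int[mu]_x \int[mu]_y (gamma_density a x * gamma_density b (y - x))%:E =
    egamma a * egamma b)%E.
  rewrite muleC /egamma -ge0_integralZl//; last by apply: integral_ge0.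
  apply: eq_integral => x _; under eq_integral do rewrite EFinM.
  rewrite ge0_integralZl//.
  - rewrite muleC; congr (_ * _)%E; rewrite [RHS](integral_affine (- x) ltr01) ?mul1e//; last exact: mg.
    by apply: eq_integral => y _; rewrite mul1r.
  - apply/measurable_EFinP; apply: (@measurableT_comp _ _ _ _ _ _ (gamma_density b)).
      exact: measurable_gamma_density.
    exact: measurable_funB.
  - exact: mg.
move=> ->; rewrite /egamma muleC -ge0_integralZr//; first last.
- by apply: integral_ge0 => x _; rewrite lee_fin beta_integrand_ge0.
- exact: mg.
apply: eq_integral => t _; under eq_integral do rewrite gamma_density_conv EFinM.
rewrite ge0_integralZr//; first last.
- by move=> x _; rewrite lee_fin beta_integrand_ge0.
- by apply/measurable_EFinP; exact: measurable_beta_integrand.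
have [t0|t0] := leP t 0.
  rewrite gamma_density0// mul0e integral0_eq ?mul0e// => x _.
  rewrite beta_integrand0//; apply/negP => /andP[x0 xt].
  by have := lt_trans x0 xt; rewrite ltNge t0.
rewrite ebeta_scale// gamma_densityE// EFinM -!muleA; congr (_ * _)%E.
by rewrite muleC.
Qed.

Definition Beta a b : R := Gamma a * Gamma b / Gamma (a + b).

Lemma ebetaE a b : 0 < a -> 0 < b -> ebeta a b = (Beta a b)%:E.
Proof.
move=> a0 b0; have ab0 := addr_gt0 a0 b0.
have := egamma_mul a0 b0; rewrite !egammaE// -EFinM => h.
have g0 := Gamma_gt0 ab0.
rewrite /Beta EFinM h -muleA -EFinM mulfV ?mule1// gt_eqF//.
Qed.

Lemma Beta_integral a b t : 0 < a -> 0 < b -> 0 < t ->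
  (\int[mu]_(s in `]0%R, t[) (s `^ (a - 1) * (t - s) `^ (b - 1))%:E =
   (t `^ (a + b - 1) * Beta a b)%:E)%E.
Proof.
move=> a0 b0 t0; rewrite EFinM -ebetaE// -ebeta_scale// integral_mkcond.
by apply: eq_integral => x _; rewrite /beta_integrand !patchE; case: ifP.
Qed.

Lemma Gamma1 : Gamma 1 = 1 :> R.
Proof.
rewrite GammaE /egamma; transitivity (fine (\int[mu]_(x in `[0%R, +oo[) (expR (- (1 * x)))%:E)).
  rewrite -integral_itv_obnd_cbnd; last first.
    apply: measurable_funTS; apply/measurable_EFinP; apply: measurableT_comp; first exact: measurable_expR.
    by apply: measurable_funN; exact: measurable_funM.
  congr fine; rewrite [RHS]integral_mkcond; apply: eq_integral => x _.
  rewrite /gamma_density !patchE; case: ifP => // _.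
  by rewrite subrr powRr0 !mul1r.
by rewrite integral_expR_Iy//= invr1 !mul1r oppr0 expR0.
Qed.

(** Read off from the Beta integral with [b = 1], which is the integral of [s^(a - 1)] over the unit
    interval. *)
Lemma GammaS a : 0 < a -> Gamma (a + 1) = a * Gamma a.
Proof.
move=> a0.
have E : ebeta a 1 = (a^-1)%:E.
  have := integral_powR a0 ltr01; rewrite powR1 mulr1 => <-.
  rewrite -integral_itv_bndo_bndc; last first.
    by apply: measurable_funTS; apply/measurable_EFinP; exact: measurable_powR.
  rewrite [RHS]integral_mkcond; apply: eq_integral => x _.
  rewrite /beta_integrand !patchE; case: ifP => // _.
  by rewrite subrr powRr0 mulr1.
have := ebetaE a0 ltr01; rewrite E /Beta Gamma1 mulr1 => -[] h.
have g1 : Gamma (a + 1) != 0 by rewrite gt_eqF// Gamma_gt0// addr_gt0.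
apply: (mulfI (x := a^-1)); first by rewrite invr_eq0 gt_eqF.
by rewrite mulKf ?gt_eqF// h divfK.
Qed.

Lemma Gamma_nat n : Gamma n.+1%:R = n`!%:R :> R.
Proof.
elim: n => [|n ih]; first by rewrite Gamma1.
by rewrite -natr1 GammaS ?ltr0n// ih factS natrM.
Qed.

End GammaFunction.

(** * Mittag-Leffler series *)

Section DominatedConvergence.
Context {d : measure_display} {T : measurableType d} {R : realType}.
Variables (mu : {measure set T -> \bar R}) (D : set T).

Lemma dominated_convergenceW (f_ : nat -> T -> \bar R) (f g : T -> \bar R) :
  measurable D -> (forall n, measurable_fun D (f_ n)) ->
  (forall x, D x -> f_ ^~ x @ \oo --> f x) -> mu.-integrable D g ->
  (forall x n, D x -> (`|f_ n x| <= g x)%E) ->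
  mu.-integrable D f /\
  (\int[mu]_(x in D) f_ n x)%E @[n --> \oo] --> (\int[mu]_(x in D) f x)%E.
Proof.
move=> mD mf_ f_f ig f_g.
have mf : measurable_fun D f by exact: emeasurable_fun_cvg mf_ f_f.
have [] := @dominated_convergence _ _ _ mu D mD f_ f g mf_ mf _ ig _ => //.
- exact: aeW.
- by apply: aeW => x n Dx; exact: f_g.
Qed.

End DominatedConvergence.

Section EntireSeries.
Context {R : realType}.
Implicit Types (c y : nat -> R) (q z : R).

(** Coefficients decaying faster than any geometric sequence; the factor [2^-1 ^+ k] makes absolute
    convergence a comparison with a geometric series. *)
Definition entire c : Prop :=
  forall q, 0 <= q -> exists A, forall k, `|c k| * q ^+ k <= A * 2^-1 ^+ k.

Lemma entire_cvg_norm c z : entire c -> cvgn [series `|c k * z ^+ k|]_k.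
Proof.
move=> ec; have [A cA] := ec `|z| (normr_ge0 z).
apply: (@series_le_cvg _ _ (geometric A 2^-1)) => //= [n|n|].
- by rewrite geometric_ge0// ?invr_ge0//; have := cA 0; rewrite !expr0 !mulr1; apply: le_trans.
- by rewrite normrM normrX; exact: cA.
- by apply: is_cvg_geometric_series; rewrite ger0_norm ?invr_ge0// invf_lt1// ltr1n.
Qed.

Lemma entire_cvg c z : entire c -> cvgn (pseries c z).
Proof. by move=> ec; apply: normed_cvg; exact: entire_cvg_norm. Qed.

(** The factor [k + 1 <= 2^(k + 1)] is absorbed by testing [c] at [2 (q + 1)] instead of [q]; adding
    1 to [q] allows the exponent to rise by one. *)
Lemma entire_diffs c : entire c -> entire (pseries_diffs c).
Proof.
move=> ec q q0.
have q1 : 0 <= 2 * (q + 1) by rewrite mulr_ge0// addr_ge0.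
have [A cA] := ec _ q1; exists A => k.
have A0 : 0 <= A by have := cA 0; rewrite !expr0 !mulr1; apply: le_trans.
rewrite /pseries_diffs normrM ger0_norm//.
apply: (@le_trans _ _ (`|c k.+1| * (2 * (q + 1)) ^+ k.+1)).
  rewrite -mulrA mulrCA ler_wpM2l// exprMn ler_pM ?exprn_ge0//.
    by rewrite -natrX ler_nat; exact/ltnW/ltn_expl.
  apply: (@le_trans _ _ ((q + 1) ^+ k)); first by rewrite lerXn2r ?nnegrE ?lerDl ?addr_ge0.
  by rewrite exprS ler_peMl ?exprn_ge0 ?addr_ge0// lerDr.
apply: (le_trans (cA _)); rewrite ler_wpM2l// exprS ler_piMl ?exprn_ge0 ?invr_ge0//.
by rewrite invf_le1// ler1n.
Qed.

Definition psum c z : R := limn (pseries c z).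

Lemma is_derive_psum c z : entire c -> is_derive z 1 (psum c) (psum (pseries_diffs c) z).
Proof.
move=> ec; apply: (@pseries_snd_diffs _ c (`|z| + 1)).
- exact: entire_cvg.
- exact/entire_cvg/entire_diffs.
- exact/entire_cvg/entire_diffs/entire_diffs.
- by rewrite [ltRHS]ger0_norm ?ltrDl// addr_ge0.
Qed.

Lemma continuous_psum c : entire c -> continuous (psum c).
Proof.
move=> ec z; have [d _] := is_derive_psum z ec.
exact/differentiable_continuous/derivable1_diffP.
Qed.

Lemma psum_le c d z : entire c -> entire d ->
  (forall k, `|c k| <= d k) -> `|psum c z| <= psum d `|z|.
Proof.
move=> ec ed cd.
rewrite -(cvg_lim _ (cvg_norm (@entire_cvg c z ec)))//.
apply: ler_lim; [exact: (cvgP _ (cvg_norm (@entire_cvg c z ec)))|exact: entire_cvg|].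
apply: nearW => n; rewrite (le_trans (ler_norm_sum _ _ _))// ler_sum// => k _.
by rewrite normrM normrX ler_wpM2r// exprn_ge0.
Qed.

Lemma psum_homo d z z' : entire d -> (forall k, 0 <= d k) -> 0 <= z <= z' ->
  psum d z <= psum d z'.
Proof.
move=> ed d0 /andP[z0 zz']; apply: lim_series_le; try exact: entire_cvg.
by move=> n; rewrite ler_wpM2l// lerXn2r ?nnegrE// (le_trans z0).
Qed.

Lemma psum0 c : psum c 0 = c 0.
Proof.
apply/cvg_lim => //; apply: cvg_near_cst; exists 1%N => //= n n1.
rewrite /pseries /series /= big_ltn// expr0 mulr1 big_nat big1 ?addr0//.
by move=> k /andP[k1 _]; rewrite expr0n gtn_eqF// mulr0.
Qed.

Lemma psumD c d z : entire c -> entire d -> psum (fun k => c k + d k) z = psum c z + psum d z.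
Proof.
move=> ec ed; apply/cvg_lim => //.
have -> : pseries (fun k => c k + d k) z = pseries c z \+ pseries d z.
  apply/funext => n; rewrite /pseries /series /= -big_split /=.
  by apply: eq_bigr => k _; rewrite mulrDl.
by apply: cvgD; exact: entire_cvg.
Qed.

Lemma psumZ a c z : entire c -> psum (fun k => a * c k) z = a * psum c z.
Proof.
move=> ec; apply/cvg_lim => //.
have -> : pseries (fun k => a * c k) z = (fun n => a * pseries c z n).
  apply/funext => n; rewrite /pseries /series /= mulr_sumr.
  by apply: eq_bigr => k _; rewrite mulrA.
by apply: cvgM; [exact: cvg_cst|exact: entire_cvg].
Qed.

End EntireSeries.

Section MittagLeffler.
Context {R : realType}.
Local Notation mu := (@lebesgue_measure R).
Local Notation RT := (measurableTypeR R).
Variable alpha : R.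
Hypothesis alpha01 : 0 < alpha < 1.
Implicit Types (y : nat -> R) (t s z : R).

Let a0 : 0 < alpha. Proof. by case/andP: alpha01. Qed.
Let a1 : 0 < 1 - alpha. Proof. by case/andP: alpha01 => _; rewrite subr_gt0. Qed.

Definition mlcoef (k : nat) : R := (Gamma (alpha * k%:R + 1))^-1.

Lemma mlcoef_gt0 k : 0 < mlcoef k.
Proof. by rewrite invr_gt0 Gamma_gt0// ltr_wpDl// mulr_ge0// ltW. Qed.

Lemma mlcoef0 : mlcoef 0 = 1.
Proof. by rewrite /mlcoef mulr0 add0r Gamma1 invr1. Qed.

Lemma entire_mlcoef : entire mlcoef.
Proof.
(* With [M^alpha = 2 q + 1], the lower bound on Gamma becomes [(2 q + 1)^k e^(-(M + 1))], and
   [q / (2 q + 1) <= 1/2]. *)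
move=> q q0; set M := (2 * q + 1) `^ alpha^-1.
have q1 : 0 < 2 * q + 1 by rewrite ltr_wpDl// mulr_ge0.
have M0 : 0 <= M by exact: powR_ge0.
have Ma : M `^ alpha = 2 * q + 1 by rewrite /M -powRrM mulVf ?gt_eqF// powRr1// ltW.
exists (expR (M + 1)) => k; rewrite ger0_norm ?(ltW (mlcoef_gt0 _))//.
have := @Gamma_ge _ (alpha * k%:R + 1) M; rewrite addrK powRrM Ma powR_mulrn ?(ltW q1)//.
rewrite lerDr mulr_ge0 ?(ltW a0)// => /(_ isT M0) h.
have G0 : 0 < Gamma (alpha * k%:R + 1) by rewrite -invr_gt0 mlcoef_gt0.
rewrite /mlcoef mulrC ler_pdivrMr//.
apply: (@le_trans _ _ (expR (M + 1) * 2^-1 ^+ k * ((2 * q + 1) ^+ k * expR (- (M + 1))))); last first.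
  by rewrite ler_wpM2l// mulr_ge0 ?expR_ge0 ?exprn_ge0 ?invr_ge0.
rewrite expRN [leRHS](_ : _ = (2^-1 * (2 * q + 1)) ^+ k * (expR (M + 1) / expR (M + 1))); last by rewrite exprMn; ring.
rewrite mulfV ?gt_eqF ?expR_gt0// mulr1.
rewrite lerXn2r ?nnegrE// ?mulr_ge0 ?invr_ge0//; lra.
Qed.

Definition geometric_growth y : Prop := exists C K, forall k, `|y k| <= C * K ^+ k.

Lemma entire_ml y : geometric_growth y -> entire (fun k => y k * mlcoef k).
Proof.
move=> [C [K yK]] q q0.
have Kq : 0 <= `|K| * q by rewrite mulr_ge0.
have [A hA] := entire_mlcoef Kq; exists (`|C| * A) => k.
rewrite normrM -[leRHS]mulrA.
apply: (@le_trans _ _ (`|C| * (`|mlcoef k| * (`|K| * q) ^+ k))); last by rewrite ler_wpM2l.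
rewrite exprMn [leLHS](_ : _ = `|y k| * (`|mlcoef k| * q ^+ k)); last by rewrite mulrA.
rewrite [leRHS](_ : _ = `|C| * `|K| ^+ k * (`|mlcoef k| * q ^+ k)); last by ring.
rewrite ler_wpM2r ?mulr_ge0 ?exprn_ge0//.
by rewrite (le_trans (yK k))// (le_trans (ler_norm _))// normrM normrX.
Qed.

Lemma geometric_growth_shift y : geometric_growth y -> geometric_growth (fun k => y k.+1).
Proof.
by move=> [C [K yK]]; exists (C * K), K => k; rewrite -mulrA -exprS.
Qed.

(** For [y k = K^k] this is the Mittag-Leffler function [E_alpha (K t^alpha)]. General coefficients
    are allowed because the Caputo derivative acts on [y] as a shift. *)
Definition ml y t : R := psum (fun k => y k * mlcoef k) (t `^ alpha).

Definition ml_deriv y s : R :=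
  psum (pseries_diffs (fun k => y k * mlcoef k)) (s `^ alpha) * (alpha * s `^ (alpha - 1)).

Lemma is_derive_ml y s : geometric_growth y -> 0 < s -> is_derive s 1 (ml y) (ml_deriv y s).
Proof.
move=> gy s0; rewrite /ml_deriv.
have h1 := is_derive_psum (s `^ alpha) (entire_ml gy).
have h2 := is_derive1_powR alpha s0.
have h := @is_derive1_comp R (psum (fun k => y k * mlcoef k)) (fun s => s `^ alpha) s _ _ h1 h2.
exact: h.
Qed.

Lemma continuous_powR (a s : R) : 0 < s -> {for s, continuous (fun x => x `^ a)}.
Proof.
move=> s0; apply: differentiable_continuous; apply/derivable1_diffP.
by apply: derivable_powR; rewrite in_itv/= s0.
Qed.

Lemma continuous_ml_deriv y s : geometric_growth y -> 0 < s ->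
  {for s, continuous (ml_deriv y)}.
Proof.
move=> gy s0; apply: continuousM.
  apply: continuous_comp; first exact: continuous_powR.
  exact/continuous_psum/entire_diffs/entire_ml.
by apply: continuousM; [exact: cst_continuous|exact: continuous_powR].
Qed.

Lemma ml_derive1 y s : geometric_growth y -> 0 < s -> derive1 (ml y) s = ml_deriv y s.
Proof. by move=> gy s0; rewrite derive1E; have [_ ->] := is_derive_ml gy s0. Qed.

Lemma ml0 y : ml y 0 = y 0.
Proof. by rewrite /ml powR0 ?gt_eqF// psum0 mlcoef0 mulr1. Qed.

Lemma within_continuous_ml y : geometric_growth y ->
  {within `[0, +oo[, continuous (ml y)}.
Proof.
move=> gy; apply/continuous_within_itvcyP; split.
  move=> x; rewrite in_itv/= andbT => x0.
  have [d _] := is_derive_ml gy x0.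
  exact/differentiable_continuous/derivable1_diffP.
apply: (@cvg_comp _ _ _ (fun x => x `^ alpha) (psum (fun k => y k * mlcoef k)) _ (nbhs (0 `^ alpha))).
  by rewrite powR0 ?gt_eqF//; exact: powR_cvg0.
exact/continuous_psum/entire_ml.
Qed.

Lemma ml_C1 y t : geometric_growth y -> 0 < t ->
  derivable (ml y) t 1 /\ {for t, continuous (derive1 (ml y))}.
Proof.
move=> gy t0; split; first by have [] := is_derive_ml gy t0.
have h : \near t, ml_deriv y t = derive1 (ml y) t.
  near=> s; rewrite ml_derive1//; near: s; exact: lt_nbhsr.
have h' : derive1 (ml y) s @[s --> t] --> ml_deriv y t.
  apply: cvg_trans (continuous_ml_deriv gy t0).
  by apply: near_eq_cvg.
by move: h'; rewrite -(ml_derive1 gy t0).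
Unshelve. all: by end_near. Qed.

Lemma integrable_itv_oo_cc (f : R -> R) a b :
  mu.-integrable `]a, b[ (EFin \o f) -> mu.-integrable `[a, b] (EFin \o f).
Proof.
move=> /integrableP[/measurable_EFinP mf foo]; apply/integrableP; split.
  by apply/measurable_EFinP; exact: measurable_fun_itv_cc mf.
rewrite integral_itv_bndoo//; apply/measurable_EFinP; apply: measurableT_comp => //.
Qed.

(** Differentiation kills the constant term and the Beta integral lowers each remaining power of
    [t^alpha] by one; the sum is moved through the integral by dominated convergence. *)
Lemma caputo_ml y t : geometric_growth y -> 0 < t ->
  mu.-integrable `[0, t] (EFin \o caputo_integrand alpha t (ml y)) /\
  caputo alpha (ml y) t = ml (fun k => y k.+1) t.
Proof.
move=> gy t0.
pose c := pseries_diffs (fun k => y k * mlcoef k).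
have ec : entire c by exact/entire_diffs/entire_ml.
(* The weight [w] collects both integrable endpoint singularities; what remains is a power series in
   [s^alpha], bounded on [[0, t]] by the constant [D]. *)
pose w s := (alpha * s `^ (alpha - 1)) * (t - s) `^ (1 - alpha - 1).
pose f_ (n : nat) s := (w s * pseries c (s `^ alpha) n)%:E.
pose f s := (w s * psum c (s `^ alpha))%:E.
pose D := psum (fun k => `|c k|) (t `^ alpha).
pose g s := (D * w s)%:E.
have eac : entire (fun k => `|c k|).
  by move=> q /ec[A hA]; exists A => k; rewrite normr_id.
have w0 s : 0 <= w s by rewrite !mulr_ge0 ?powR_ge0// ltW.
have mw : measurable_fun [set: RT] (w : RT -> RT).
  apply: measurable_funM.
    by apply: measurable_funM => //; exact: measurable_powR.
  apply: (@measurableT_comp _ _ _ _ _ _ (fun x => x `^ (1 - alpha - 1))); first exact: measurable_powR.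
  exact: measurable_funB.
have mI : measurable (`]0, t[%classic : set RT) by exact: measurable_itv.
have iwk k : (\int[mu]_(s in `]0%R, t[) (w s * (s `^ alpha) ^+ k)%:E =
    (alpha * (t `^ alpha) ^+ k * Beta (alpha * k.+1%:R) (1 - alpha))%:E)%E.
  have ak : 0 < alpha * k.+1%:R by rewrite mulr_gt0.
  rewrite -[in RHS]powR_mulrn ?powR_ge0// -powRrM.
  have -> : alpha * k%:R = alpha * k.+1%:R + (1 - alpha) - 1 by rewrite -natr1; ring.
  rewrite -mulrA EFinM -(Beta_integral ak a1 t0) -ge0_integralZl//.
  - apply: eq_integral => s; rewrite inE/= in_itv/= => /andP[s0 st].
    rewrite -EFinM /w; congr EFin.
    have -> : alpha * k.+1%:R - 1 = (alpha - 1) + alpha * k%:R by rewrite -natr1; ring.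
    rewrite (@powRD _ s (alpha - 1)) ?(gt_eqF s0) ?implybT// powRrM powR_mulrn ?powR_ge0//.
    ring.
  - apply: measurable_funTS; apply/measurable_EFinP; apply: measurable_funM; first exact: measurable_powR.
    apply: (@measurableT_comp _ _ _ _ _ _ (fun x => x `^ (1 - alpha - 1))); first exact: measurable_powR.
    exact: measurable_funB.
  - by move=> s _; rewrite lee_fin mulr_ge0 ?powR_ge0.
  - by rewrite lee_fin ltW.
have ik k : mu.-integrable `]0, t[ (fun s => (w s * (s `^ alpha) ^+ k)%:E).
  apply/integrableP; split.
    apply: measurable_funTS; apply/measurable_EFinP; apply: measurable_funM => //.
    by apply: measurable_funX; exact: measurable_powR.
  under eq_integral do rewrite gee0_abs ?lee_fin ?(mulr_ge0 (w0 _)) ?exprn_ge0 ?powR_ge0//.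
  by rewrite iwk ltry.
have ig : mu.-integrable `]0, t[ g.
  have := integrableZl mI D (ik 0%N).
  by apply: eq_integrable => // s _; rewrite expr0 mulr1.
have mf_ n : measurable_fun `]0, t[ (f_ n).
  apply: measurable_funTS; apply/measurable_EFinP; apply: measurable_funM => //.
  apply: measurable_sum => k; apply: measurable_funM => //.
  by apply: measurable_funX; exact: measurable_powR.
have f_f s : f_ ^~ s @ \oo --> f s.
  apply: cvg_EFin; first exact: nearW.
  by apply: cvgM; [exact: cvg_cst|exact: entire_cvg].
have f_g s n : `]0, t[%classic s -> (`|f_ n s| <= g s)%E.
  rewrite /= in_itv/= => /andP[s0 st]; rewrite lee_fin normrM (ger0_norm (w0 s)) mulrC ler_wpM2r//.
  apply: (@le_trans _ _ (\sum_(0 <= k < n) `|c k| * (t `^ alpha) ^+ k)).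
    rewrite (le_trans (ler_norm_sum _ _ _))// ler_sum// => k _.
    rewrite normrM normrX ler_wpM2l// ger0_norm ?powR_ge0// lerXn2r ?nnegrE ?powR_ge0//.
    by rewrite ge0_ler_powR ?nnegrE// ltW.
  apply: nondecreasing_cvgn_le; last exact: entire_cvg.
  apply/nondecreasing_seqP => m; rewrite /pseries /series /= big_nat_recr//= lerDl.
  by rewrite mulr_ge0 ?exprn_ge0 ?powR_ge0.
have [i_f cvgf] := dominated_convergenceW mI mf_ (fun s _ => f_f s) ig f_g.
have capE s : s \in `]0, t[%classic -> caputo_integrand alpha t (ml y) s = w s * psum c (s `^ alpha).
  rewrite inE/= in_itv/= => /andP[s0 st]; rewrite /caputo_integrand ml_derive1// /ml_deriv -/c /w.
  by rewrite (_ : 1 - alpha - 1 = - alpha); [ring|lra].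
have icap : mu.-integrable `]0, t[ (EFin \o caputo_integrand alpha t (ml y)).
  apply: eq_integrable i_f => // s /capE h; by rewrite /f /= h.
split; first exact: integrable_itv_oo_cc.
have Sf n : (\int[mu]_(s in `]0%R, t[) f_ n s =
    (Gamma (1 - alpha) * \sum_(0 <= k < n) y k.+1 * mlcoef k * (t `^ alpha) ^+ k)%:E)%E.
  rewrite mulr_sumr -sumEFin /f_ /pseries /series /=.
  under eq_integral do rewrite mulr_sumr -sumEFin.
  rewrite integral_sum//; last first.
    move=> k; have := ik k; move/(integrableZl mI (c k)).
    by apply: eq_integrable => // s _; rewrite -EFinM; congr EFin; ring.
  apply: eq_bigr => k _.
  transitivity ((c k)%:E * \int[mu]_(s in `]0%R, t[) (w s * (s `^ alpha) ^+ k)%:E)%E.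
    rewrite -integralZl//; apply: eq_integral => s _; rewrite -EFinM; congr EFin; ring.
  rewrite iwk -EFinM; congr EFin; rewrite /c /pseries_diffs /Beta /mlcoef.
  have ak : 0 < alpha * k.+1%:R by rewrite mulr_gt0.
  (* The factor [alpha (k + 1)] produced by differentiation cancels against the functional equation
     for [Gamma (alpha (k + 1) + 1)]. *)
  rewrite GammaS// (_ : alpha * k.+1%:R + (1 - alpha) = alpha * k%:R + 1); last by rewrite -natr1; ring.
  have g1 := Gamma_gt0 ak.
  have g2 : 0 < Gamma (alpha * k%:R + 1) by rewrite -invr_gt0 mlcoef_gt0.
  have k0 : (0 : R) < k.+1%:R by [].
  move: (Gamma (alpha * k.+1%:R)) (Gamma (1 - alpha)) (Gamma (alpha * k%:R + 1)) g1 g2 => x1 x2 x3 g1 g2.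
  move: (k.+1%:R) k0 => x4 x40.
  by field; rewrite !gt_eqF.
have lim : (\int[mu]_(s in `]0%R, t[) f s = (Gamma (1 - alpha) * ml (fun k => y k.+1) t)%:E)%E.
  move/cvg_lim : cvgf => <-//; apply/cvg_lim => //; under eq_fun do rewrite Sf.
  apply: cvg_EFin; first exact: nearW.
  apply: cvgM; first exact: cvg_cst.
  by apply: entire_cvg; apply/entire_ml/geometric_growth_shift.
rewrite /caputo /Rintegral -integral_itv_obnd_cbnd; last first.
  by case/integrableP: icap => /measurable_EFinP h _; apply/measurable_EFinP; exact: measurable_fun_itv_oc h.
rewrite -integral_itv_bndo_bndc; last by case/integrableP: icap.
transitivity ((Gamma (1 - alpha))^-1 * fine (\int[mu]_(s in `]0%R, t[) f s)%E).
  by congr (_ * fine _); apply: eq_integral => s /capE h; rewrite /f h.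
by rewrite lim /= mulKf// gt_eqF// Gamma_gt0.
Qed.

End MittagLeffler.

(** * Maximum principle and uniqueness for the Caputo problem *)

Section CaputoRegular.
Context {R : realType}.
Local Notation mu := (@lebesgue_measure R).
Local Notation RT := (measurableTypeR R).
Variable alpha : R.
Hypothesis alpha01 : 0 < alpha < 1.
Implicit Types (v w z : R -> R) (t s : R).

Let a0 : 0 < alpha. Proof. by case/andP: alpha01. Qed.
Let a1 : 0 < 1 - alpha. Proof. by case/andP: alpha01 => _; rewrite subr_gt0. Qed.

Record caputo_regular v : Prop := {
  reg_continuous : {within `[0, +oo[, continuous v} ;
  reg_C1 : forall t, 0 < t -> derivable v t 1 /\ {for t, continuous (derive1 v)} ;
  reg_integrable : forall t, 0 < t ->
    mu.-integrable `[0, t] (EFin \o caputo_integrand alpha t v) }.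

Lemma caputo_integral_oo v t : caputo_regular v -> 0 < t ->
  \int[mu]_(s in `[0, t]) caputo_integrand alpha t v s =
  \int[mu]_(s in `]0, t[) caputo_integrand alpha t v s.
Proof.
move=> rv t0; have [/measurable_EFinP m _] := integrableP _ _ _ (reg_integrable rv t0).
rewrite /Rintegral (@integral_itv_bndoo R 0 t _ true false)//.
by apply/measurable_EFinP; apply: measurable_funS m => //; exact: subset_itv_oo_cc.
Qed.

Lemma integrable_caputo_oo v t : caputo_regular v -> 0 < t ->
  mu.-integrable `]0, t[ (EFin \o caputo_integrand alpha t v).
Proof.
by move=> rv t0; apply: integrableS (reg_integrable rv t0) => //; exact: subset_itv_oo_cc.
Qed.

Lemma derive1_comb v w (a b : R) s : derivable v s 1 -> derivable w s 1 ->
  derive1 (fun t => a * v t + b * w t) s = a * derive1 v s + b * derive1 w s /\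
  derivable (fun t => a * v t + b * w t) s 1.
Proof.
move=> dv dw.
have hv : is_derive s 1 v (derive1 v s) by apply: DeriveDef => //; rewrite derive1E.
have hw : is_derive s 1 w (derive1 w s) by apply: DeriveDef => //; rewrite derive1E.
have [h1 h2] := is_deriveD (is_deriveZ a hv) (is_deriveZ b hw).
by split; [rewrite derive1E; exact: h2|exact: h1].
Qed.

Lemma caputo_regular_comb v w (a b : R) : caputo_regular v -> caputo_regular w ->
  caputo_regular (fun t => a * v t + b * w t) /\
  forall t, 0 < t -> caputo alpha (fun t => a * v t + b * w t) t =
    a * caputo alpha v t + b * caputo alpha w t.
Proof.
move=> rv rw.
have mI t : measurable (`]0, t[%classic : set RT) by exact: measurable_itv.
have E t s : s \in `]0, t[%classic -> caputo_integrand alpha t (fun t => a * v t + b * w t) s =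
    a * caputo_integrand alpha t v s + b * caputo_integrand alpha t w s.
  rewrite inE/= in_itv/= => /andP[s0 _]; rewrite /caputo_integrand.
  have [-> _] := derive1_comb a b (reg_C1 rv s0).1 (reg_C1 rw s0).1; ring.
have I t : 0 < t -> mu.-integrable `]0, t[ (EFin \o caputo_integrand alpha t (fun t => a * v t + b * w t)).
  move=> t0; have h1 := integrableZl (mI _) a (integrable_caputo_oo rv t0).
  have h2 := integrableZl (mI _) b (integrable_caputo_oo rw t0).
  apply: eq_integrable (integrableD (mI _) h1 h2) => // s st.
  by rewrite /= E.
have rc : caputo_regular (fun t => a * v t + b * w t).
  split.
  - have cst_w (c : R) : {within `[0, +oo[%classic, continuous (fun _ : R => c)}.
      by apply: continuous_subspaceT => x; exact: cst_continuous.
    move=> x; apply: cvgD; apply: cvgM; [exact: cst_w|exact: (reg_continuous rv)|exact: cst_w|exact: (reg_continuous rw)].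
  - move=> t t0; split; first exact: (derive1_comb a b (reg_C1 rv t0).1 (reg_C1 rw t0).1).2.
    have [e _] := derive1_comb a b (reg_C1 rv t0).1 (reg_C1 rw t0).1.
    suff : derive1 (fun t => a * v t + b * w t) s @[s --> t] --> a * derive1 v t + b * derive1 w t by rewrite -e.
    apply: (@cvg_trans _ ((fun s => a * derive1 v s + b * derive1 w s) @ t)).
      apply: near_eq_cvg; near=> s.
      have s0 : 0 < s by near: s; exact: lt_nbhsr.
      by rewrite (derive1_comb a b (reg_C1 rv s0).1 (reg_C1 rw s0).1).1.
    have h1 : a * derive1 v s @[s --> t] --> a * derive1 v t.
      by apply: cvgM; [exact: cvg_cst|exact: (reg_C1 rv t0).2].
    have h2 : b * derive1 w s @[s --> t] --> b * derive1 w t.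
      by apply: cvgM; [exact: cvg_cst|exact: (reg_C1 rw t0).2].
    exact: (cvgD h1 h2).
  - by move=> t t0; apply: integrable_itv_oo_cc; exact: I.
split=> // t t0; rewrite /caputo !caputo_integral_oo//.
have i1 := integrable_caputo_oo rv t0.
have i2 := integrable_caputo_oo rw t0.
rewrite [X in _ * X = _](_ : _ = \int[mu]_(s in `]0, t[)
  (a * caputo_integrand alpha t v s + b * caputo_integrand alpha t w s)); last first.
  by apply: eq_Rintegral => s /E.
rewrite RintegralD//.
- by rewrite !RintegralZl// mulrDr; congr (_ + _); exact: mulrCA.
- exact: (integrableZl (mI _) a i1).
- exact: (integrableZl (mI _) b i2).
Unshelve. all: by end_near. Qed.

(* Integration by parts: with [phi s = z t - z s >= 0], the integrand is
   [alpha (t - s)^(- alpha - 1) phi s] minus the derivative of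
   [(t - s)^(- alpha) phi s]. *)
Lemma caputo_max z t : caputo_regular z -> 0 < t ->
  (forall s, 0 <= s <= t -> z s <= z t) ->
  t `^ (- alpha) * (z t - z 0) <= \int[mu]_(s in `[0, t]) caputo_integrand alpha t z s.
Proof.
move=> rz t0 zmax; rewrite caputo_integral_oo//.
pose f s := caputo_integrand alpha t z s.
pose psi s := (t - s) `^ (- alpha) * (z t - z s).
have dz s : 0 < s -> is_derive s 1 z (derive1 z s).
  by move=> s0; apply: DeriveDef; rewrite ?derive1E//; exact: (reg_C1 rz s0).1.
have ti (s : R) : is_derive s 1 (fun s => t - s) (-1).
  by have h := is_deriveB (is_derive_cst t s 1) (is_derive_id s (1 : R)); apply: (is_derive_eq h); rewrite sub0r.
have dpsi s : 0 < s < t -> is_derive s 1 (\- psi)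
    (f s - alpha * (t - s) `^ (- alpha - 1) * (z t - z s)).
  move=> /andP[s0 st]; have ts0 : 0 < t - s by rewrite subr_gt0.
  have h1 := @is_derive1_comp R (fun x => x `^ (- alpha)) (fun s => t - s) s _ _ (is_derive1_powR (- alpha) ts0) (ti s).
  have h2 : is_derive s 1 (fun s => z t - z s) (- derive1 z s).
    by have h := is_deriveB (is_derive_cst (z t) s 1) (dz s s0); apply: (is_derive_eq h); rewrite sub0r.
  have h3 := is_deriveN (is_deriveM h1 h2).
  apply: (is_derive_eq h3); rewrite /f /caputo_integrand /GRing.scale /=; ring.
(* The fundamental theorem is applied on [[a_ n, b_ n]], away from the singularities at [0] and [t];
   the shift by 3 makes [a_ n < t / 2 < b_ n]. *)
pose a_ (n : nat) := t / n.+3%:R.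
pose b_ (n : nat) := t - t / n.+3%:R.
have an0 n : 0 < a_ n by rewrite divr_gt0.
have bnt n : b_ n < t by rewrite ltrBlDr ltrDl an0.
have ab n : a_ n < b_ n.
  have : t / n.+3%:R < t / 2 by rewrite ltr_pM2l// ltf_pV2 ?posrE// ltr_nat.
  by rewrite /a_ /b_; move: (t / n.+3%:R) => x; lra.
have a_0 : a_ @ \oo --> 0.
  rewrite -(mulr0 t); apply: cvgM; first exact: cvg_cst.
  have := @cvg_harmonic R; rewrite -(cvg_shiftn 2) /= /harmonic.
  by under eq_fun do rewrite addn2.
have cf s : 0 < s < t -> {for s, continuous f}.
  move=> /andP[s0 st]; apply: continuousM; last exact: (reg_C1 rz s0).2.
  apply: (@continuous_comp _ _ _ (fun s => t - s) (fun x => x `^ (- alpha))).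
    by apply: continuousB; [exact: cst_continuous|exact: cvg_id].
  by apply: continuous_powR; rewrite subr_gt0.
have cz s : 0 < s -> {for s, continuous z}.
  by move=> s0; have [h _] := dz s s0; exact/differentiable_continuous/derivable1_diffP.
pose g s := f s - alpha * (t - s) `^ (- alpha - 1) * (z t - z s).
have cg s : 0 < s < t -> {for s, continuous g}.
  move=> /andP[s0 st]; apply: continuousB; first by apply: cf; rewrite s0.
  apply: continuousM; last first.
    by apply: continuousB; [exact: cst_continuous|exact: cz].
  apply: continuousM; first exact: cst_continuous.
  apply: (@continuous_comp _ _ _ (fun s => t - s) (fun x => x `^ (- alpha - 1))).
    by apply: continuousB; [exact: cst_continuous|exact: cvg_id].
  by apply: continuous_powR; rewrite subr_gt0.
have iab n s : s \in `[a_ n, b_ n]%classic -> 0 < s < t.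
  rewrite inE/= in_itv/= => /andP[h1 h2].
  by rewrite (lt_le_trans (an0 n) h1) (le_lt_trans h2 (bnt n)).
have wc n (h : R -> R) : (forall s, 0 < s < t -> {for s, continuous h}) ->
    {within `[a_ n, b_ n], continuous h}.
  by move=> ch; apply: continuous_in_subspaceT => s /iab; exact: ch.
have FTC n : (\int[mu]_(s in `[a_ n, b_ n]) (g s)%:E = (psi (a_ n) - psi (b_ n))%:E)%E.
  rewrite (@continuous_FTC2 _ g (\- psi))//.
  - by rewrite -EFinB /= opprK addrC.
  - exact: wc.
  - have sb s : a_ n <= s <= b_ n -> 0 < s < t.
      by move=> h; apply: (iab n); rewrite inE/= in_itv.
    have cpsi s : a_ n <= s <= b_ n -> {for s, continuous (\- psi)}.
      by move=> /sb /dpsi[h _]; exact/differentiable_continuous/derivable1_diffP.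
    split.
    + move=> s; rewrite in_itv/= => /andP[h1 h2].
      by have /dpsi[] : 0 < s < t by apply: sb; rewrite !ltW.
    + by apply: cvg_at_right_filter; apply: cpsi; rewrite lexx ltW.
    + by apply: cvg_at_left_filter; apply: cpsi; rewrite lexx ltW.
  - move=> s; rewrite in_itv/= => /andP[h1 h2].
    have /dpsi[_ e] : 0 < s < t by rewrite (lt_trans (an0 n) h1) (lt_trans h2 (bnt n)).
    by rewrite derive1E e.
have lb n : psi (a_ n) - psi (b_ n) <= \int[mu]_(s in `[a_ n, b_ n]) f s.
  have -> : psi (a_ n) - psi (b_ n) = \int[mu]_(s in `[a_ n, b_ n]) g s by rewrite /Rintegral FTC.
  have ci (h : R -> R) : (forall s, 0 < s < t -> {for s, continuous h}) -> mu.-integrable `[a_ n, b_ n] (EFin \o h).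
    by move=> ch; apply: continuous_compact_integrable; [exact: segment_compact|exact: wc].
  apply: le_Rintegral => //; [exact: ci|exact: ci|].
  move=> s /mem_set /iab /andP[s0 st]; rewrite /g lerBlDr lerDl.
  by rewrite !mulr_ge0 ?powR_ge0 ?subr_ge0 ?zmax// ?(ltW a0) ?(ltW s0) ?(ltW st).
have cvgf : \int[mu]_(s in `[a_ n, b_ n]) f s @[n --> \oo] --> \int[mu]_(s in `]0, t[) f s.
  have i_f := integrable_caputo_oo rz t0.
  have mI : measurable (`]0, t[%classic : set RT) by exact: measurable_itv.
  have mf : measurable_fun `]0, t[ f by apply/measurable_EFinP; case/integrableP: i_f.
  pose f_ (n : nat) : R -> R := f \_ `[a_ n, b_ n].
  have [_] : mu.-integrable `]0, t[ (EFin \o f) /\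
    (\int[mu]_(s in `]0%R, t[) (f_ n s)%:E)%E @[n --> \oo] --> (\int[mu]_(s in `]0%R, t[) (f s)%:E)%E.
    apply: (@dominated_convergenceW _ _ _ mu _ (fun n s => (f_ n s)%:E) (EFin \o f) (abse \o (EFin \o f))) => //.
    - move=> n; apply/measurable_EFinP; apply/measurable_restrict => //.
      by apply: measurable_funS mf => // x [].
    - move=> s; rewrite /= in_itv/= => /andP[s0 st]; apply: cvg_near_cst.
      near=> n; congr EFin; rewrite /f_ patchE mem_set//= in_itv/=; apply/andP; split.
        by near: n; apply: (cvgr_le 0).
      rewrite /b_ -/(a_ n) lerBrDr -lerBrDl; near: n; apply: (cvgr_le 0) => //.
      by rewrite subr_gt0.
    - exact: integrable_abse.
    - by move=> s n _; rewrite /f_ patchE; case: ifP => _ /=; rewrite lee_fin ?normr0.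
  rewrite -[X in _ --> X](fineK (integrable_fin_num mI i_f)).
  move/fine_cvg; apply: cvg_trans; apply: near_eq_cvg; apply: nearW => n.
  rewrite /= /Rintegral; congr fine.
  rewrite [RHS]integral_mkcond [LHS]integral_mkcond; apply: eq_integral => s _.
  rewrite /f_ !patchE; case: ifPn => //; rewrite ?notin_setE; last first.
    move=> ns; rewrite ifF//; apply/negbTE; rewrite notin_setE => sab; apply: ns.
    by move/mem_set/iab : sab; rewrite /= in_itv.
  by move=> _; case: ifP.
have ta : t - a_ n @[n --> \oo] --> t.
  by rewrite -[X in _ --> X]subr0; apply: cvgB => //; exact: cvg_cst.
have psia : psi (a_ n) @[n --> \oo] --> t `^ (- alpha) * (z t - z 0).
  apply: cvgM.
    exact: (cvg_comp _ _ ta (@continuous_powR _ (- alpha) t t0)).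
  apply: cvgB; first exact: cvg_cst.
  have /continuous_within_itvcyP[_ z0] := reg_continuous rz.
  by move/cvg_at_rightP : z0; apply.
(* The boundary term at [t] is [(t - s)^(1 - alpha)] times a difference quotient of [z] at [t],
   which converges because [z] is differentiable there. *)
have psib : psi (b_ n) @[n --> \oo] --> 0.
  have E n : psi (b_ n) = (a_ n) `^ (1 - alpha) * ((- a_ n)^-1 *: (z (- a_ n + t) - z t)).
    rewrite /psi /b_ -/(a_ n) subKr /GRing.scale /= (addrC (- a_ n)) invrN mulNr -mulrN opprB.
    rewrite mulrA; congr (_ * _); rewrite powRD ?(gt_eqF (an0 n)) ?implybT// powRr1 ?(ltW (an0 n))//.
    by rewrite mulrAC mulfV ?mul1r// gt_eqF.
  rewrite (_ : (fun n => psi (b_ n)) = (fun n => (a_ n) `^ (1 - alpha) *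
      ((- a_ n)^-1 *: (z (- a_ n + t) - z t)))); last by apply/funext.
  have h1 : (a_ n) `^ (1 - alpha) @[n --> \oo] --> 0.
    by move/cvg_at_rightP : (@powR_cvg0 R (1 - alpha) a1); apply.
  have [/cvg_ex[l zl] _] := dz t t0.
  move/cvgr_dnbhsP : zl => /(_ (fun n => - a_ n)) zl.
  have h2 : (- a_ n)^-1 *: (z (- a_ n + t) - z t) @[n --> \oo] --> l.
    rewrite (_ : (fun n => (- a_ n)^-1 *: (z (- a_ n + t) - z t)) =
        (fun n => (- a_ n)^-1 *: ((z \o shift t) (- a_ n)%:A - z t))); last first.
      by apply/funext => n; rewrite /= [(- a_ n)%:A]mulr1.
    apply: zl; split; first by move=> n; rewrite oppr_eq0 gt_eqF.
    by rewrite -oppr0; exact: cvgN.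
  have h3 : (a_ n) `^ (1 - alpha) * ((- a_ n)^-1 *: (z (- a_ n + t) - z t)) @[n --> \oo] --> 0 * l.
    by apply: cvgM; [exact: h1|exact: h2].
  by move: h3; rewrite mul0r.
have psiab : psi (a_ n) - psi (b_ n) @[n --> \oo] --> t `^ (- alpha) * (z t - z 0).
  by rewrite -[X in _ --> X]subr0; exact: cvgB.
by apply: (ler_cvg_to psiab cvgf); exact: nearW.
Unshelve. all: by end_near. Qed.

Lemma caputo_regular_ml y : geometric_growth y -> caputo_regular (ml alpha y).
Proof.
move=> gy; split.
- exact: within_continuous_ml.
- by move=> t t0; exact: ml_C1.
- by move=> t t0; have [] := caputo_ml alpha01 gy t0.
Qed.

Lemma powers_growth (K : R) : geometric_growth (fun k => K ^+ k).
Proof. by exists 1, `|K| => k; rewrite mul1r normrX. Qed.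

Lemma ml_powers_ge1 (K t : R) : 0 <= K -> 0 <= t -> 1 <= ml alpha (fun k => K ^+ k) t.
Proof.
move=> K0 t0; rewrite -[X in X <= _](expr0 K) -(ml0 alpha01 (fun k => K ^+ k)) /ml.
apply: psum_homo.
- exact/(entire_ml alpha01)/powers_growth.
- by move=> k; rewrite mulr_ge0 ?exprn_ge0// ltW// mlcoef_gt0.
- by rewrite powR0 ?gt_eqF// lexx powR_ge0.
Qed.

(* The Mittag-Leffler function [ml (K ^+ k)] satisfies [D^alpha b = K b], so it
   is a barrier for the maximum principle. *)
Lemma caputo_comparison w (c K M T : R) : caputo_regular w -> w 0 = 0 -> 0 < K -> 0 <= M ->
  (forall t, 0 < t <= T -> c * caputo alpha w t <= M * ml alpha (fun k => K ^+ k) t) ->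
  forall t, 0 <= t <= T -> c * w t <= M / K * ml alpha (fun k => K ^+ k) t.
Proof.
move=> rw w0 K0 M0 wM t /andP[t0 tT].
set b := ml alpha (fun k => K ^+ k).
have gK := powers_growth K.
have rb : caputo_regular b by exact: caputo_regular_ml.
have [rz cz] := caputo_regular_comb c (- (M / K)) rw rb.
set z := (fun t => _) in rz cz.
have MK : 0 <= M / K by rewrite divr_ge0// ltW.
have b0 : b 0 = 1 by rewrite /b ml0.
have z0 : z 0 <= 0 by rewrite /z w0 b0 mulr0 mulr1 add0r oppr_le0.
suff : z t <= 0 by rewrite /z mulNr subr_le0.
rewrite leNgt; apply/negP => zt.
have tp : 0 < t.
  by rewrite lt_neqAle t0 andbT; apply/eqP => te; move: zt; rewrite -te ltNge z0.
have cz0 : {within `[0, t], continuous z}.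
  apply: (@continuous_subspaceW R R `[0, t]%classic `[0, +oo[%classic); last exact: reg_continuous.
  by apply: subset_itvl; rewrite bnd_simp.
(* If [z = c w - (M / K) b] were positive somewhere, its maximum over [[0, t]] would be at some
   [s > 0]: there [caputo_max] makes the Caputo derivative positive, while the hypothesis makes it
   at most zero. *)
have [s] := EVT_max t0 cz0; rewrite in_itv/= => /andP[s0 st] smax.
have zs : 0 < z s by rewrite (lt_le_trans zt)// smax// in_itv/= t0 lexx.
have sp : 0 < s.
  by rewrite lt_neqAle s0 andbT; apply/eqP => se; move: zs; rewrite -se ltNge z0.
have := caputo_max rz sp.
have hm : forall r, 0 <= r <= s -> z r <= z s.
  by move=> r /andP[r0 rs]; apply: smax; rewrite in_itv/= r0 (le_trans rs).
move=> /(_ hm); apply/negP; rewrite -ltNge.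
have g0 : 0 < Gamma (1 - alpha) by exact: Gamma_gt0.
have -> : \int[mu]_(r in `[0, s]) caputo_integrand alpha s z r = Gamma (1 - alpha) * caputo alpha z s.
  by rewrite /caputo mulVKf// gt_eqF.
apply: (@le_lt_trans _ _ 0).
  rewrite pmulr_rle0// cz//.
  have -> : caputo alpha b s = K * b s.
    rewrite /b (caputo_ml alpha01 gK sp).2 /ml -psumZ; last exact: entire_ml.
    by congr psum; apply/funext => k; rewrite exprS mulrA.
  have := wM s; rewrite sp (le_trans st tT) => /(_ isT).
  have -> : - (M / K) * (K * b s) = - (M * b s) by field; rewrite gt_eqF.
  by rewrite -/b subr_le0.
by rewrite mulr_gt0 ?powR_gt0// subr_gt0 (le_lt_trans z0).
Qed.

End CaputoRegular.

Section ShiftedCombination.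
Context {R : realType}.
Implicit Types (f g : R -> R).

Definition smooth f : Prop := forall k x, derivable (derive1n k f) x 1.

(** One form for both operations needed: difference quotients, with [a = 1/h] and [b = -1/h], and
    differences of solutions, with [a = 1], [h = 0] and [b = -1]. *)
Definition shift_comb (a h b : R) f g (x : R) : R := a * f (x + h) + b * g x.

Lemma is_derive_shift_comb a h b f g x :
  derivable f (x + h) 1 -> derivable g x 1 ->
  is_derive x 1 (shift_comb a h b f g) (shift_comb a h b (derive1 f) (derive1 g) x).
Proof.
move=> df dg.
have hf : is_derive (x + h) 1 f (derive1 f (x + h)) by apply: DeriveDef => //; rewrite derive1E.
have hg : is_derive x 1 g (derive1 g x) by apply: DeriveDef => //; rewrite derive1E.
have hs : is_derive x 1 (fun x => x + h) 1.
  have h0 := is_deriveD (is_derive_id x (1 : R)) (is_derive_cst h x 1).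
  by apply: (is_derive_eq h0); rewrite addr0.
have hc := @is_derive1_comp R f (fun x => x + h) x _ _ hf hs.
have hh := is_deriveD (is_deriveZ a hc) (is_deriveZ b hg).
by apply: (is_derive_eq hh); rewrite /shift_comb /GRing.scale /= mulr1.
Qed.

Lemma derive1n_shift_comb a h b f g k : smooth f -> smooth g ->
  derive1n k (shift_comb a h b f g) = shift_comb a h b (derive1n k f) (derive1n k g).
Proof.
move=> sf sg; elim: k => [//|k ih].
apply/funext => x; rewrite derive1nS ih derive1E.
have [_ ->] := is_derive_shift_comb a b (sf k (x + h)) (sg k x).
by rewrite !derive1nS.
Qed.

Lemma smooth_shift_comb a h b f g : smooth f -> smooth g -> smooth (shift_comb a h b f g).
Proof.
move=> sf sg k x; rewrite derive1n_shift_comb//.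
by have [] := is_derive_shift_comb a b (sf k (x + h)) (sg k x).
Qed.

Lemma derive1_le g (x B : R) : derivable g x 1 ->
  (forall h, h != 0 -> `|shift_comb h^-1 h (- h^-1) g g x| <= B) -> `|derive1 g x| <= B.
Proof.
move=> dg gB; rewrite derive1E.
have /cvg_norm h : h^-1 *: ((g \o shift x) (h *: (1 : R)) - g x) @[h --> (0 : R)^'] --> 'D_1 g x by exact: dg.
apply: (cvgr_to_le h); near=> y.
have y0 : y != 0 by near: y; exact: nbhs_dnbhs_neq.
have := gB y y0; rewrite /shift_comb /GRing.scale /= mulr1 (addrC x) mulNr -mulrBr.
exact.
Unshelve. all: by end_near. Qed.

Lemma diff_quotient_le g (h B : R) : (forall x, derivable g x 1 /\ `|derive1 g x| <= B) ->
  h != 0 -> forall x, `|shift_comb h^-1 h (- h^-1) g g x| <= B.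
Proof.
move=> dg h0 x.
have E : shift_comb h^-1 h (- h^-1) g g x = h^-1 * (g (x + h) - g x).
  by rewrite /shift_comb mulNr -mulrBr.
have dg' (y : R) : is_derive y 1 g (derive1 g y).
  by apply: DeriveDef; [exact: (dg y).1|rewrite derive1E].
have cg (S : set R) : {within S, continuous g}.
  apply: continuous_subspaceT => y; have [d _] := dg' y.
  exact/differentiable_continuous/derivable1_diffP.
have mvt (y z : R) : y < z -> `|g z - g y| <= B * (z - y).
  move=> yz; have [c _ ->] := MVT yz (fun y _ => dg' y) (cg _).
  by rewrite normrM (gtr0_norm (_ : 0 < z - y)) ?subr_gt0// ler_wpM2r ?subr_ge0 ?(ltW yz)// (dg c).2.
rewrite E normrM normfV mulrC ler_pdivrMr ?normr_gt0//.
have [hp|hn] := ltP 0 h.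
  have := mvt x (x + h); rewrite ltrDl hp => /(_ isT).
  by rewrite (addrC x) addrK (gtr0_norm hp).
have {}hn : h < 0 by rewrite lt_neqAle h0.
have := mvt (x + h) x; rewrite gtrDl hn => /(_ isT).
by rewrite distrC opprD addNKr (ltr0_norm hn).
Qed.

End ShiftedCombination.

(** * Uniqueness by a contraction over all solutions with zero initial value *)

Section Uniqueness.
Context {R : realType}.
Variables (alpha : R) (N : nat) (beta : R[i]).
Hypothesis alpha01 : 0 < alpha < 1.
Implicit Types (w : R -> R -> R[i]).

(** The initial value is left out, so that the class is stable under shifts in [x] and linear
    combinations. *)
Record smooth_solution w : Prop := {
  ss_Re : forall x, caputo_regular alpha (fun t => complex.Re (w t x)) ;
  ss_Im : forall x, caputo_regular alpha (fun t => complex.Im (w t x)) ;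
  ss_smooth : forall t, 0 <= t -> reim smooth (w t) ;
  ss_eq : forall t x, 0 < t -> ccaputo alpha (w^~ x) t = opA N beta (w t) x }.

Definition shift_combC (a h b : R) w w' (t x : R) : R[i] :=
  a%:C * w t (x + h) + b%:C * w' t x.

Lemma Re_shift_combC a h b w w' t : (fun x => complex.Re (shift_combC a h b w w' t x)) =
  shift_comb a h b (fun x => complex.Re (w t x)) (fun x => complex.Re (w' t x)).
Proof. by apply/funext => x; rewrite /shift_combC ReD !ReZ. Qed.

Lemma Im_shift_combC a h b w w' t : (fun x => complex.Im (shift_combC a h b w w' t x)) =
  shift_comb a h b (fun x => complex.Im (w t x)) (fun x => complex.Im (w' t x)).
Proof. by apply/funext => x; rewrite /shift_combC ImD !ImZ. Qed.

Lemma complex_comb (a b p q p' q' : R) :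
  (a * p + b * p') +i* (a * q + b * q') = a%:C * (p +i* q) + b%:C * (p' +i* q').
Proof. by apply: complexP; rewrite ?ReD ?ImD ?ReZ ?ImZ. Qed.

Lemma smooth_solution_comb a h b w w' : smooth_solution w -> smooth_solution w' ->
  smooth_solution (shift_combC a h b w w').
Proof.
move=> sw sw'.
have eR x : (fun t => complex.Re (shift_combC a h b w w' t x)) =
    (fun t => a * complex.Re (w t (x + h)) + b * complex.Re (w' t x)).
  by apply/funext => t; rewrite /shift_combC ReD !ReZ.
have eI x : (fun t => complex.Im (shift_combC a h b w w' t x)) =
    (fun t => a * complex.Im (w t (x + h)) + b * complex.Im (w' t x)).
  by apply/funext => t; rewrite /shift_combC ImD !ImZ.
split.
- move=> x; rewrite eR; exact: (caputo_regular_comb a b (ss_Re sw (x + h)) (ss_Re sw' x)).1.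
- move=> x; rewrite eI; exact: (caputo_regular_comb a b (ss_Im sw (x + h)) (ss_Im sw' x)).1.
- move=> t t0; have [s1 s2] := ss_smooth sw t0; have [s3 s4] := ss_smooth sw' t0.
  split; first by rewrite Re_shift_combC; exact: smooth_shift_comb.
  by rewrite Im_shift_combC; exact: smooth_shift_comb.
- move=> t x t0; have [s1 s2] := ss_smooth sw (ltW t0); have [s3 s4] := ss_smooth sw' (ltW t0).
  have e1 := ss_eq sw (x + h) t0; have e2 := ss_eq sw' x t0.
  have -> : ccaputo alpha (shift_combC a h b w w'^~ x) t =
      a%:C * ccaputo alpha (w^~ (x + h)) t + b%:C * ccaputo alpha (w'^~ x) t.
    rewrite /ccaputo eR eI.
    rewrite (caputo_regular_comb a b (ss_Re sw (x + h)) (ss_Re sw' x)).2//.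
    rewrite (caputo_regular_comb a b (ss_Im sw (x + h)) (ss_Im sw' x)).2//.
    exact: complex_comb.
  rewrite e1 e2 /opA /cderive Re_shift_combC Im_shift_combC.
  rewrite !derive1n_shift_comb//.
  rewrite [a%:C * _]mulrCA [b%:C * _]mulrCA -mulrDr; congr (_ * _).
  by rewrite -complex_comb.
Qed.

Definition exp_type_le (T C r : R) w : Prop := forall t : R, 0 <= t <= T ->
  reim (fun v : R -> R => forall k x, `|derive1n k v x| <= C * r ^+ k) (w t).

Section Contraction.
Variables (T r : R).
Hypothesis T0 : 0 <= T.
Hypothesis r0 : 0 <= r.

Let cb : R := cnorm (beta / N`!%:R).
(** The comparison yields the factor [2 cb r^N / K], where 2 comes from adding the real and
    imaginary parts of the [N]-th derivative; this choice makes it at most [1/2], and the summand 1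
    keeps [K] positive. *)
Let K : R := 4 * cb * r ^+ N + 1.
Let cb0 : 0 <= cb. Proof. exact: cnorm_ge0. Qed.
Let cbr0 : 0 <= cb * r ^+ N. Proof. by rewrite mulr_ge0// exprn_ge0. Qed.
Let K0 : 0 < K. Proof. by rewrite ltr_wpDl// -mulrA mulr_ge0. Qed.
Let b (t : R) : R := ml alpha (fun k => K ^+ k) t.
Let b1 t : 0 <= t -> 1 <= b t. Proof. by move=> t0; apply: ml_powers_ge1 => //; exact: ltW. Qed.

Let hom_class C w : Prop :=
  [/\ smooth_solution w, forall x, w 0 x = 0 & exp_type_le T C r w].

Let hom_class_ge0 C w : hom_class C w -> 0 <= C.
Proof.
move=> [_ _ /(_ 0)]; rewrite lexx T0 => /(_ isT)[/(_ 0%N 0) + _].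
by rewrite expr0 mulr1; apply: le_trans.
Qed.

(** The mean value theorem bounds the [k]-th derivative of the quotient by [C r^(k + 1)], that is,
    by the class bound with constant [C r]. *)
Let hom_class_diff C h w : h != 0 -> hom_class C w ->
  hom_class (C * r) (shift_combC h^-1 h (- h^-1) w w).
Proof.
move=> h0 [sw w0 ew]; split.
- exact: smooth_solution_comb.
- by move=> x; rewrite /shift_combC !w0 !mulr0 addr0.
- move=> t tT; have /andP[t0 _] := tT; have [s1 s2] := ss_smooth sw t0; have [e1 e2] := ew t tT.
  split=> k x.
    rewrite Re_shift_combC derive1n_shift_comb// -mulrA -exprS.
    by apply: diff_quotient_le => // y; split; [exact: s1|rewrite -derive1nS; exact: e1].
  rewrite Im_shift_combC derive1n_shift_comb// -mulrA -exprS.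
  by apply: diff_quotient_le => // y; split; [exact: s2|rewrite -derive1nS; exact: e2].
Qed.

(** Quantified over the whole class at once, so that it also applies to the difference quotients of
    a given member. *)
Let bounded_by (q : R) : Prop := forall C w, hom_class C w -> forall t, 0 <= t <= T ->
  reim (fun v : R -> R => forall x, `|v x| <= C * q * b t) (w t).

(** Induction on [j]: the bound for the [j]-th derivative, applied to difference quotients, is
    uniform in [h] and passes to the [(j + 1)]-st derivative as [h] tends to [0]. *)
Let derivative_bound q : 0 <= q -> bounded_by q -> forall j C w, hom_class C w ->
  forall t, 0 <= t <= T ->
  reim (fun v : R -> R => forall x, `|derive1n j v x| <= C * r ^+ j * q * b t) (w t).
Proof.
move=> q0 hq; elim=> [|j ih] C w cw t tT.
  by rewrite expr0 mulr1; exact: hq.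
have [sw _ _] := cw; have /andP[t0 _] := tT; have [s1 s2] := ss_smooth sw t0.
split=> x; rewrite derive1nS; apply: derive1_le => [|h h0].
- exact: s1.
- have [+ _] := ih _ _ (hom_class_diff h0 cw) _ tT; move=> /(_ x).
  by rewrite Re_shift_combC derive1n_shift_comb// -(mulrA C) -exprS.
- exact: s2.
- have [_] := ih _ _ (hom_class_diff h0 cw) _ tT; move=> /(_ x).
  by rewrite Im_shift_combC derive1n_shift_comb// -(mulrA C) -exprS.
Qed.

Let contraction q : 0 <= q -> bounded_by q -> bounded_by (q / 2).
Proof.
move=> q0 hq C w cw t tT.
have C0 := hom_class_ge0 cw.
have [sw w0 ew] := cw.
have opAle s x : 0 < s <= T -> cnorm (opA N beta (w s) x) <= (2 * cb * (C * r ^+ N * q)) * b s.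
  move=> /andP[sp sT]; have sT' : 0 <= s <= T by rewrite ltW.
  have [h1 h2] := derivative_bound q0 hq N cw sT'.
  rewrite /opA (le_trans (cnormM _ _))// -/cb /cderive.
  have h : cnorm (derive1n N (fun y => complex.Re (w s y)) x +i* derive1n N (fun y => complex.Im (w s y)) x)
     <= 2 * (C * r ^+ N * q * b s).
    by rewrite /cnorm /= mulr_natl mulr2n lerD.
  by apply: (le_trans (ler_wpM2l cb0 h)); rewrite le_eqVlt; apply/orP; left; apply/eqP; ring.
have MK : 2 * cb * (C * r ^+ N * q) / K <= C * (q / 2).
  rewrite ler_pdivrMr//.
  have -> : C * (q / 2) * K = C * q * (2 * (cb * r ^+ N)) + C * q / 2 by rewrite /K; field.
  have -> : 2 * cb * (C * r ^+ N * q) = C * q * (2 * (cb * r ^+ N)) by ring.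
  by rewrite lerDl !mulr_ge0// invr_ge0.
have M0 : 0 <= 2 * cb * (C * r ^+ N * q) by rewrite !mulr_ge0 ?exprn_ge0.
have /andP[t0 tT'] := tT.
have bt0 : 0 <= b t by rewrite (le_trans _ (b1 t0)).
have concl (v : R -> R) : caputo_regular alpha v -> v 0 = 0 ->
    (forall s, 0 < s <= T -> `|caputo alpha v s| <= (2 * cb * (C * r ^+ N * q)) * b s) ->
    `|v t| <= C * (q / 2) * b t.
  move=> rv v0 hv.
  have cmp c : c ^+ 2 = 1 -> c * v t <= C * (q / 2) * b t.
    move=> c2; apply: (le_trans (@caputo_comparison _ _ alpha01 v c K _ T rv v0 K0 M0 _ t tT)); last first.
      by rewrite ler_wpM2r.
    move=> s sT; apply: le_trans (hv s sT).
    move/eqP : c2; rewrite sqrf_eq1 => /orP[]/eqP ->; first by rewrite mul1r ler_norm.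
    by rewrite mulN1r -normrN ler_norm.
  rewrite ler_norml; apply/andP; split.
    by rewrite lerNl -mulN1r cmp// sqrrN expr1n.
  by rewrite -[v t]mul1r cmp// expr1n.
split=> x; [apply: (concl (fun t => complex.Re (w t x)))|apply: (concl (fun t => complex.Im (w t x)))].
- exact: ss_Re.
- by rewrite w0.
- move=> s /[dup] sT /andP[sp _]; have := ss_eq sw x sp; rewrite /ccaputo => e.
  have -> : caputo alpha (fun t => complex.Re (w t x)) s = complex.Re (opA N beta (w s) x) by rewrite -e.
  exact: le_trans (le_Re_cnorm _) (opAle s x sT).
- exact: ss_Im.
- by rewrite w0.
- move=> s /[dup] sT /andP[sp _]; have := ss_eq sw x sp; rewrite /ccaputo => e.
  have -> : caputo alpha (fun t => complex.Im (w t x)) s = complex.Im (opA N beta (w s) x) by rewrite -e.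
  exact: le_trans (le_Im_cnorm _) (opAle s x sT).
Qed.

(** The class bound itself is the case [q = 1], because the barrier [b] is at least 1; each use of
    [contraction] then halves [q]. *)
Lemma hom_solution0 C w : smooth_solution w -> (forall x, w 0 x = 0) ->
  exp_type_le T C r w -> forall t x, 0 <= t <= T -> w t x = 0.
Proof.
move=> sw w0 ew t x tT.
have cw : hom_class C w by [].
have C0 := hom_class_ge0 cw.
have bnd m : bounded_by (2^-1 ^+ m).
  elim: m => [|m ih]; last by rewrite exprSr; apply: contraction => //; rewrite exprn_ge0 ?invr_ge0.
  move=> D v cv s sT; have [sv _ ev] := cv; have [h1 h2] := ev s sT.
  have D0 := hom_class_ge0 cv; have /andP[s0 _] := sT.
  have Db : D <= D * 1 * b s by rewrite mulr1 ler_peMr// b1.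
  split=> y; rewrite expr0; apply: le_trans Db.
    by have := h1 0%N y; rewrite expr0 mulr1.
  by have := h2 0%N y; rewrite expr0 mulr1.
have cv0 : (fun m => C * 2^-1 ^+ m * b t) @ \oo --> 0.
  rewrite -(mul0r (b t)); apply: cvgM; last exact: cvg_cst.
  rewrite -(mulr0 C); apply: cvgM; first exact: cvg_cst.
  by apply: cvg_expr; rewrite ger0_norm ?invr_ge0// invf_lt1// ltr1n.
have z0 (a : R) : (forall m, `|a| <= C * 2^-1 ^+ m * b t) -> a = 0.
  move=> ha; apply/eqP; rewrite -normr_le0.
  by apply: (ler_cvg_to (@cvg_cst _ `|a| _ \oo _) cv0); exact: nearW.
apply: complexP; apply: z0 => m; first exact: (bnd m _ _ cw t tT).1.
exact: (bnd m _ _ cw t tT).2.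
Qed.

End Contraction.

Lemma smooth_solution_of (f : R -> R) w : caputo_solution alpha N beta f w ->
  bounded_exp_type w -> smooth_solution w.
Proof.
move=> sw bw; split.
- move=> x; split; [exact: (sol_time_continuous sw x).1|exact: (sol_time_C1 sw x).1|].
  by move=> t t0; exact: (sol_caputo_integrable sw x t0).1.
- move=> x; split; [exact: (sol_time_continuous sw x).2|exact: (sol_time_C1 sw x).2|].
  by move=> t t0; exact: (sol_caputo_integrable sw x t0).2.
- move=> t t0; have [C [r /(_ t)]] := bw t; rewrite t0 lexx => /(_ isT)[h1 h2].
  by split=> k x; [have [] := h1 k x|have [] := h2 k x].
- by move=> t x t0; exact: (sol_equation sw x t0).
Qed.

Lemma caputo_solution_unique (f : R -> R) u v :
  caputo_solution alpha N beta f u -> bounded_exp_type u ->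
  caputo_solution alpha N beta f v -> bounded_exp_type v ->
  forall t x : R, 0 <= t -> v t x = u t x.
Proof.
move=> su bu sv bv t x t0.
have ssu := smooth_solution_of su bu; have ssv := smooth_solution_of sv bv.
(* The difference [v - u], as a combination with shift zero. *)
have sw := smooth_solution_comb 1 0 (-1) ssv ssu.
set w := shift_combC _ _ _ _ _ in sw.
have w0 y : w 0 y = 0.
  by rewrite /w /shift_combC addr0 (sol_initial su) (sol_initial sv) rmorphN1 mul1r mulN1r subrr.
have [C1 [r1 h1]] := bu t; have [C2 [r2 h2]] := bv t.
have le2 (a c : R) (C C' q q' : R) k : `|a| <= C * q ^+ k -> `|c| <= C' * q' ^+ k ->
    `|1 * a + -1 * c| <= (`|C| + `|C'|) * (`|q| + `|q'|) ^+ k.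
  move=> ha hc; rewrite mul1r mulN1r (le_trans (ler_normB _ _))// mulrDl lerD//.
    apply: (le_trans ha); rewrite (le_trans (ler_norm _))// normrM normrX ler_wpM2l//.
    by rewrite lerXn2r ?nnegrE ?addr_ge0// lerDl.
  apply: (le_trans hc); rewrite (le_trans (ler_norm _))// normrM normrX ler_wpM2l//.
  by rewrite lerXn2r ?nnegrE ?addr_ge0// lerDr.
have ew : exp_type_le t (`|C2| + `|C1|) (`|r2| + `|r1|) w.
  move=> s st; have /andP[s0 _] := st.
  have [a1 a2] := h1 s st; have [c1 c2] := h2 s st.
  have [s1 s2] := ss_smooth ssu s0; have [s3 s4] := ss_smooth ssv s0.
  split=> k y.
    rewrite /w Re_shift_combC derive1n_shift_comb// /shift_comb.
    by apply: le2; [exact: (c1 k _).2|exact: (a1 k _).2].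
  rewrite /w Im_shift_combC derive1n_shift_comb// /shift_comb.
  by apply: le2; [exact: (c2 k _).2|exact: (a2 k _).2].
have r0 : 0 <= `|r2| + `|r1| by exact: addr_ge0.
have := hom_solution0 t0 r0 sw w0 ew x; move=> /(_ t); rewrite t0 lexx => /(_ isT).
by rewrite /w /shift_combC addr0 rmorphN1 mul1r mulN1r => /eqP; rewrite subr_eq0 => /eqP.
Qed.

End Uniqueness.

(** * Existence for the Caputo problem *)

Section MittagLefflerLinear.
Context {R : realType}.
Variable alpha : R.
Hypothesis alpha01 : 0 < alpha < 1.
Implicit Types (y z : nat -> R) (t : R).

Lemma mlD y z t : geometric_growth y -> geometric_growth z ->
  ml alpha (fun k => y k + z k) t = ml alpha y t + ml alpha z t.
Proof.
move=> gy gz; rewrite /ml -psumD; try exact: entire_ml.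
by congr psum; apply/funext => k; rewrite mulrDl.
Qed.

Lemma mlZ (a : R) y t : geometric_growth y -> ml alpha (fun k => a * y k) t = a * ml alpha y t.
Proof.
move=> gy; rewrite /ml -psumZ; last exact: entire_ml.
by congr psum; apply/funext => k; rewrite mulrA.
Qed.

Lemma ml_le y (K C t : R) : 0 <= K -> 0 <= C -> (forall k, `|y k| <= C * K ^+ k) ->
  `|ml alpha y t| <= C * ml alpha (fun k => K ^+ k) t.
Proof.
move=> K0 C0 yK.
have gy : geometric_growth y by exists C, K.
rewrite -mlZ; last exact: powers_growth.
rewrite /ml -[X in _ <= psum _ X]ger0_norm ?powR_ge0//; apply: psum_le.
- exact: entire_ml.
- by apply: entire_ml => //; exists C, K => k; rewrite ger0_norm// mulr_ge0// exprn_ge0.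
- move=> k; rewrite normrM (gtr0_norm (mlcoef_gt0 alpha01 k)) ler_wpM2r//.
  exact: ltW (mlcoef_gt0 alpha01 k).
Qed.

Lemma ml_powers_homo (K s t : R) : 0 <= K -> 0 <= s <= t ->
  ml alpha (fun k => K ^+ k) s <= ml alpha (fun k => K ^+ k) t.
Proof.
move=> K0 /andP[s0 st]; apply: psum_homo.
- by apply: entire_ml => //; exact: powers_growth.
- by move=> k; rewrite mulr_ge0 ?exprn_ge0// ltW// mlcoef_gt0.
- rewrite powR_ge0/= ge0_ler_powR ?nnegrE//; last exact: le_trans st.
  by case/andP: alpha01 => /ltW.
Qed.

End MittagLefflerLinear.

Section Existence.
Context {R : realType}.
Local Notation RT := (measurableTypeR R).
Variables (alpha : R) (N : nat) (beta : R[i]).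
Hypothesis alpha01 : 0 < alpha < 1.
Variables (mu : complex_measure R) (r : R).
Hypothesis r0 : 0 <= r.
Hypothesis supp_mu : forall A : set RT, measurable A ->
  A `&` `[- r, r]%classic = set0 -> cm_re mu A = 0%E /\ cm_im mu A = 0%E.

Let V := complex_mass mu * 2.
Let V0 : 0 <= V. Proof. by rewrite mulr_ge0// complex_mass_ge0. Qed.
Let p := beta / N`!%:R.
Let K := cnorm p * r ^+ N.
Let K0 : 0 <= K. Proof. by rewrite mulr_ge0 ?cnorm_ge0 ?exprn_ge0. Qed.

(* [ml_term j x k] is the [j]-th derivative at [x] of [(A_{N,beta})^k f]. *)
Definition ml_term (j : nat) (x : R) (k : nat) : R[i] :=
  (beta / N`!%:R) ^+ k * moment mu (N * k + j) x%:C.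

Lemma ml_term_le j x k : cnorm (ml_term j x k) <= V * r ^+ j * K ^+ k.
Proof.
rewrite /ml_term -/p (le_trans (cnormM _ _))//.
apply: (@le_trans _ _ (cnorm p ^+ k * (V * r ^+ (N * k + j)))).
  by rewrite ler_pM ?cnorm_ge0 ?cnormX// (moment_le supp_mu).
rewrite exprD exprM /K exprMn le_eqVlt; apply/orP; left; apply/eqP; ring.
Qed.

Lemma growth_Re j x : geometric_growth (fun k => complex.Re (ml_term j x k)).
Proof. by exists (V * r ^+ j), K => k; exact: le_trans (le_Re_cnorm _) (ml_term_le _ _ _). Qed.

Lemma growth_Im j x : geometric_growth (fun k => complex.Im (ml_term j x k)).
Proof. by exists (V * r ^+ j), K => k; exact: le_trans (le_Im_cnorm _) (ml_term_le _ _ _). Qed.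

(** Formally [E_alpha (t^alpha A) f (x)]; the parts are separated because [ml] takes real
    coefficients. *)
Definition ml_solution (t x : R) : R[i] :=
  ml alpha (fun k => complex.Re (ml_term 0 x k)) t +i*
  ml alpha (fun k => complex.Im (ml_term 0 x k)) t.

(** The remainder depends on [k] only through [K^k], the growth that the Mittag-Leffler series sums
    in [ml_le]. *)
Lemma ml_term_diff j x k h : `|h| <= 1 ->
  cnorm (ml_term j (x + h) k - ml_term j x k - h%:C * ml_term j.+1 x k) <=
  V * r ^+ j * (r ^+ 2 / 2 * expR `|r|) * h ^+ 2 * K ^+ k.
Proof.
move=> h1; rewrite /ml_term -/p addnS.
have -> (a b c d e : R[i]) : a * b - a * c - d * (a * e) = a * (b - c - d * e) by ring.
apply: (le_trans (cnormM _ _)).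
apply: (@le_trans _ _ (cnorm p ^+ k * (V * r ^+ (N * k + j) * (r ^+ 2 / 2 * expR `|r|) * h ^+ 2))).
  by rewrite ler_pM ?cnorm_ge0 ?cnormX// (moment_diff_le supp_mu).
rewrite exprD exprM /K exprMn; move: (r ^+ 2 / 2 * _) => c.
by rewrite le_eqVlt; apply/orP; left; apply/eqP; ring.
Qed.

(** Here [q] stands for the real or the imaginary part. The remainders of the terms add up to a
    quadratic remainder of the series, which gives the derivative termwise. *)
Lemma is_derive_ml_term (q : R[i] -> R) j t (x : R) :
  (forall z w, q (z - w) = q z - q w) -> (forall a z, q (a%:C * z) = a * q z) ->
  (forall z, `|q z| <= cnorm z) ->
  is_derive x 1 (fun x => ml alpha (fun k => q (ml_term j x k)) t)
    (ml alpha (fun k => q (ml_term j.+1 x k)) t).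
Proof.
move=> qB qZ qle.
have gq i y : geometric_growth (fun k => q (ml_term i y k)).
  by exists (V * r ^+ i), K => k; exact: le_trans (qle _) (ml_term_le _ _ _).
have gM (a : R) y : geometric_growth y -> geometric_growth (fun k => a * y k).
  by move=> [C [L yL]]; exists (`|a| * C), L => k; rewrite normrM -mulrA ler_wpM2l.
set L := ml alpha (fun k => K ^+ k) t.
apply: (@is_derive_quadratic _ _ _ _ (V * r ^+ j * (r ^+ 2 / 2 * expR `|r|) * `|L|)) => h h1.
rewrite (_ : _ - _ - _ = ml alpha (fun k => q (ml_term j (x + h) k - ml_term j x k - h%:C * ml_term j.+1 x k)) t); last first.
  transitivity (ml alpha (fun k => q (ml_term j (x + h) k) + ((-1) * q (ml_term j x k) + (- h) * q (ml_term j.+1 x k))) t).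
    have g1 := gM (-1) _ (gq j x); have g2 := gM (- h) _ (gq j.+1 x).
    rewrite mlD//; last first.
      move: g1 g2 => [C [M h2]] [C' [M' h3]]; exists (`|C| + `|C'|), (`|M| + `|M'|) => k.
      rewrite (le_trans (ler_normD _ _))// mulrDl lerD//.
        apply: (le_trans (h2 k)); rewrite (le_trans (ler_norm _))// normrM normrX ler_wpM2l//.
        by rewrite lerXn2r ?nnegrE ?addr_ge0// lerDl.
      apply: (le_trans (h3 k)); rewrite (le_trans (ler_norm _))// normrM normrX ler_wpM2l//.
      by rewrite lerXn2r ?nnegrE ?addr_ge0// lerDr.
    rewrite mlD// !mlZ//; move: (ml _ _ _) (ml _ _ _) (ml _ _ _) => A B D; ring.
  by congr (ml _ _ _); apply/funext => k; rewrite !qB qZ; ring.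
have hc : 0 <= r ^+ 2 / 2 * expR `|r| by rewrite !mulr_ge0 ?sqr_ge0 ?invr_ge0 ?expR_ge0.
have C0 : 0 <= V * r ^+ j * (r ^+ 2 / 2 * expR `|r|) * h ^+ 2.
  by rewrite mulr_ge0 ?sqr_ge0// mulr_ge0// mulr_ge0// exprn_ge0.
apply: (le_trans (ml_le alpha01 _ K0 C0 _)).
  by move=> k; apply: (le_trans (qle _)); exact: ml_term_diff.
rewrite -/L; move: (r ^+ 2 / 2 * _) C0 => c C0.
rewrite [leRHS](_ : _ = V * r ^+ j * c * h ^+ 2 * `|L|); last ring.
by rewrite ler_wpM2l// ler_norm.
Qed.

Lemma derive1n_Re_solution j t x :
  derive1n j (fun x => complex.Re (ml_solution t x)) x =
    ml alpha (fun k => complex.Re (ml_term j x k)) t /\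
  derivable (derive1n j (fun x => complex.Re (ml_solution t x))) x 1.
Proof.
have d i y := @is_derive_ml_term (@complex.Re R) i t y (@ReB R) (@ReZ R) (@le_Re_cnorm R).
have E i : derive1n i (fun x => complex.Re (ml_solution t x)) =
    (fun x => ml alpha (fun k => complex.Re (ml_term i x k)) t).
  elim: i => [//|i ih]; apply/funext => y; rewrite derive1nS ih derive1E.
  by have [_ ->] := d i y.
by rewrite E; split => //; have [] := d j x.
Qed.

Lemma derive1n_Im_solution j t x :
  derive1n j (fun x => complex.Im (ml_solution t x)) x =
    ml alpha (fun k => complex.Im (ml_term j x k)) t /\
  derivable (derive1n j (fun x => complex.Im (ml_solution t x))) x 1.
Proof.
have d i y := @is_derive_ml_term (@complex.Im R) i t y (@ImB R) (@ImZ R) (@le_Im_cnorm R).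
have E i : derive1n i (fun x => complex.Im (ml_solution t x)) =
    (fun x => ml alpha (fun k => complex.Im (ml_term i x k)) t).
  elim: i => [//|i ih]; apply/funext => y; rewrite derive1nS ih derive1E.
  by have [_ ->] := d i y.
by rewrite E; split => //; have [] := d j x.
Qed.

Lemma ml_solution_bounded : bounded_exp_type ml_solution.
Proof.
move=> T; exists (V * ml alpha (fun k => K ^+ k) T), r => t /andP[t0 tT].
have b (q : R[i] -> R) j x : (forall z, `|q z| <= cnorm z) ->
    `|ml alpha (fun k => q (ml_term j x k)) t| <= V * ml alpha (fun k => K ^+ k) T * r ^+ j.
  move=> qle.
  apply: (le_trans (@ml_le _ _ alpha01 _ K (V * r ^+ j) t K0 _ _)).
  - by rewrite mulr_ge0// exprn_ge0.
  - by move=> k; exact: le_trans (qle _) (ml_term_le _ _ _).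
  - rewrite mulrAC ler_wpM2r ?exprn_ge0// ler_wpM2l// ml_powers_homo// t0//.
split=> k x; have [eR dR] := derive1n_Re_solution k t x; have [eI dI] := derive1n_Im_solution k t x.
  by split => //; rewrite eR; apply: b; exact: le_Re_cnorm.
by split => //; rewrite eI; apply: b; exact: le_Im_cnorm.
Qed.

Lemma caputo_ml_solution (f : R -> R) : (forall x, (f x)%:C = fourier mu x%:C) ->
  caputo_solution alpha N beta f ml_solution.
Proof.
move=> fE; split.
- move=> x; rewrite /ml_solution !ml0// /ml_term !expr0 !mul1r muln0 addn0 complex_eta.
  by rewrite fE fourierE.
- by move=> x; split; apply: within_continuous_ml => //; [exact: growth_Re|exact: growth_Im].
- by move=> x; split=> t t0; apply: ml_C1 => //; [exact: growth_Re|exact: growth_Im].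
- move=> t x t0; split.
    by have [] := caputo_ml alpha01 (growth_Re 0 x) t0.
  by have [] := caputo_ml alpha01 (growth_Im 0 x) t0.
- move=> t t0; split=> k x _; first by have [] := derive1n_Re_solution k t x.
  by have [] := derive1n_Im_solution k t x.
- move=> t x t0.
  (* This is [A^(k + 1) f = p (A^k f)^(N)]: the index shift caused by the Caputo derivative is the
     action of [A]. *)
  have shift k : ml_term 0 x k.+1 = p * ml_term N x k.
    by rewrite /ml_term -/p mulrA -exprS mulnS addn0 addnC.
  rewrite /ccaputo /=.
  rewrite (caputo_ml alpha01 (growth_Re 0 x) t0).2 (caputo_ml alpha01 (growth_Im 0 x) t0).2.
  rewrite /opA /cderive (derive1n_Re_solution N t x).1 (derive1n_Im_solution N t x).1 -/p.
  have gR := growth_Re N x; have gI := growth_Im N x.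
  have gM (a : R) y : geometric_growth y -> geometric_growth (fun k => a * y k).
    by move=> [C [L yL]]; exists (`|a| * C), L => k; rewrite normrM -mulrA ler_wpM2l.
  move: (p) shift => q shift.
  apply: complexP; rewrite ?(ReM, ImM) /=.
    rewrite -mulNr -!(mlZ alpha01)// -(mlD alpha01); try exact: gM.
    by congr (ml _ _ _); apply/funext => k; rewrite shift ReM mulNr.
  rewrite -!(mlZ alpha01)// -(mlD alpha01); try exact: gM.
  by congr (ml _ _ _); apply/funext => k; rewrite shift ImM.
Qed.

End Existence.

(** * Injectivity of the Laplace transform *)

Section LaplaceUniqueness.
Context {R : realType}.
Local Notation RT := (measurableTypeR R).
Local Notation mu := (@lebesgue_measure R).
Local Notation D := (`]0%R, +oo[%classic : set RT).
Implicit Types (w : R -> R).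
Variable g : R -> R.

(** The weights orthogonal to [g]. They are closed under linear combinations and dominated limits,
    and the argument enlarges them from exponentials to steps. *)
Definition annihilates w := mu.-integrable D (fun x => (w x * g x)%:E) /\
  (\int[mu]_(x in D) (w x * g x)%:E = 0)%E.

Hypothesis laplace0 : forall l, 0 < l -> annihilates (fun x => expR (- (l * x))).

Let mD : measurable D. Proof. exact: measurable_itv. Qed.

Lemma annihilates_ext w w' : {in D, w =1 w'} -> annihilates w -> annihilates w'.
Proof.
move=> ww [iw w0]; split.
  by apply: eq_integrable iw => // x /ww ->.
by rewrite -[RHS]w0; apply: eq_integral => x /ww ->.
Qed.

Lemma annihilatesZ a w : annihilates w -> annihilates (fun x => a * w x).
Proof.
move=> [iw w0]; split.
  have := integrableZl mD a iw; apply: eq_integrable => // x _.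
  by rewrite -mulrA EFinM.
under eq_integral do rewrite -mulrA EFinM.
by rewrite integralZl// w0 mule0.
Qed.

Lemma annihilatesD w w' : annihilates w -> annihilates w' ->
  annihilates (fun x => w x + w' x).
Proof.
move=> [iw w0] [iw' w0']; split.
  have := integrableD mD iw iw'; apply: eq_integrable => // x _.
  by rewrite mulrDl EFinD.
under eq_integral do rewrite mulrDl EFinD.
by rewrite integralD// w0 w0' adde0.
Qed.

Lemma annihilates_sum (w_ : nat -> R -> R) n : (forall j, annihilates (w_ j)) ->
  annihilates (fun x => \sum_(j < n) w_ j x).
Proof.
move=> w_0; elim: n => [|n ih].
  apply: (@annihilates_ext (fun x => 0 * w_ 0%N x)); last exact: annihilatesZ.
  by move=> x _; rewrite big_ord0 mul0r.
apply: (@annihilates_ext (fun x => \sum_(j < n) w_ j x + w_ n x)); last exact: annihilatesD.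
by move=> x _; rewrite big_ord_recr.
Qed.

(** Domination by [C e^(-x)] is enough because [e^(-x) g] is integrable, by the hypothesis at
    [l = 1]. *)
Lemma annihilates_lim (w_ : nat -> R -> R) w C : (forall n, annihilates (w_ n)) ->
  (forall x n, 0 < x -> `|w_ n x| <= C * expR (- x)) ->
  (forall x, 0 < x -> w_ ^~ x @ \oo --> w x) -> annihilates w.
Proof.
move=> w_0 w_le w_cvg.
have [ig _] : annihilates (fun x => expR (- (1 * x))) by exact: laplace0.
have iG : mu.-integrable D (fun x => (C%:E * `|(expR (- (1 * x)) * g x)%:E|)%E).
  by apply: integrableZl => //; exact: integrable_abse.
have D0 x : D x -> 0 < x by rewrite /= in_itv/= andbT.
have cw_ x : D x -> (w_ n x * g x)%:E @[n --> \oo] --> (w x * g x)%:E.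
  move=> /D0 x0; apply: cvg_EFin; first exact: nearW.
  by apply: cvgM; [exact: w_cvg|exact: cvg_cst].
have [|iw cw] := @dominated_convergenceW _ _ _ mu D (fun n x => (w_ n x * g x)%:E)
  (fun x => (w x * g x)%:E) _ mD (fun n => measurable_int mu (w_0 n).1)
  cw_ iG.
- move=> x n /D0 x0; rewrite !abse_EFin -EFinM lee_fin !normrM mulrA.
  by rewrite ler_wpM2r// (ger0_norm (expR_ge0 _)) mul1r w_le.
- split => //; rewrite -(cvg_lim _ cw)//; apply: lim_near_cst => //.
  by apply: nearW => n; case: (w_0 n).
Qed.

(** With [Y = e^((n + 1) t)], expanding the outer exponential gives terms in [e^(-(n + 1) j x)] with
    [j >= 1]; subtracting from 1 removes the constant term. All rates are at least 1, so the partial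
    sums are bounded by [e^Y e^(-x)]. *)
Lemma annihilates_double_exp n t :
  annihilates (fun x => 1 - expR (- expR (- (n.+1%:R * (x - t))))).
Proof.
pose Y := expR (n.+1%:R * t).
pose w_ j (x : R) : R := - ((- Y) ^+ j.+1 / j.+1`!%:R) * expR (- (n.+1%:R * j.+1%:R * x)).
have w_0 j : annihilates (w_ j).
  by apply: annihilatesZ; apply: laplace0; rewrite mulr_gt0// ltr0n.
have w_E j x : w_ j x = - ((- expR (- (n.+1%:R * (x - t)))) ^+ j.+1 / j.+1`!%:R).
  rewrite /w_ mulNr; congr (- _); rewrite mulrAC; congr (_ / _).
  rewrite -[- Y]mulN1r -[- expR _]mulN1r ![(_ * _) ^+ _]exprMn -[LHS]mulrA; congr (_ * _).
  by rewrite /Y -!expRM_natl -expRD; congr expR; ring.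
apply: (@annihilates_lim (fun J x => \sum_(j < J) w_ j x) _ (expR Y)).
- by move=> J; exact: annihilates_sum.
- move=> x J x0; apply: (le_trans (ler_norm_sum _ _ _)).
  apply: (@le_trans _ _ (\sum_(j < J) expR (- x) * (Y ^+ j.+1 / j.+1`!%:R))).
    apply: ler_sum => j _; rewrite /w_ normrM normrN normrM normrX normrN mulrC.
    rewrite (ger0_norm (expR_ge0 _)) (ger0_norm (expR_ge0 _)).
    rewrite normfV (@ger0_norm _ _%:R)// ler_wpM2r//.
    rewrite ler_expR lerN2 -[leLHS]mul1r ler_wpM2r// ?(ltW x0)//.
    by rewrite -natrM ler1n.
  rewrite -mulr_sumr mulrC ler_wpM2r ?expR_ge0//.
  apply: le_trans (sum_expR_le J.+1 (expR_ge0 _)).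
  by rewrite big_ord_recl lerDr divr_ge0// exprn_ge0// expR_ge0.
- move=> x x0.
  set y := expR (- (n.+1%:R * (x - t))) in w_E *.
  have : series (exp_coeff (- y)) J.+1 @[J --> \oo] --> expR (- y).
    by rewrite cvg_shiftS; exact: is_cvg_series_exp_coeff.
  move=> /(cvgB (cvg_cst (1 : R))); apply: cvg_trans; apply: near_eq_cvg; apply: nearW => J.
  rewrite [LHS]/= !fctE exp_coeffE /series /= big_nat_recl// big_mkord expr0 fact0 invr1 mulr1.
  rewrite opprD addrA subrr sub0r -sumrN; apply: eq_bigr => j _.
  by rewrite w_E mulrC.
Qed.

(** At [x = t] every double exponential equals [1 - e^(-1)], which is therefore the value of the
    limit there. *)
Definition step_weight (t x : R) : R :=
  if x < t then 1 else if x == t then 1 - expR (- 1) else 0.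

(* Phragmen's inversion: the double exponentials tend to the indicator of [x < t]. *)
Lemma annihilates_step t : annihilates (step_weight t).
Proof.
(* The bound [e^(t - x)] holds for [x <= t] because the weight is at most 1, and for [x > t] because
   [1 - e^(-y) <= y]. *)
apply: (@annihilates_lim (fun n x => 1 - expR (- expR (- (n.+1%:R * (x - t))))) _ (expR t)).
- by move=> n; exact: annihilates_double_exp.
- move=> x n x0; rewrite ger0_norm; last by rewrite subr_ge0 -expR0 ler_expR oppr_le0 expR_ge0.
  rewrite -expRD; have [xt|tx] := leP x t.
    apply: (@le_trans _ _ 1); first by rewrite lerBlDr lerDl expR_ge0.
    by rewrite -expR0 ler_expR subr_ge0.
  apply: (@le_trans _ _ (expR (- (n.+1%:R * (x - t))))).
    by rewrite lerBlDr -lerBlDl (le_trans _ (expR_ge1Dx _))//.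
  rewrite ler_expR lerNl opprD opprK addrC -[leLHS]mul1r ler_wpM2r ?subr_ge0 ?(ltW tx)//.
  by rewrite ler1n.
- move=> x x0; rewrite /step_weight.
  have expRN_le (c : R) : 0 < c -> expR (- c) <= c^-1.
    move=> c0; rewrite expRN lef_pV2 ?posrE ?expR_gt0//.
    by apply: le_trans (expR_ge1Dx c); rewrite lerDr.
  have cvgV (c : R) : 0 < c -> (n.+1%:R * c)^-1 @[n --> \oo] --> (0 : R).
    move=> c0; have : c^-1 * harmonic n @[n --> \oo] --> c^-1 * (0 : R).
      by apply: cvgM; [exact: cvg_cst|exact: cvg_harmonic].
    by rewrite mulr0; apply: cvg_trans; apply: near_eq_cvg; apply: nearW => n; rewrite invfM mulrC.
  case: ltgtP => [xt|tx|->].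
  + have h : expR (- expR (- (n.+1%:R * (x - t)))) @[n --> \oo] --> (0 : R).
      have tx : 0 < t - x by rewrite subr_gt0.
      apply: (squeeze_cvgr _ (cvg_cst 0) (cvgV _ tx)); apply: nearW => n.
      have c0 : 0 < n.+1%:R * (t - x) by rewrite mulr_gt0.
      rewrite expR_ge0/=; apply: le_trans (expRN_le _ c0).
      rewrite ler_expR lerN2 -mulrN opprB (le_trans _ (expR_ge1Dx _))//.
      by rewrite lerDr.
    have := cvgB (cvg_cst (1 : R)) h; rewrite subr0; exact.
  + have xt : 0 < x - t by rewrite subr_gt0.
    apply: (squeeze_cvgr _ (cvg_cst 0) (cvgV _ xt)); apply: nearW => n.
    have c0 : 0 < n.+1%:R * (x - t) by rewrite mulr_gt0.
    rewrite subr_ge0 -[X in _ <= X]expR0 ler_expR oppr_le0 expR_ge0/=.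
    apply: le_trans (expRN_le _ c0).
    by rewrite lerBlDr -lerBlDl (le_trans _ (expR_ge1Dx _))//.
  + under eq_fun do rewrite subrr mulr0 oppr0 expR0.
    exact: cvg_cst.
Qed.

(** The difference of the steps at [b] and [a] is nonnegative, vanishes outside [[a, b]] and equals
    1 inside, so its integral against [g] would be at least [e (b - a)]. *)
Lemma laplace0_not_pos (a b e : R) : 0 < a -> a < b -> 0 < e ->
  ~ (forall x, a <= x <= b -> e <= g x).
Proof.
move=> a0 ab e0 eg.
have [iw w0] := annihilatesD (annihilates_step b) (annihilatesZ (-1) (annihilates_step a)).
set w := (X in mu.-integrable D X) in iw w0.
have wE x : 0 < x -> ((if a < x < b then e else 0)%:E <= w x)%E.
  move=> x0; rewrite /w lee_fin /step_weight.
  have e1 : 0 <= 1 - expR (-1) :> R by rewrite subr_ge0 -[leRHS]expR0 ler_expR; lra.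
  have e2 : 1 - expR (-1) <= 1 :> R by rewrite lerBlDr lerDl expR_ge0.
  have gx : a <= x <= b -> 0 <= g x by move=> /eg; apply: le_trans; exact: ltW.
  case: (ltgtP x b) => [xb|bx|xb]; case: (ltgtP x a) => [xa|ax|xa] //=; rewrite ?andbT ?andbF.
  - by rewrite mulr1 subrr mul0r.
  - by rewrite mulr0 addr0 mul1r eg// !ltW.
  - have := gx; rewrite xa lexx (ltW ab) => /(_ isT) g0.
    by rewrite mulr_ge0//; lra.
  - by exfalso; lra.
  - by rewrite mulr0 addr0 mul0r.
  - by exfalso; lra.
  - by exfalso; lra.
  - rewrite mulr0 addr0 mulr_ge0// gx// xb lexx andbT; exact: ltW.
  - by exfalso; lra.
have : (\int[mu]_(x in D) ((if a < x < b then e else 0)%:E) <= 0)%E.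
  rewrite -w0; apply: ge0_le_integral => //.
  - by move=> x _; case: ifPn => _; rewrite lee_fin// ltW.
  - apply/measurable_EFinP; apply: (@measurable_funTS _ _ RT).
    by apply: measurable_fun_ifT => //; apply: measurable_and; exact: measurable_fun_ltr.
  - exact: measurable_int iw.
  - by move=> x; rewrite /= in_itv/= andbT; exact: wE.
apply/negP; rewrite -ltNge.
have -> : (\int[mu]_(x in D) ((if a < x < b then e else 0)%:E) =
    \int[mu]_(x in `]a, b[) (cst e%:E x))%E.
  rewrite [LHS]integral_mkcond [RHS]integral_mkcond; apply: eq_integral => x _.
  rewrite !patchE !mem_setE !in_itv/= andbT; case: ifPn => [x0|]; first by case: ifPn.
  by case: ifPn => // /andP[ax _]; rewrite (lt_trans a0 ax).
rewrite integral_cst//= lebesgue_measure_itv/= lte_fin ab -EFinD -EFinM lte_fin.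
by rewrite mulr_gt0// subr_gt0.
Qed.

End LaplaceUniqueness.

(** Monotonicity of one function and continuity of the other give equality at every point: a gap
    [M t > G t] persists to the right of [t] and a gap [M t < G t] to the left, against
    [laplace0_not_pos]. *)
Lemma laplace_injective {R : realType} (M G : R -> R) :
  let mu := @lebesgue_measure R in
  (forall l, 0 < l ->
    [/\ mu.-integrable `]0, +oo[ (fun x => (expR (- (l * x)) * M x)%:E),
        mu.-integrable `]0, +oo[ (fun x => (expR (- (l * x)) * G x)%:E) &
        (\int[mu]_(x in `]0%R, +oo[) (expR (- (l * x)) * M x)%:E =
         \int[mu]_(x in `]0%R, +oo[) (expR (- (l * x)) * G x)%:E)%E]) ->
  (forall s t, 0 < s <= t -> M s <= M t) ->
  (forall t, 0 < t -> {for t, continuous G}) ->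
  forall t, 0 < t -> M t = G t.
Proof.
move=> mu eqL Mh Gc t t0.
have mD : measurable (`]0, +oo[%classic : set (measurableTypeR R)) by exact: measurable_itv.
have l1 l : 0 < l -> annihilates (fun x => M x - G x) (fun x => expR (- (l * x))).
  move=> /eqL[iM iG E]; split.
    have := integrableB mD iM iG; apply: eq_integrable => // x _.
    by rewrite mulrBr EFinB.
  under eq_integral do rewrite mulrBr EFinB.
  by rewrite integralB// E subee// integrable_fin_num.
have l2 l : 0 < l -> annihilates (fun x => G x - M x) (fun x => expR (- (l * x))).
  move=> /eqL[iM iG E]; split.
    have := integrableB mD iG iM; apply: eq_integrable => // x _.
    by rewrite mulrBr EFinB.
  under eq_integral do rewrite mulrBr EFinB.
  by rewrite integralB// E subee// integrable_fin_num.
apply/eqP; rewrite eq_le; apply/andP; split; rewrite leNgt; apply/negP => lt.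
  pose e := (M t - G t) / 2.
  have e0 : 0 < e by rewrite divr_gt0// subr_gt0.
  have /cvgrPdist_lt/(_ _ e0) := Gc t t0; move=> /nbhs_ballP[de /= de0 dG].
  apply: (@laplace0_not_pos _ _ l1 t (t + de / 2) e) => //; first by rewrite ltrDl divr_gt0.
  move=> x /andP[tx xd]; have : `|G t - G x| < e.
    by apply: dG; rewrite /ball/= distrC ger0_norm; lra.
  have := Mh t x; rewrite t0 tx => /(_ isT) Mx.
  rewrite ltr_norml => /andP[h1 h2]; rewrite /e in h1 h2 *; lra.
pose e := (G t - M t) / 2.
have e0 : 0 < e by rewrite divr_gt0// subr_gt0.
have /cvgrPdist_lt/(_ _ e0) := Gc t t0; move=> /nbhs_ballP[de /= de0 dG].
(* The interval [[s, t]] lies in the ball of radius [de] and, thanks to [t / 2], away from [0]. *)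
pose s := Num.max (t / 2) (t - de / 2).
have s0 : 0 < s by rewrite lt_max divr_gt0.
have st : s < t by rewrite gt_max; apply/andP; split; lra.
apply: (@laplace0_not_pos _ _ l2 s t e) => //.
move=> x /andP[sx xt]; have : `|G t - G x| < e.
  apply: dG; rewrite /ball/= ger0_norm; last lra.
  by have : t - de / 2 <= s; [rewrite le_max lexx orbT|lra].
have := Mh x t; rewrite xt (lt_le_trans s0 sx) => /(_ isT) Mx.
rewrite ltr_norml => /andP[h1 h2]; rewrite /e in h1 h2 *; lra.
Qed.

(** * Inverse stable subordinator *)

Lemma indic_bool {R : pzRingType} {U : Type} (b : U -> bool) (x : U) :
  \1_[set z | b z] x = (b x)%:R :> R.
Proof. by rewrite indicE; congr (nat_of_bool _)%:R; apply/idP/idP; rewrite inE. Qed.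

Section InverseSubordinator.
Context {d : measure_display} {T : measurableType d} {R : realType}.
Local Notation RT := (measurableTypeR R).
Local Notation mu := (@lebesgue_measure R).
Variables (P : probability T R) (alpha : R) (H : R -> {RV P >-> R}).
Hypothesis alpha01 : 0 < alpha < 1.
Hypothesis HH : stable_subordinator alpha H.
Local Notation L := (inverse_subordinator H).

Lemma inverse_subordinator_ge0 t w : 0 <= L t w.
Proof.
rewrite /inverse_subordinator.
have [->|/set0P S0] := eqVneq [set s | 0 <= s /\ t <= H s w] set0; first by rewrite inf0.
by apply: lb_le_inf => // s [].
Qed.

(** The second condition excludes paths that never reach [t], for which the infimum of the empty set
    is [0]. For the converse, right continuity keeps [H] below [t] slightly beyond [s]. *)
Lemma lt_inverse_subordinator s t w : 0 <= s ->
  s < L t w <-> H s w < t /\ exists n : nat, t <= H n%:R w.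
Proof.
move=> s0; set S := [set s | 0 <= s /\ t <= H s w].
have lbS : has_lbound S by exists 0 => x [].
split=> [sL|[Hst [n tn]]].
  split.
    rewrite ltNge; apply/negP => tH; move: sL; apply/negP; rewrite -leNgt.
    by apply: ge_inf.
  have [S0|/set0P[x [x0 tx]]] := eqVneq S set0.
    by move: sL; rewrite /inverse_subordinator -/S S0 inf0 ltNge s0.
  exists (Num.truncn x).+1; apply: (le_trans tx).
  by apply: (subord_nondecreasing HH); rewrite x0 ltW// truncnS_gt.
rewrite ltNge; apply/negP => Ls.
have := cvgr_lt _ (subord_right_continuous HH s0) _ Hst.
move=> /(_ _)/nbhs_ballP[e /= e0 he].
have hS : has_inf S by split=> //; exists n%:R; split.
have [x [x0 tx] xL] := inf_adherent e0 hS.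
have [xs|sx] := leP x s.
  have := subord_nondecreasing HH w (s := x) (t := s); rewrite x0 xs => /(_ isT) h.
  by have := le_lt_trans (le_trans tx h) Hst; rewrite ltxx.
have : H x w < t; last by rewrite ltNge tx.
apply: he => //; rewrite /ball/= ltr0_norm ?subr_lt0// opprB ltrBlDl (lt_le_trans xL)//.
by rewrite lerD2r.
Qed.

(** Joint measurability is what Tonelli needs. It holds because [t] enters [lt_inverse_subordinator]
    only as a threshold, next to countably many values of [H]. *)
Lemma measurable_inverse_subordinator2 :
  measurable_fun [set: RT * T] (fun z => L z.1 z.2 : RT).
Proof.
apply: (measurability _ (RGenOInfty.measurableE R)) => // _ [_ [s ->] <-].
rewrite setTI; have [s0|s0] := ltP s 0.
  rewrite (_ : _ @^-1` _ = setT)//; apply/seteqP; split=> // z _ /=.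
  by rewrite in_itv/= andbT (lt_le_trans s0)// inverse_subordinator_ge0.
have mHs r : measurable_fun [set: RT * T] (fun z => H r z.2 : RT).
  by apply: (@measurableT_comp _ _ _ _ _ _ (H r)).
rewrite (_ : _ @^-1` _ = [set z | H s z.2 < z.1] `&` \bigcup_n [set z | z.1 <= H n%:R z.2]); last first.
  apply/seteqP; split=> z /=; rewrite in_itv/= andbT.
    by move=> /(lt_inverse_subordinator _ _ s0)[h [n hn]]; split=> //; exists n.
  by move=> [h [n _ hn]]; apply/lt_inverse_subordinator => //; split=> //; exists n.
apply: measurableI.
  rewrite -[X in measurable X]setTI.
  exact: (@measurable_fun_ltr _ (RT * T)%type _ _ _ _ (mHs s) measurable_fst _ [set true]).
apply: bigcupT_measurable => n; rewrite -[X in measurable X]setTI.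
exact: (@measurable_fun_ler _ (RT * T)%type _ _ _ _ measurable_fst (mHs n%:R) _ [set true]).
Qed.

Lemma measurable_inverse_subordinator t : measurable_fun [set: T] (L t : T -> RT).
Proof. exact: measurableT_comp measurable_inverse_subordinator2 (measurable_pair1 t). Qed.

Lemma measurable_inverse_subordinator_gt s t : measurable [set w | (s < L t w)%R].
Proof.
rewrite -[X in measurable X]setTI.
apply: (@measurable_fun_ltr _ _ _ _ (cst s) (L t) _ _ _ [set true]) => //.
exact: measurable_inverse_subordinator.
Qed.

Lemma subordinator_laplace s l : 0 < l -> 0 <= s ->
  (\int[P]_w (expR (- (l * H s w)))%:E = (expR (- (s * l `^ alpha)))%:E)%E.
Proof.
move=> l0 s0; have := subord_laplace HH l0 s0; rewrite unlock mulNr => <-.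
by apply: eq_integral => w _; rewrite mulNr.
Qed.

Lemma measurable_subordinator_lt s t : measurable [set w | (H s w < t)%R].
Proof.
rewrite -[X in measurable X]setTI.
exact: (@measurable_fun_ltr _ _ _ _ (H s) (cst t) _ _ _ [set true]).
Qed.

(** Chernoff bound: the indicator of [H s < t] is at most [e^(t - H s)], and
    [E e^(-H s) = e^(-s)]. *)
Lemma subordinator_lt_le s t : 0 <= s -> (P [set w | (H s w < t)%R] <= (expR (t - s))%:E)%E.
Proof.
move=> s0; rewrite -[X in P X]setIT -integral_indic//; last exact: measurable_subordinator_lt.
have := subordinator_laplace (ltr01 : 0 < 1 :> R) s0; rewrite powR1 mulr1 => E.
rewrite expRD EFinM -E.
rewrite -ge0_integralZl//=.
- apply: ge0_le_integral => //.
  + apply/measurable_EFinP; apply: measurable_indic; exact: measurable_subordinator_lt.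
  + under eq_fun do rewrite -EFinM.
    apply/measurable_EFinP; apply: measurable_funM => //; apply: measurableT_comp => //.
    by apply: measurable_funN; apply: measurable_funM.
  + move=> w _; rewrite -EFinM lee_fin -expRD mul1r indicE.
    case: (boolP (_ \in _)) => [|_]; last exact: expR_ge0.
    by rewrite inE/= => h; rewrite -[leLHS]expR0 ler_expR subr_ge0 ltW.
- by apply/measurable_EFinP; apply: measurableT_comp => //; apply: measurable_funN; apply: measurable_funM.
Qed.

Lemma subordinator_unbounded t : P (\bigcap_n [set w | (H n%:R w < t)%R]) = 0.
Proof.
have le n : (P (\bigcap_n [set w | (H n%:R w < t)%R]) <= (expR (t - n%:R))%:E)%E.
  apply: le_trans (subordinator_lt_le t (ler0n R n)); apply: le_measure.
  - rewrite inE; apply: bigcap_measurable => // k _; exact: measurable_subordinator_lt.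
  - by rewrite inE; exact: measurable_subordinator_lt.
  - by move=> w; apply.
have h : (expR (t - n%:R))%:E @[n --> \oo] --> 0%:E.
  apply: cvg_EFin; first exact: nearW.
  have h : expR t * expR (- n%:R) @[n --> \oo] --> expR t * (0 : R).
    apply: cvgM; first exact: cvg_cst.
    by apply: cvg_comp (@cvgr_idn R) (@cvgr_expR R).
  by move: h; rewrite mulr0; under eq_fun do rewrite -expRD.
apply/eqP; rewrite eq_le measure_ge0 andbT.
apply: le_trans (_ : limn (fun n => (expR (t - n%:R))%:E) <= 0)%E; last by rewrite (cvg_lim _ h).
apply: lime_ge; first by apply/cvg_ex; exists 0%:E.
by apply: nearW => n; exact: le.
Qed.

Lemma inverse_subordinator_tail s t : 0 <= s ->
  P [set w | (s < L t w)%R] = P [set w | (H s w < t)%R].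
Proof.
move=> s0.
have mL := measurable_inverse_subordinator_gt s t.
have mN : measurable (\bigcap_n [set w | (H n%:R w < t)%R]).
  by apply: bigcap_measurable => // k _; exact: measurable_subordinator_lt.
apply/eqP; rewrite eq_le; apply/andP; split.
  apply: le_measure; rewrite ?inE//; first exact: measurable_subordinator_lt.
  by move=> w /= /(lt_inverse_subordinator _ _ s0)[].
rewrite -[leRHS]adde0 -(subordinator_unbounded t).
apply: le_trans (measureU2 P mL mN).
apply: le_measure; rewrite ?inE//; [exact: measurable_subordinator_lt|exact: measurableU|].
move=> w /= Hw; have [h|h] := pselect (exists n : nat, t <= H n%:R w).
  by left; apply/lt_inverse_subordinator.
by right=> n _ /=; rewrite ltNge; apply/negP => h'; apply: h; exists n.
Qed.

(** The derivative of [s^k] on [s > 0], so that [x^k] is its integral over [s < x]; setting it to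
    zero for [s <= 0] confines all identities to admissible times. *)
Definition power_density k (s : R) : R := if 0 < s then k%:R * s `^ (k%:R - 1) else 0.

Lemma power_density_ge0 k s : 0 <= power_density k s.
Proof. by rewrite /power_density; case: ifP => // _; rewrite mulr_ge0 ?powR_ge0. Qed.

Lemma measurable_power_density k : measurable_fun [set: RT] (power_density k : RT -> RT).
Proof.
apply: measurable_fun_ifT => //; first exact: measurable_fun_ltr.
by apply: measurable_funM => //; apply: measurable_powR.
Qed.

Lemma power_layer_cake k (x : R) : (0 < k)%N -> 0 <= x ->
  (\int[mu]_s (power_density k s * \1_[set s | (s < x)%R] s)%:E = (x ^+ k)%:E)%E.
Proof.
move=> k0 x0.
have kr : 0 < k%:R :> R by rewrite ltr0n.
have [->|xn0] := eqVneq x 0.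
  rewrite expr0n gtn_eqF// integral0_eq// => s _; rewrite /power_density indicE.
  case: ifP => [s0|_]; last by rewrite mul0r.
  by rewrite memNset ?mulr0//=; apply/negP; rewrite -leNgt ltW.
have {xn0} x0' : 0 < x by rewrite lt_neqAle eq_sym xn0.
have -> : (x ^+ k)%:E = (k%:R%:E * \int[mu]_(s in `]0%R, x]) (s `^ (k%:R - 1))%:E)%E.
  by rewrite integral_powR// -EFinM mulrA divff ?mul1r ?powR_mulrn// gt_eqF.
rewrite -ge0_integralZl//; first last.
- by move=> s _; rewrite lee_fin powR_ge0.
- apply: measurable_funTS; apply/measurable_EFinP; exact: measurable_powR.
rewrite -integral_itv_bndo_bndc; last first.
  by apply: measurable_funTS; apply: measurable_funeM; apply/measurable_EFinP; exact: measurable_powR.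
rewrite [RHS]integral_mkcond; apply: eq_integral => s _.
rewrite indic_bool patchE mem_setE in_itv/= /power_density.
by case: (0 < s); rewrite ?mul0r//=; case: (s < x); rewrite ?mulr1 ?mulr0// EFinM.
Qed.

Lemma laplace_power_density k l : (0 < k)%N -> 0 < l ->
  (\int[mu]_s (power_density k s * expR (- (s * l)))%:E = (k`!%:R * (l ^+ k)^-1)%:E)%E.
Proof.
move=> k0 l0; have kr : 0 < k%:R :> R by rewrite ltr0n.
have -> : k`!%:R * (l ^+ k)^-1 = k%:R * (Gamma k%:R * l `^ (- k%:R)).
  rewrite -{1}(prednK k0) factS natrM (prednK k0) -Gamma_nat (prednK k0).
  by rewrite powRN powR_mulrn ?(ltW l0)// mulrA.
rewrite EFinM -laplace_powR// -ge0_integralZl//; first last.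
- by move=> s _; rewrite lee_fin mulr_ge0 ?powR_ge0 ?expR_ge0.
- apply: measurable_funTS; apply/measurable_EFinP; apply: measurable_funM; last exact: measurable_powR.
  by apply: measurableT_comp => //; apply: measurable_funN; apply: measurable_funM.
rewrite [RHS]integral_mkcond; apply: eq_integral => s _.
rewrite patchE mem_setE in_itv/= andbT /power_density.
case: (0 < s); rewrite ?mul0r// -EFinM; congr EFin.
by rewrite (mulrC l) -!mulrA [X in _ * X = _]mulrC.
Qed.

Lemma inverse_subordinator_layer_cake k t : (0 < k)%N ->
  (\int[P]_w ((L t w) ^+ k)%:E =
   \int[mu]_s ((power_density k s)%:E * P [set w | (H s w < t)%R]))%E.
Proof.
move=> k0.
pose f (z : T * RT) : \bar R := (power_density k z.2 * \1_[set z : T * RT | (z.2 < L t z.1)%R] z)%:E.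
have mS : measurable [set z : T * RT | (z.2 < L t z.1)%R].
  rewrite -[X in measurable X]setTI.
  apply: (@measurable_fun_ltr _ (T * RT)%type _ _ snd (fun z => L t z.1) _ _ _ [set true]) => //.
  by apply: measurableT_comp (measurable_inverse_subordinator t) measurable_fst.
have mf : measurable_fun [set: T * RT] f.
  apply/measurable_EFinP; apply: measurable_funM; last exact: measurable_indic.
  exact: measurableT_comp (measurable_power_density k) measurable_snd.
have f0 z : (0 <= f z)%E by rewrite lee_fin mulr_ge0 ?power_density_ge0.
have := @fubini_tonelli _ _ _ _ _ P mu f mf f0; rewrite /f /= => E.
rewrite [LHS](_ : _ = \int[P]_w \int[mu]_s (power_density k s * \1_[set z : T * RT | (z.2 < L t z.1)%R] (w, s))%:E)%E; last first.
  apply: eq_integral => w _.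
  rewrite -(power_layer_cake k0 (inverse_subordinator_ge0 t w)).
  by apply: eq_integral => s _; rewrite !indicE !mem_setE.
rewrite E; apply: eq_integral => s _.
have [s0|s0] := leP s 0.
  by rewrite /power_density ltNge s0/= mul0e integral0_eq// => w _; rewrite mul0r.
rewrite -inverse_subordinator_tail ?ltW//.
rewrite -[X in P X]setIT -integral_indic//; last exact: measurable_inverse_subordinator_gt.
rewrite -ge0_integralZl//; last 2 first.
- by apply/measurable_EFinP; apply: measurable_indic; exact: measurable_inverse_subordinator_gt.
- by rewrite lee_fin power_density_ge0.
Qed.

(** By Tonelli the integral over [t] may be done first, for a fixed path: over [t > H s w] it equals
    [l^-1 e^(-l H s w)]. *)
Lemma laplace_subordinator_lt s l : 0 <= s -> 0 < l ->
  (\int[mu]_t ((expR (- (l * t)))%:E * P [set w | (H s w < t)%R]) =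
   (l^-1 * expR (- (s * l `^ alpha)))%:E)%E.
Proof.
move=> s0 l0.
pose A := [set z : RT * T | (H s z.2 < z.1)%R].
have mHs : measurable_fun [set: RT * T] (fun z => H s z.2 : RT).
  by apply: (@measurableT_comp _ _ _ _ _ _ (H s)).
have mA : measurable A.
  rewrite -[X in measurable X]setTI.
  exact: (@measurable_fun_ltr _ (RT * T)%type _ _ _ _ mHs measurable_fst _ [set true]).
have mexp : measurable_fun [set: RT] (fun t => expR (- (l * t)) : RT).
  by apply: measurableT_comp => //; apply: measurable_funN; exact: measurable_funM.
pose f (z : RT * T) : \bar R := (expR (- (l * z.1)) * \1_A z)%:E.
have mf : measurable_fun [set: RT * T] f.
  apply/measurable_EFinP; apply: measurable_funM; last exact: measurable_indic.
  exact: measurableT_comp mexp measurable_fst.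
have f0 z : (0 <= f z)%E by rewrite lee_fin mulr_ge0 ?expR_ge0.
have := @fubini_tonelli _ _ _ _ _ mu P f mf f0; rewrite /f /= => E.
transitivity (\int[mu]_t \int[P]_w (expR (- (l * t)) * \1_A (t, w))%:E)%E.
  apply: eq_integral => t _.
  rewrite -[X in P X]setIT -integral_indic//; last exact: measurable_subordinator_lt.
  rewrite -ge0_integralZl//; last first.
    apply/measurable_EFinP; apply: measurable_indic; exact: measurable_subordinator_lt.
rewrite E EFinM -(subordinator_laplace l0 s0) -ge0_integralZl//; first last.
- by rewrite lee_fin invr_ge0 ltW.
- apply/measurable_EFinP; apply: measurableT_comp => //; apply: measurable_funN.
  by apply: measurable_funM.
apply: eq_integral => w _; rewrite -EFinM -integral_expR_Iy//.
rewrite -integral_itv_obnd_cbnd; last by apply: measurable_funTS; exact/measurable_EFinP.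
rewrite [RHS]integral_mkcond; apply: eq_integral => t _.
rewrite patchE mem_setE in_itv/= andbT /A indic_bool.
by case: (H s w < t)%R; rewrite ?mulr1 ?mulr0.
Qed.

(** The tail is written with [L] rather than [H]: joint measurability of [H] in time and path is not
    among the established facts, while [s] is merely a threshold for [L]. *)
Lemma measurable_tail2 :
  measurable_fun [set: RT * RT] (fun z => P [set w | (z.2 < L z.1 w)%R]).
Proof.
have mB : measurable [set z : RT * RT * T | (z.1.2 < L z.1.1 z.2)%R].
  rewrite -[X in measurable X]setTI.
  apply: (@measurable_fun_ltr _ (RT * RT * T)%type _ _ (fun z => z.1.2) (fun z => L z.1.1 z.2) _ _ _ [set true]) => //.
    exact: measurableT_comp measurable_snd measurable_fst.
  apply: (@measurableT_comp _ _ _ _ _ _ (fun z : RT * T => L z.1 z.2) _ (fun z : RT * RT * T => (z.1.1, z.2))).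
    exact: measurable_inverse_subordinator2.
  apply: measurable_fun_pair => //.
  exact: measurableT_comp measurable_fst measurable_fst.
have := measurable_fun_xsection P mB; congr measurable_fun; apply/funext => z.
by congr (P _); apply/seteqP; split=> w; rewrite /xsection/= inE.
Qed.

(** Integrating over [t] first leaves [l^-1 e^(-s l^alpha)]; integrating this against the power
    density is a Laplace transform at [l^alpha]. *)
Lemma laplace_inverse_subordinator k l : (0 < k)%N -> 0 < l ->
  (\int[mu]_t ((expR (- (l * t)))%:E * \int[P]_w ((L t w) ^+ k)%:E) =
   (k`!%:R * (l^-1 * l `^ (- (alpha * k%:R))))%:E)%E.
Proof.
move=> k0 l0.
pose q (z : RT * RT) := P [set w | (z.2 < L z.1 w)%R].
pose f (z : RT * RT) : \bar R := ((expR (- (l * z.1)) * power_density k z.2)%:E * q z)%E.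
have mexp : measurable_fun [set: RT] (fun t => expR (- (l * t)) : RT).
  by apply: measurableT_comp => //; apply: measurable_funN; exact: measurable_funM.
have mf : measurable_fun [set: RT * RT] f.
  apply: emeasurable_funM; last exact: measurable_tail2.
  apply/measurable_EFinP; apply: measurable_funM.
    exact: measurableT_comp mexp measurable_fst.
  exact: measurableT_comp (measurable_power_density k) measurable_snd.
have f0 z : (0 <= f z)%E.
  by rewrite mule_ge0// lee_fin mulr_ge0 ?expR_ge0 ?power_density_ge0.
(* For [s <= 0] the two tails may differ, but there the density vanishes. *)
have qE t s : ((power_density k s)%:E * q (t, s) = (power_density k s)%:E * P [set w | (H s w < t)%R])%E.
  rewrite /q/=; have [s0|s0] := leP s 0; first by rewrite /power_density ltNge s0/= !mul0e.
  by rewrite inverse_subordinator_tail ?ltW.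
have := @fubini_tonelli _ _ _ _ _ mu mu f mf f0; rewrite /f /= => E.
transitivity (\int[mu]_t \int[mu]_s ((expR (- (l * t)) * power_density k s)%:E * q (t, s)))%E.
  apply: eq_integral => t _; rewrite (inverse_subordinator_layer_cake t k0).
  rewrite -ge0_integralZl.
  - by apply: eq_integral => s _; rewrite EFinM -muleA qE.
  - exact: measurableT.
  - under eq_fun do rewrite -(qE t).
    apply: emeasurable_funM; first by apply/measurable_EFinP; exact: measurable_power_density.
    exact: measurableT_comp measurable_tail2 (measurable_pair1 _).
  - by move=> s _; apply: mule_ge0; [rewrite lee_fin power_density_ge0|exact: measure_ge0].
  - by rewrite lee_fin expR_ge0.
rewrite E.
transitivity (\int[mu]_s ((power_density k s)%:E * (l^-1 * expR (- (s * l `^ alpha)))%:E))%E.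
  apply: eq_integral => s _; have [s0|s0] := leP s 0.
    have -> : power_density k s = 0 by rewrite /power_density ltNge s0.
    rewrite mul0e; apply: integral0_eq => t _.
    rewrite mulr0; exact: mul0e.
  rewrite -(laplace_subordinator_lt (ltW s0) l0) -ge0_integralZl.
  - by apply: eq_integral => t _; rewrite EFinM -muleA qE muleCA.
  - exact: measurableT.
  - apply: emeasurable_funM; first exact/measurable_EFinP.
    have := measurableT_comp measurable_tail2 (measurable_pair2 s).
    congr measurable_fun; apply/funext => t /=.
    by rewrite inverse_subordinator_tail ?ltW.
  - by move=> t _; apply: mule_ge0; [rewrite lee_fin expR_ge0|exact: measure_ge0].
  - by rewrite lee_fin power_density_ge0.
have la0 : 0 < l `^ alpha by rewrite powR_gt0.
rewrite mulrCA EFinM.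
have -> : l `^ (- (alpha * k%:R)) = ((l `^ alpha) ^+ k)^-1.
  rewrite powRN powRrM; congr (_^-1); apply: powR_mulrn; exact: powR_ge0.
move: (l `^ alpha) la0 {E qE f0 mf f q} => c c0.
rewrite -(laplace_power_density k0 c0) -ge0_integralZl.
- by apply: eq_integral => s _; rewrite -!EFinM mulrCA.
- exact: measurableT.
- apply/measurable_EFinP; apply: measurable_funM; first exact: measurable_power_density.
  by apply: measurableT_comp => //; apply: measurable_funN; exact: measurable_funM.
- by move=> s _; rewrite lee_fin mulr_ge0 ?power_density_ge0 ?expR_ge0.
- by rewrite lee_fin invr_ge0 ltW.
Qed.

End InverseSubordinator.

Section InverseSubordinatorMoments.
Context {d : measure_display} {T : measurableType d} {R : realType}.
Local Notation RT := (measurableTypeR R).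
Local Notation mu := (@lebesgue_measure R).
Variables (P : probability T R) (alpha : R) (H : R -> {RV P >-> R}).
Hypothesis alpha01 : 0 < alpha < 1.
Hypothesis HH : stable_subordinator alpha H.
Local Notation L := (inverse_subordinator H).

Lemma inverse_subordinator_le0 t w : t <= 0 -> L t w = 0.
Proof.
move=> t0; apply/eqP; rewrite eq_le inverse_subordinator_ge0 andbT leNgt.
by apply/negP => /(lt_inverse_subordinator HH _ _ (lexx 0))[]; rewrite (subord0 HH) ltNge t0.
Qed.

Let measurable_layer_cake k t :
  measurable_fun [set: RT] (fun s => ((power_density k s)%:E * P [set w | (H s w < t)%R])%E).
Proof.
have E s : ((power_density k s)%:E * P [set w | (H s w < t)%R] =
    (power_density k s)%:E * P [set w | (s < L t w)%R])%E.
  have [s0|s0] := leP s 0; first by rewrite /power_density ltNge s0/= !mul0e.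
  by rewrite (inverse_subordinator_tail HH)// ltW.
under eq_fun do rewrite E.
apply: emeasurable_funM; first by apply/measurable_EFinP; exact: measurable_power_density.
exact: measurableT_comp (measurable_tail2 HH) (measurable_pair1 t).
Qed.

(** The Chernoff bound under the layer-cake integral: crude, but it makes the moments finite, so
    that they are a real function of [t] to invert. *)
Let moment_le_expR k t : (0 < k)%N ->
  (\int[P]_w ((L t w) ^+ k)%:E <= (expR t * k`!%:R)%:E)%E.
Proof.
move=> k0; rewrite (inverse_subordinator_layer_cake HH t k0).
have := laplace_power_density k0 (ltr01 : 0 < 1 :> R).
rewrite expr1n invr1 mulr1 EFinM => <-.
rewrite -ge0_integralZl; last 4 first.
- exact: measurableT.
- apply/measurable_EFinP; apply: measurable_funM; first exact: measurable_power_density.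
  by apply: measurableT_comp => //; apply: measurable_funN; exact: measurable_funM.
- by move=> s _; rewrite lee_fin mulr_ge0 ?power_density_ge0 ?expR_ge0.
- by rewrite lee_fin expR_ge0.
apply: ge0_le_integral.
- exact: measurableT.
- by move=> s _; apply: mule_ge0; [rewrite lee_fin power_density_ge0|exact: measure_ge0].
- exact: measurable_layer_cake.
- under eq_fun do rewrite -EFinM.
  apply/measurable_EFinP; apply: measurable_funM => //; apply: measurable_funM.
    exact: measurable_power_density.
  by apply: measurableT_comp => //; apply: measurable_funN; exact: measurable_funM.
move=> s _; have [s0|s0] := leP s 0.
  by rewrite /power_density ltNge s0/= mul0e mul0r mule0.
have -> : ((expR t)%:E * (power_density k s * expR (- (s * 1)))%:E = (power_density k s)%:E * (expR (t - s))%:E)%E.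
  by rewrite -!EFinM mulr1 mulrCA expRD.
apply: lee_wpmul2l; first by rewrite lee_fin power_density_ge0.
exact: (subordinator_lt_le HH t (ltW s0)).
Qed.

Let moment_fin k t : (0 < k)%N -> (\int[P]_w ((L t w) ^+ k)%:E)%E \is a fin_num.
Proof.
move=> k0; rewrite ge0_fin_numE; first exact: le_lt_trans (moment_le_expR t k0) (ltry _).
by apply: integral_ge0 => w _; rewrite lee_fin exprn_ge0// inverse_subordinator_ge0.
Qed.

Let moment_homo k : (0 < k)%N ->
  {homo (fun t => fine (\int[P]_w ((L t w) ^+ k)%:E)%E) : s t / s <= t}.
Proof.
move=> k0 s t st; apply: fine_le; [exact: moment_fin|exact: moment_fin|].
rewrite !(inverse_subordinator_layer_cake HH _ k0).
apply: ge0_le_integral.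
- exact: measurableT.
- by move=> x _; apply: mule_ge0; [rewrite lee_fin power_density_ge0|exact: measure_ge0].
- exact: measurable_layer_cake.
- exact: measurable_layer_cake.
move=> x _; apply: lee_wpmul2l; first by rewrite lee_fin power_density_ge0.
apply: le_measure; rewrite ?inE; [exact: measurable_subordinator_lt|exact: measurable_subordinator_lt|].
by move=> w /= /lt_le_trans; apply.
Qed.

Let integrable_ge0 (D : set RT) (f : RT -> R) (c : R) : measurable D -> measurable_fun D f ->
  (forall x, D x -> 0 <= f x) -> (\int[mu]_(x in D) (f x)%:E = c%:E)%E ->
  mu.-integrable D (EFin \o f).
Proof.
move=> mD mf f0 fc; apply/integrableP; split; first exact/measurable_EFinP.
rewrite (_ : (\int[mu]_(x in D) `|(EFin \o f) x|)%E = c%:E) ?ltry// -fc.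
by apply: eq_integral => x; rewrite inE => /f0 fx; rewrite /= ger0_norm.
Qed.

(** The moments are monotone in [t] and the candidate is continuous, as [laplace_injective]
    requires. The case [k = 0] lies outside the layer-cake formula, and [t = 0] outside the
    inversion. *)
Lemma inverse_subordinator_moment k t : 0 <= t ->
  (\int[P]_w ((L t w) ^+ k)%:E = (k`!%:R * (mlcoef alpha k * (t `^ alpha) ^+ k))%:E)%E.
Proof.
case: k => [|k] t0.
  transitivity (\int[P]_w (cst 1%E w))%E; first by apply: eq_integral => w _; rewrite expr0.
  by rewrite integral_cst// mul1e expr0 mlcoef0 fact0 !mulr1 -[RHS](@probability_setT _ _ _ P).
have [->|tn0] := eqVneq t 0.
  rewrite powR0; last by case/andP: alpha01 => /gt_eqF ->.
  rewrite integral0_eq ?expr0n ?mulr0// => w _.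
  by rewrite inverse_subordinator_le0// expr0n.
have {tn0} t0' : 0 < t by rewrite lt_neqAle eq_sym tn0.
have mD : measurable (`]0, +oo[%classic : set RT) by exact: measurable_itv.
rewrite -(fineK (moment_fin t (ltn0Sn k))); congr EFin.
pose M t := fine (\int[P]_w ((L t w) ^+ k.+1)%:E)%E.
pose c : R := k.+1`!%:R * mlcoef alpha k.+1.
have c0 : 0 <= c by rewrite mulr_ge0// ltW// mlcoef_gt0.
apply: (@laplace_injective _ M (fun t => k.+1`!%:R * (mlcoef alpha k.+1 * (t `^ alpha) ^+ k.+1))) => //.
- move=> l l0.
  have mexp : measurable_fun [set: RT] (fun t => expR (- (l * t)) : RT).
    by apply: measurableT_comp => //; apply: measurable_funN; exact: measurable_funM.
  have EM : (\int[mu]_(x in `]0%R, +oo[) (expR (- (l * x)) * M x)%:E =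
      (k.+1`!%:R * (l^-1 * l `^ (- (alpha * k.+1%:R))))%:E)%E.
    rewrite -(laplace_inverse_subordinator HH (ltn0Sn k) l0) integral_mkcond.
    apply: eq_integral => x _; rewrite patchE mem_setE in_itv/= andbT.
    have [x0|x0] := ltP 0 x; first by rewrite EFinM /M fineK// moment_fin.
    rewrite integral0_eq ?mule0// => w _.
    by rewrite inverse_subordinator_le0// expr0n.
  have EG : (\int[mu]_(x in `]0%R, +oo[) (expR (- (l * x)) * (k.+1`!%:R * (mlcoef alpha k.+1 * (x `^ alpha) ^+ k.+1)))%:E =
      (k.+1`!%:R * (l^-1 * l `^ (- (alpha * k.+1%:R))))%:E)%E.
    have a1 : 0 < alpha * k.+1%:R + 1.
      by rewrite ltr_wpDl// mulr_ge0//; case/andP: alpha01 => /ltW.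
    transitivity (c%:E * \int[mu]_(x in `]0%R, +oo[) (expR (- (l * x)) * x `^ (alpha * k.+1%:R + 1 - 1))%:E)%E.
      rewrite -ge0_integralZl//; first last.
      - by move=> x _; rewrite lee_fin mulr_ge0 ?expR_ge0 ?powR_ge0.
      - apply: measurable_funTS; apply/measurable_EFinP; apply: measurable_funM; first exact: mexp.
        exact: measurable_powR.
      apply: eq_integral => x _; rewrite -EFinM addrK powRrM powR_mulrn ?powR_ge0// /c.
      congr EFin; move: (expR _) (mlcoef _ _) (_ ^+ _) => A B D; ring.
    rewrite laplace_powR// -EFinM; congr EFin.
    rewrite /c /mlcoef opprD powRD; last by rewrite (gt_eqF l0) implybT.
    rewrite powR_inv1 ?(ltW l0)//.
    have := Gamma_gt0 a1; move: (Gamma _) (_ `^ _) => g A g0.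
    by field; rewrite !gt_eqF.
  split; last by rewrite EM EG.
    apply: (integrable_ge0 mD _ _ EM) => [|x _]; last first.
      by rewrite mulr_ge0 ?expR_ge0// fine_ge0// integral_ge0// => w _; rewrite lee_fin exprn_ge0// inverse_subordinator_ge0.
    apply: measurable_funTS; apply: measurable_funM => //.
    apply: nondecreasing_measurable => // x y; exact: moment_homo.
  apply: (integrable_ge0 mD _ _ EG) => [|x _]; last first.
    by rewrite mulr_ge0 ?expR_ge0// mulrA mulr_ge0// exprn_ge0// powR_ge0.
  apply: measurable_funTS; apply: measurable_funM => //.
  apply: measurable_funM => //; apply: measurable_funM => //; apply: measurable_funX.
  exact: measurable_powR.
- by move=> x y /andP[_ xy]; exact: moment_homo.
- move=> x x0.
  apply: continuousM; first exact: cvg_cst.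
  apply: continuousM; first exact: cvg_cst.
  apply: (@continuous_comp _ _ _ (fun x => x `^ alpha) (fun y => y ^+ k.+1)).
    exact: continuous_powR.
  exact: exprn_continuous.
Qed.

(** The partial sums of the exponential series have as expectations the partial sums of the
    Mittag-Leffler series at [c t^alpha], which are bounded; monotone convergence concludes. *)
Lemma inverse_subordinator_expR c t : 0 <= c -> 0 <= t ->
  P.-integrable setT (fun w => (expR (c * L t w))%:E).
Proof.
move=> c0 t0.
pose g n w : \bar R := (\sum_(0 <= k < n) (c * L t w) ^+ k / k`!%:R)%:E.
have mL := measurable_inverse_subordinator HH t.
have mterm k : measurable_fun [set: T] (fun w => (c * L t w) ^+ k / k`!%:R : RT).
  apply: measurable_funM => //; apply: measurable_funX; exact: measurable_funM.
have cL0 w : 0 <= c * L t w by rewrite mulr_ge0// inverse_subordinator_ge0.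
have term0 k w : 0 <= (c * L t w) ^+ k / k`!%:R by rewrite divr_ge0// exprn_ge0.
have mg n : measurable_fun [set: T] (g n).
  by apply/measurable_EFinP; exact: measurable_sum.
have g0 n w : (0 <= g n w)%E by rewrite lee_fin sumr_ge0.
have g_cvg w : g ^~ w @ \oo --> (expR (c * L t w))%:E.
  apply: cvg_EFin; first exact: nearW.
  have := is_cvg_series_exp_coeff (c * L t w).
  by rewrite /series /exp_coeff /=.
have mexp : measurable_fun [set: T] (fun w => expR (c * L t w) : RT).
  by apply: measurableT_comp => //; exact: measurable_funM.
have cta : 0 <= c * t `^ alpha by rewrite mulr_ge0 ?powR_ge0.
have Ig n : (\int[P]_w g n w <= (psum (mlcoef alpha) (c * t `^ alpha))%:E)%E.
  have -> : (\int[P]_w g n w = (\sum_(0 <= k < n) mlcoef alpha k * (c * t `^ alpha) ^+ k)%:E)%E.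
    rewrite /g; under eq_integral do rewrite -sumEFin.
    rewrite ge0_integral_sum//; first last.
    - by move=> k w _; rewrite lee_fin.
    - by move=> k; apply/measurable_EFinP; exact: mterm.
    rewrite -sumEFin; apply: eq_bigr => k _.
    transitivity ((c ^+ k / k`!%:R)%:E * \int[P]_w ((L t w) ^+ k)%:E)%E.
      rewrite -ge0_integralZl//; first last.
      - by rewrite lee_fin divr_ge0// exprn_ge0.
      - by move=> w _; rewrite lee_fin exprn_ge0// inverse_subordinator_ge0.
      - by apply/measurable_EFinP; exact: measurable_funX.
      by apply: eq_integral => w _; rewrite -EFinM exprMn mulrAC.
    rewrite inverse_subordinator_moment// -EFinM; congr EFin.
    have kf : k`!%:R != 0 :> R by rewrite pnatr_eq0 -lt0n fact_gt0.
    rewrite exprMn; move: (k`!%:R) kf (c ^+ k) (mlcoef _ _) (_ ^+ k) => a a0 b m e.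
    by field.
  rewrite lee_fin; apply: nondecreasing_cvgn_le; last exact: entire_cvg (entire_mlcoef alpha01).
  by apply: nondecreasing_series => k _ _; rewrite mulr_ge0 ?exprn_ge0// ltW// mlcoef_gt0.
apply/integrableP; split; first exact/measurable_EFinP.
have E w : `|(expR (c * L t w))%:E|%E = limn (g ^~ w).
  by rewrite (cvg_lim _ (g_cvg w))//= ger0_norm ?expR_ge0.
under eq_integral do rewrite E.
rewrite monotone_convergence//; last first.
  move=> w _ m n mn; rewrite lee_fin; apply: nondecreasing_series mn => k _ _; exact: term0.
apply: le_lt_trans (ltry (psum (mlcoef alpha) (c * t `^ alpha))).
apply: lime_le; last exact: nearW.
apply: ereal_nondecreasing_is_cvgn => m n mn; apply: ge0_le_integral => //.
by move=> w _; rewrite lee_fin; apply: nondecreasing_series mn => k _ _; exact: term0.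
Qed.

End InverseSubordinatorMoments.

(** * The walk at a random time *)

Section ComplexExpectation.
Context {d : measure_display} {T : measurableType d} {R : realType}.
Variable P : probability T R.
Implicit Types (Z W : T -> R[i]) (Y : T -> R).

Lemma cexpectationE Z : cexpectation P Z =
  (\int[P]_w complex.Re (Z w))%R +i* (\int[P]_w complex.Im (Z w))%R.
Proof. by rewrite /cexpectation unlock. Qed.

Lemma cintegrable_le Z Y : cmeasurable Z -> P.-integrable setT (EFin \o Y) ->
  (forall w, cnorm (Z w) <= Y w) -> cintegrable P Z.
Proof.
move=> [m1 m2] iY ZY; split.
  apply: le_integrable iY => //; first exact/measurable_EFinP.
  move=> w _; rewrite !abse_EFin lee_fin (le_trans (le_Re_cnorm _))// (le_trans (ZY w))//.
  exact: ler_norm.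
apply: le_integrable iY => //; first exact/measurable_EFinP.
move=> w _; rewrite !abse_EFin lee_fin (le_trans (le_Im_cnorm _))// (le_trans (ZY w))//.
exact: ler_norm.
Qed.

Lemma cintegrableD Z W : cintegrable P Z -> cintegrable P W ->
  cintegrable P (fun w => Z w + W w).
Proof.
move=> [z1 z2] [w1 w2]; split.
  have := integrableD measurableT z1 w1; apply: eq_integrable => // w _.
  by rewrite /= ReD.
have := integrableD measurableT z2 w2; apply: eq_integrable => // w _.
by rewrite /= ImD.
Qed.

Lemma cexpectationD Z W : cintegrable P Z -> cintegrable P W ->
  cexpectation P (fun w => Z w + W w) = cexpectation P Z + cexpectation P W.
Proof.
move=> [z1 z2] [w1 w2]; rewrite !cexpectationE; apply: complexP; rewrite ?ReD ?ImD /=.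
  rewrite -RintegralD//; apply: eq_Rintegral => w _; exact: ReD.
rewrite -RintegralD//; apply: eq_Rintegral => w _; exact: ImD.
Qed.

Lemma cexpectation_sum I (s : seq I) (Z : I -> T -> R[i]) :
  (forall i, cintegrable P (Z i)) ->
  cintegrable P (fun w => \sum_(i <- s) Z i w) /\
  cexpectation P (fun w => \sum_(i <- s) Z i w) = \sum_(i <- s) cexpectation P (Z i).
Proof.
move=> iZ; elim: s => [|i s [ih1 ih2]].
  under [X in cintegrable P X]eq_fun do rewrite big_nil.
  under [X in cexpectation P X]eq_fun do rewrite big_nil.
  split; first by split; exact: integrable0.
  by rewrite big_nil cexpectationE /=; congr (_ +i* _); rewrite /Rintegral integral0.
under [X in cintegrable P X]eq_fun do rewrite big_cons.
under [X in cexpectation P X]eq_fun do rewrite big_cons.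
by rewrite big_cons -ih2; split; [exact: cintegrableD|exact: cexpectationD].
Qed.

Lemma cexpectation_scale Y (c : R[i]) : P.-integrable setT (EFin \o Y) ->
  cintegrable P (fun w => (Y w)%:C * c) /\
  cexpectation P (fun w => (Y w)%:C * c) = (\int[P]_w Y w)%R%:C * c.
Proof.
move=> iY.
have E (a : R) : P.-integrable setT (EFin \o (fun w => Y w * a)) /\
    (\int[P]_w (Y w * a))%R = (\int[P]_w Y w)%R * a.
  split; first by have := integrableZr measurableT a iY; apply: eq_integrable.
  by rewrite RintegralZr.
split.
  split; [have := (E (complex.Re c)).1|have := (E (complex.Im c)).1].
    by apply: eq_integrable => // w _; rewrite /= ReZ.
  by apply: eq_integrable => // w _; rewrite /= ImZ.
rewrite cexpectationE; apply: complexP; rewrite ?ReZ ?ImZ /= -(E _).2.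
  by apply: eq_Rintegral => w _; exact: ReZ.
by apply: eq_Rintegral => w _; exact: ImZ.
Qed.

Lemma cexpectation_indic A (c : R[i]) : measurable A ->
  cintegrable P (fun w => (\1_A w)%:C * c) /\
  cexpectation P (fun w => (\1_A w)%:C * c) = (fine (P A))%:C * c.
Proof.
move=> mA; have iA : P.-integrable setT (EFin \o (\1_A : T -> R)).
  exact: integrable_indic.
have [iAc ->] := cexpectation_scale c iA; split => //.
by rewrite /Rintegral integral_indic// setIT.
Qed.

Lemma cexpectation_ae A Z W : measurable A -> P A = 0 -> cmeasurable Z -> cmeasurable W ->
  (forall w, ~ A w -> Z w = W w) ->
  (cintegrable P W -> cintegrable P Z) /\ cexpectation P Z = cexpectation P W.
Proof.
move=> mA A0 [z1 z2] [w1 w2] ZW.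
have aeE (X Y : T -> R) : measurable_fun setT X -> measurable_fun setT Y ->
    (forall w, ~ A w -> X w = Y w) -> (P.-integrable setT (EFin \o Y) -> P.-integrable setT (EFin \o X)) /\
    (\int[P]_w X w)%R = (\int[P]_w Y w)%R.
  move=> mX mY XY.
  have ae : ae_eq P setT (EFin \o X) (EFin \o Y).
    exists A; split=> // w /= h; apply: contrapT => nA; apply: h => _.
    by rewrite XY.
  split; last by congr fine; apply: ae_eq_integral => //; exact/measurable_EFinP.
  move=> iY; apply/integrableP; split; first exact/measurable_EFinP.
  rewrite (_ : (\int[P]_w `|(EFin \o X) w|)%E = (\int[P]_w `|(EFin \o Y) w|)%E).
    by case/integrableP: iY.
  apply: ae_eq_integral => //.
  - by apply: measurableT_comp => //; exact/measurable_EFinP.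
  - by apply: measurableT_comp => //; exact/measurable_EFinP.
  - exact: ae_eq_abse.
have h1 w : ~ A w -> complex.Re (Z w) = complex.Re (W w) by move=> /ZW ->.
have h2 w : ~ A w -> complex.Im (Z w) = complex.Im (W w) by move=> /ZW ->.
split; first by move=> [i1 i2]; split; [exact: (aeE _ _ z1 w1 h1).1|exact: (aeE _ _ z2 w2 h2).1].
by rewrite !cexpectationE (aeE _ _ z1 w1 h1).2 (aeE _ _ z2 w2 h2).2.
Qed.

Lemma cexpectation_cvg (Z_ : nat -> T -> R[i]) Z Y : (forall n, cmeasurable (Z_ n)) ->
  (forall w, ccvg (Z_ ^~ w) (Z w)) -> P.-integrable setT (EFin \o Y) ->
  (forall n w, cnorm (Z_ n w) <= Y w) ->
  cintegrable P Z /\ ccvg (fun n => cexpectation P (Z_ n)) (cexpectation P Z).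
Proof.
move=> mZ cZ iY ZY.
have E (X_ : nat -> T -> R) (X : T -> R) : (forall n, measurable_fun setT (X_ n)) ->
    (forall w, X_ ^~ w @ \oo --> X w) -> (forall n w, `|X_ n w| <= Y w) ->
    P.-integrable setT (EFin \o X) /\ (fun n => (\int[P]_w X_ n w)%R) @ \oo --> (\int[P]_w X w)%R.
  move=> mX cX XY.
  have [|||iX cI] := @dominated_convergenceW _ _ _ P setT (fun n => EFin \o X_ n) (EFin \o X) (EFin \o Y) measurableT _ _ iY.
  - by move=> n; exact/measurable_EFinP.
  - by move=> w _; apply: cvg_EFin; [exact: nearW|exact: cX].
  - by move=> w n _; rewrite /= lee_fin.
  split=> //; rewrite /Rintegral.
  have /fineK <- : (\int[P]_w (X w)%:E)%E \is a fin_num by exact: integrable_fin_num.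
  by apply: fine_cvg; rewrite fineK//; exact: integrable_fin_num.
have [|||i1 c1] := E (fun n w => complex.Re (Z_ n w)) (fun w => complex.Re (Z w)).
- by move=> n; exact: (mZ n).1.
- by move=> w; exact: (cZ w).1.
- by move=> n w; exact: le_trans (le_Re_cnorm _) (ZY n w).
have [|||i2 c2] := E (fun n w => complex.Im (Z_ n w)) (fun w => complex.Im (Z w)).
- by move=> n; exact: (mZ n).2.
- by move=> w; exact: (cZ w).2.
- by move=> n w; exact: le_trans (le_Im_cnorm _) (ZY n w).
split=> //; rewrite cexpectationE.
rewrite (funext (fun n => cexpectationE (Z_ n))).
by split.
Qed.

End ComplexExpectation.

Lemma cmeasurable_random_index {d} {T : measurableType d} {R : realType} (M : T -> nat)
    (G : nat -> T -> R[i]) : (forall m, measurable [set w | M w = m]) ->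
  (forall m, cmeasurable (G m)) -> cmeasurable (fun w => G (M w) w).
Proof.
move=> mM mG.
apply: (@cmeasurable_cvg _ _ _ (fun J w => \sum_(m < J) (\1_[set w | M w = m] w)%:C * G m w)).
  move=> J; apply: cmeasurable_sum => m; apply: cmeasurableM => //.
  by apply: cmeasurableR; exact: measurable_indic.
move=> w.
have near : \forall J \near \oo, \sum_(m < J) (\1_[set w | M w = m] w)%:C * G m w = G (M w) w.
  exists (M w).+1 => // k /= Mk; rewrite (bigD1 (Ordinal Mk))//= indicE mem_set// mul1r.
  rewrite big1 ?addr0// => m /eqP mM'; rewrite indicE memNset ?mul0r//= => Mm.
  by apply: mM'; exact: val_inj.
by split; apply: cvg_near_cst; apply: filterS near => k ->.
Qed.

(** * Mean of the Fourier transform along the walk, at fixed and at random times *)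

Section Walk.
Context {d : measure_display} {T : measurableType d} {R : realType}.
Variables (P : probability T R) (N : nat) (b : R[i]) (xi : nat -> T -> R[i]).
Hypothesis N0 : (0 < N)%N.
Hypothesis Hxi : iid_uniform_on_roots P N b xi.
Variables (mu : complex_measure R) (r : R).
Hypothesis supp_mu : forall A : set (measurableTypeR R), measurable A ->
  A `&` `[- r, r]%classic = set0 -> cm_re mu A = 0%E /\ cm_im mu A = 0%E.
Variable h : R.

Lemma cmeasurable_step j : cmeasurable (xi j).
Proof.
by have [m _ _] := Hxi; split; [exact: measurableT_comp measurable_fst (m j)|exact: measurableT_comp measurable_snd (m j)].
Qed.

(** Duplicates are removed because the events that a step equals a given root must be disjoint, and
    the roots coincide when [b = 0]. *)
Definition roots_seq : seq R[i] := undup [seq b * unity_root N k | k <- iota 0 N].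

Lemma roots_seqP k : (k < N)%N -> b * unity_root N k \in roots_seq.
Proof. by move=> kN; rewrite mem_undup; apply: map_f; rewrite mem_iota. Qed.

Lemma cnorm_roots_seq v : v \in roots_seq -> cnorm v <= cnorm b * 2.
Proof.
rewrite mem_undup => /mapP[k _ ->]; rewrite (le_trans (cnormM _ _))//.
by rewrite ler_wpM2l ?cnorm_ge0 ?cnorm_unity_root.
Qed.

Definition step_event j v : set T := [set w | xi j w = v].

Lemma step_event_sigma j v : sigma_of [set j] (fun i => cpair \o xi i) (step_event j v).
Proof.
apply: sub_sigma_algebra; exists j => //.
exists ([set complex.Re v] `*` [set complex.Im v]); first exact: measurableX.
rewrite setTI; apply/seteqP; split=> w /=; last by move=> ->.
by move=> [h1 h2]; exact: complexP.
Qed.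

Lemma measurable_step_event j v : measurable (step_event j v).
Proof.
have [m _ _] := Hxi.
rewrite (_ : step_event j v = (cpair \o xi j) @^-1` ([set complex.Re v] `*` [set complex.Im v])).
  by rewrite -[X in measurable X]setTI; apply: (m j) => //; exact: measurableX.
apply/seteqP; split=> w /=; first by move=> ->.
by move=> [h1 h2]; exact: complexP.
Qed.

(** An event of probability one on which the walk is bounded by its number of steps. *)
Definition regular : set T := [set w | forall j, xi j w \in roots_seq].

Let mem_event j : set T := \big[setU/set0]_(v <- roots_seq) step_event j v.

Let mem_eventE j : mem_event j = [set w | xi j w \in roots_seq].
Proof.
rewrite /mem_event -bigcup_seq; apply/seteqP; split=> w /=.
  by move=> [v /= vr ->].
by move=> hw; exists (xi j w).
Qed.

Let measurable_mem_event j : measurable (mem_event j).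
Proof. by apply: bigsetU_measurable => v _; exact: measurable_step_event. Qed.

Lemma prob_uniform j A (g : R[i] -> bool) : measurable A -> A = [set w | g (xi j w)] ->
  (fine (P A))%:C = N%:R^-1 * \sum_(k < N) (g (b * unity_root N k))%:R :> R[i].
Proof.
move=> mA AE; have [_ u _] := Hxi; rewrite -(u j (fun z => (g z)%:R)).
have [_] := cexpectation_indic P (1 : R[i]) mA; rewrite mulr1 => <-.
congr (cexpectation P _); apply/funext => w; rewrite mulr1 AE indic_bool /=.
by case: (g _).
Qed.

Lemma prob_step j v : (fine (P (step_event j v)))%:C =
  N%:R^-1 * \sum_(k < N) (b * unity_root N k == v)%:R :> R[i].
Proof.
apply: (@prob_uniform j _ (eq_op^~ v)); first exact: measurable_step_event.
by apply/seteqP; split=> w /=; [move=> ->|move/eqP].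
Qed.

(** Coinciding roots enter [prob_step] with their multiplicity, so the sum over distinct values is
    again the mean over all [k]. *)
Lemma sum_prob_step j (G : R[i] -> R[i]) :
  \sum_(v <- roots_seq) (fine (P (step_event j v)))%:C * G v =
  N%:R^-1 * \sum_(k < N) G (b * unity_root N k).
Proof.
under eq_bigr do rewrite prob_step -mulrA.
rewrite -mulr_sumr; congr (_ * _).
under eq_bigr do rewrite mulr_suml.
rewrite exchange_big /=; apply: eq_bigr => k _.
rewrite (bigD1_seq (b * unity_root N k))/= ?undup_uniq ?roots_seqP//.
rewrite eqxx mul1r big1 ?addr0// => v vk.
by rewrite eq_sym (negbTE vk) mul0r.
Qed.

Lemma prob_mem j : P (mem_event j) = 1%E.
Proof.
have := @prob_uniform j _ (fun z => z \in roots_seq) (measurable_mem_event j) (mem_eventE j).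
rewrite (eq_bigr (fun=> 1)) => [|k _]; last by rewrite roots_seqP.
rewrite sumr_const card_ord mulVf ?pnatr_eq0 -?lt0n// => /(congr1 (@complex.Re R)) /= E.
by rewrite -(fineK (fin_num_measure P _ (measurable_mem_event j))) E.
Qed.

Lemma measurable_regular : measurable regular.
Proof.
rewrite (_ : regular = \bigcap_j mem_event j).
  by apply: bigcapT_measurable => j; exact: measurable_mem_event.
apply/seteqP; split=> w.
  by move=> hw j _; rewrite mem_eventE; exact: hw.
by move=> hw j; have := hw j I; rewrite mem_eventE.
Qed.

Lemma prob_irregular : P (~` regular) = 0.
Proof.
apply: measure_negligible; first exact: measurableC measurable_regular.
rewrite (_ : ~` regular = \bigcup_j ~` mem_event j).
  apply: negligible_bigcup => j; apply/negligibleP; first exact: measurableC.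
  transitivity (1 - P (mem_event j))%E; first exact: probability_setC.
  by rewrite prob_mem subee.
apply/seteqP; split=> w; last by move=> [j _ hw] /(_ j); move: hw; rewrite mem_eventE.
move=> hw; apply: contrapT => nh; apply: hw => j; apply: contrapT => nj; apply: nh.
by exists j => //; rewrite mem_eventE.
Qed.

Definition partial_sum m w : R[i] := \sum_(j < m) xi j w.

Lemma cmeasurable_partial_sum m : cmeasurable (partial_sum m).
Proof. by apply: cmeasurable_sum => j; exact: cmeasurable_step. Qed.

Lemma cnorm_partial_sum m w : regular w -> cnorm (partial_sum m w) <= m%:R * (cnorm b * 2).
Proof.
move=> hw; rewrite (le_trans (cnorm_sum _ _ _))//.
rewrite mulr_natl -[X in _ *+ X]card_ord -sumr_const; apply: ler_sum => j _.
exact: cnorm_roots_seq.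
Qed.

(* Conditioning on the value of step [m] preserves independence of the first [m] steps,
   which drives the induction in [cexpectation_walk]. *)
Definition indep_steps (A : set T) m := [/\ measurable A, A `<=` regular &
  forall B : nat -> set T, (forall j, (j < m)%N -> sigma_of [set j] (fun i => cpair \o xi i) (B j)) ->
  fine (P (A `&` \bigcap_(j in `I_m) B j)) = fine (P A) * \prod_(j < m) fine (P (B j))].

Lemma indep_steps_cond A m v : indep_steps A m.+1 ->
  indep_steps (A `&` step_event m v) m /\
  fine (P (A `&` step_event m v)) = fine (P A) * fine (P (step_event m v)).
Proof.
move=> [mA Areg iA].
have E : fine (P (A `&` step_event m v)) = fine (P A) * fine (P (step_event m v)).
  (* The whole space at the earlier indices isolates step [m]. *)
  have := iA (fun j => if j == m then step_event m v else setT).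
  rewrite big_ord_recr /= eqxx big1 => [|j _]; last by rewrite ltn_eqF ?ltn_ord// probability_setT.
  rewrite mul1r => <-; last first.
    move=> j _; case: eqP => [->|_]; first exact: step_event_sigma.
    by have [h0 hC _] := smallest_sigma_algebra [set: T] (\bigcup_(i in [set j]) preimage_set_system setT (cpair \o xi i) measurable);
       have := hC _ h0; rewrite setD0.
  congr (fine (P (_ `&` _))); apply/seteqP; split=> w.
    by move=> hw j _ /=; case: eqP.
  by move=> /(_ m (ltnSn m)) /=; rewrite eqxx.
split=> //; split.
- by apply: measurableI => //; exact: measurable_step_event.
- by move=> w [/Areg].
- move=> B hB; rewrite E.
  have := iA (fun j => if j == m then step_event m v else B j).
  rewrite big_ord_recr /= eqxx (eq_bigr (fun j : 'I_m => fine (P (B j)))) => [|j _]; last by rewrite ltn_eqF ?ltn_ord.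
  rewrite -mulrA [X in _ = _ * X]mulrC => <-; last first.
    move=> j; rewrite ltnS leq_eqVlt; case: eqP => [-> _|_ /= jm]; first exact: step_event_sigma.
    exact: hB.
  congr (fine (P _)); rewrite -setIA; congr (_ `&` _); apply/seteqP; split=> w.
    move=> [h1 h2] j /=; rewrite ltnS leq_eqVlt; case: eqP => [->|_ /= jm]//.
    exact: h2.
  move=> hw; split; first by have := hw m (ltnSn m); rewrite eqxx.
  by move=> j /= jm; have := hw j (ltnW jm); rewrite ltn_eqF.
Qed.

(** The candidate for the mean of [fourier mu (y + h S_m)]: under the integral, each independent
    step contributes one factor [root_mean]. *)
Definition walk_mean m (y : R[i]) : R[i] :=
  complex_int mu (fun l => cexp (iota_ l * y) * root_mean N b (h%:C * iota_ l) ^+ m).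

Lemma admissible_root_mean : admissible r (fun l => root_mean N b (h%:C * iota_ l)).
Proof.
apply: admissibleM; first exact: admissible_cst.
apply: admissible_sum => k; apply: admissible_cexp; apply: admissibleM; last exact: admissible_cst.
by apply: admissibleM; [exact: admissible_cst|exact: admissible_iota].
Qed.

Lemma admissible_walk_mean m y :
  admissible r (fun l => cexp (iota_ l * y) * root_mean N b (h%:C * iota_ l) ^+ m).
Proof.
apply: admissibleM; first exact: admissible_cexp_iota.
by apply: admissibleX; exact: admissible_root_mean.
Qed.

(** Shifting [y] by [h v] multiplies the integrand by [e^(-i l h v)], and averaging over the roots
    [v] produces one more factor [root_mean]. *)
Lemma walk_meanS m y :
  N%:R^-1 * \sum_(k < N) walk_mean m (y + h%:C * (b * unity_root N k)) = walk_mean m.+1 y.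
Proof.
rewrite /walk_mean -(complex_int_sum supp_mu); last by move=> k; exact: admissible_walk_mean.
rewrite -(complex_intZ supp_mu); last by apply: admissible_sum => k; exact: admissible_walk_mean.
congr complex_int; apply/funext => l.
rewrite exprS mulrA [X in _ = _ * X * _]/root_mean.
rewrite [X in _ = X * _]mulrCA -mulrA; congr (_ * _).
rewrite mulr_sumr mulr_suml; apply: eq_bigr => k _; congr (_ * _).
by rewrite -cexpD; congr cexp; rewrite mulrDr; congr (_ + _); rewrite mulrA [iota_ l * _]mulrC.
Qed.

Lemma cmeasurable_fourier_walk m y :
  cmeasurable (fun w => fourier mu (y + h%:C * partial_sum m w)).
Proof.
rewrite [X in cmeasurable X](_ : _ = fun w => fourier mu (0%:C + (y + h%:C * partial_sum m w))).
  apply: (cmeasurable_fourier supp_mu); apply: cmeasurableD; first exact: cmeasurable_cst.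
  by apply: cmeasurableM; [exact: cmeasurable_cst|exact: cmeasurable_partial_sum].
apply/funext => w; congr fourier; exact/esym/add0r.
Qed.

Let V := complex_mass mu * 2.
Let V0 : 0 <= V. Proof. by rewrite mulr_ge0// complex_mass_ge0. Qed.

Definition walk_bound y (m : nat) : R :=
  V * expR (`|r| * (cnorm y + `|h| * (m%:R * (cnorm b * 2)))).

Lemma fourier_walk_le m y w : regular w ->
  cnorm (fourier mu (y + h%:C * partial_sum m w)) <= walk_bound y m.
Proof.
move=> hw; rewrite (le_trans (fourier_le supp_mu _))// ler_wpM2l// ler_expR.
rewrite (le_trans (ler_wpM2r (cnorm_ge0 _) (ler_norm r)))// ler_wpM2l//.
rewrite (le_trans (cnormD _ _))// lerD2l cnormZ ler_wpM2l//.
exact: cnorm_partial_sum.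
Qed.

Lemma walk_mean_le m y : cnorm (walk_mean m y) <= walk_bound y m.
Proof.
apply: (@le_trans _ _ (complex_mass mu * expR (`|r| * (cnorm y + `|h| * (m%:R * (cnorm b * 2)))))); last first.
  rewrite /walk_bound /V -mulrA ler_wpM2l ?complex_mass_ge0//.
  by rewrite -[leLHS]mul1r ler_wpM2r ?expR_ge0// ler1n.
apply: (complex_int_le supp_mu); first exact: admissible_walk_mean.
move=> l lr; have lr' : cnorm (iota_ l) <= `|r|.
  by rewrite cnorm_iota (le_trans lr)// ler_norm.
rewrite mulrDr expRD (le_trans (cnormM _ _))// ler_pM ?cnorm_ge0//.
  rewrite (le_trans (cnorm_cexp _))// ler_expR (le_trans (cnormM _ _))//.
  by rewrite ler_wpM2r ?cnorm_ge0.
rewrite (le_trans (cnormX _ _))//.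
rewrite [X in expR X](_ : _ = m%:R * (`|r| * `|h| * (cnorm b * 2))); last by ring.
rewrite expRM_natl lerXn2r ?nnegrE ?cnorm_ge0 ?expR_ge0//.
rewrite /root_mean -(rmorph_nat (real_complex R)) -fmorphV cnormZ ger0_norm ?invr_ge0 ?ler0n//.
rewrite mulrC ler_pdivrMr ?ltr0n// (le_trans (cnorm_sum _ _ _))//.
rewrite [leRHS]mulr_natr -[X in _ <= _ *+ X](card_ord N) -sumr_const.
apply: ler_sum => k _; rewrite (le_trans (cnorm_cexp _))// ler_expR (le_trans (cnormM _ _))//.
rewrite ler_pM ?cnorm_ge0//; first by rewrite cnormZ mulrC ler_wpM2r.
by rewrite (le_trans (cnormM _ _))// ler_wpM2l ?cnorm_ge0// cnorm_unity_root.
Qed.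

Lemma cintegrable_walk A m y : measurable A -> A `<=` regular ->
  cintegrable P (fun w => (\1_A w)%:C * fourier mu (y + h%:C * partial_sum m w)).
Proof.
move=> mA Areg; apply: (@cintegrable_le _ _ _ _ _ (cst (walk_bound y m))).
- apply: cmeasurableM; first by apply: cmeasurableR; exact: measurable_indic.
  exact: cmeasurable_fourier_walk.
- exact: finite_measure_integrable_cst.
- move=> w; rewrite cnormZ indicE; case: (boolP (w \in A)) => [|_]; last first.
    by rewrite normr0 mul0r mulr_ge0// expR_ge0.
  by rewrite inE => /Areg hw; rewrite normr1 mul1r fourier_walk_le.
Qed.

(** Splitting by the value [v] of the last step turns it into a deterministic shift of [y] and
    shrinks the event [A]. Both vary in the induction, so finite sums take the place of product
    measures. *)
Lemma cexpectation_walk m A y : indep_steps A m ->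
  cexpectation P (fun w => (\1_A w)%:C * fourier mu (y + h%:C * partial_sum m w)) =
  (fine (P A))%:C * walk_mean m y.
Proof.
elim: m A y => [|m ih] A y; first move=> [mA _ _].
  rewrite -(cexpectation_indic P (walk_mean 0 y) mA).2; congr cexpectation; apply/funext => w.
  congr (_ * _); rewrite /partial_sum big_ord0 mulr0 addr0.
  by congr complex_int; apply/funext => l; rewrite expr0 mulr1.
move=> iA; have [mA Areg _] := iA.
rewrite [X in cexpectation P X](_ : _ = fun w => \sum_(v <- roots_seq)
    (\1_(A `&` step_event m v) w)%:C * fourier mu ((y + h%:C * v) + h%:C * partial_sum m w)); last first.
  apply/funext => w; rewrite indicE; case: (boolP (w \in A)) => [|wA]; last first.
    rewrite mul0r big1// => v _; rewrite indicE memNset ?mul0r//.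
    by move=> [/mem_set]; rewrite (negbTE wA).
  rewrite inE => wA; rewrite mul1r (bigD1_seq (xi m w))/= ?undup_uniq//; last exact: Areg.
  rewrite indicE mem_set//= mul1r big1 ?addr0 => [|v vx].
    congr fourier; rewrite -addrA -mulrDr; congr (_ + _ * _).
    by rewrite /partial_sum big_ord_recr/= addrC.
  rewrite indicE memNset ?mul0r//= => -[_ /esym]; exact/eqP.
rewrite (cexpectation_sum _ _).2; last first.
  move=> v; apply: cintegrable_walk; last by move=> w [/Areg].
  by apply: measurableI => //; exact: measurable_step_event.
rewrite -walk_meanS -(sum_prob_step m (fun z => walk_mean m (y + h%:C * z))) mulr_sumr; apply: eq_bigr => v _.
have [iAv E] := indep_steps_cond v iA; rewrite ih// E.
by rewrite mulrA -rmorphM.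
Qed.

Section RandomTime.
Variable M : T -> nat.
Hypothesis measurable_time : forall m, measurable [set w | M w = m].
Hypothesis indep_time : forall m B, sigma_of [set: nat] (fun j => cpair \o xi j) B ->
  P ([set w | M w = m] `&` B) = (P [set w | M w = m] * P B)%E.
Variables (y : R[i]) (Y : T -> R).
Hypothesis integrable_Y : P.-integrable setT (EFin \o Y).
Hypothesis bound_Y : forall w, walk_bound y (M w) <= Y w.

Let E m := [set w | M w = m] `&` regular.

Let mE m : measurable (E m).
Proof. by apply: measurableI => //; exact: measurable_regular. Qed.

Let PE A : measurable A -> P (A `&` regular) = P A.
Proof.
move=> mA; have mR := measurable_regular.
have -> : P A = (P (A `&` regular) + P (A `\` regular))%E.
  rewrite -measureU//; [by rewrite setUIDK|exact: measurableI|exact: measurableD|].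
  by apply/seteqP; split=> w // -[[_ h1] [_ h2]]; exact: h2.
rewrite (_ : P (A `\` regular) = 0%E) ?adde0//.
apply/eqP; rewrite eq_le measure_ge0 andbT -prob_irregular; apply: le_measure; rewrite ?inE.
- exact: measurableD.
- exact: measurableC.
- by move=> w [].
Qed.

(** Intersecting with [regular] changes no probability, by [PE]; the rest is independence of the
    time from the steps, then of the steps from each other. *)
Lemma indep_steps_time m : indep_steps (E m) m.
Proof.
split=> //; first by move=> w [].
move=> B hB; have [_ _ mi] := Hxi.
pose G : set (set T) := \bigcup_(i in [set: nat]) preimage_set_system setT (cpair \o xi i) measurable.
have mB j : (j < m)%N -> @measurable _ (g_sigma_algebraType G) (B j).
  move=> /hB; apply: sub_smallest2r; first exact: smallest_sigma_algebra.
  by move=> X [i _ hX]; exists i.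
have mBm j : (j < m)%N -> measurable (B j).
  move=> /hB; apply: smallest_sub; first exact: sigma_algebra_measurable.
  move=> X [i _ [S mS <-]]; have [mx _ _] := Hxi; exact: (mx i).
have hcap : sigma_of [set: nat] (fun j => cpair \o xi j) (\bigcap_(j in `I_m) B j).
  by apply: (@bigcap_measurableType _ (g_sigma_algebraType G)) => // j /=; exact: mB.
have mcap : measurable (\bigcap_(j in `I_m) B j) by apply: bigcap_measurableType.
rewrite /E setIAC PE; last exact: measurableI.
rewrite PE// indep_time// fineM ?fin_num_measure//; congr (_ * _).
have := mi (iota 0 m) B (iota_uniq 0 m) _.
rewrite -(big_mkord xpredT (fun j => fine (P (B j)))) /index_iota subn0 => <-.
  congr (fine (P _)); apply/seteqP; split=> w hw j /= jm; apply: hw => /=.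
    by move: jm; rewrite mem_iota.
  by rewrite mem_iota.
by move=> j; rewrite mem_iota => /hB.
Qed.

Let sum_time J (F : nat -> R[i]) w : \sum_(m < J) (\1_(E m) w)%:C * F m =
  (\1_regular w)%:C * (if (M w < J)%N then F (M w) else 0).
Proof.
have [hw|hw] := pselect (regular w); last first.
  rewrite [in RHS]indicE memNset// mul0r big1// => m _.
  by rewrite indicE memNset ?mul0r// => -[].
rewrite [in RHS]indicE mem_set// mul1r; case: ifPn => MJ.
  rewrite (bigD1 (Ordinal MJ))//= indicE mem_set// mul1r big1 ?addr0// => m /eqP mM.
  by rewrite indicE memNset ?mul0r// => -[/= Mm _]; apply: mM; exact: val_inj.
rewrite big1// => m _; rewrite indicE memNset ?mul0r// => -[/= Mm _].
by move: MJ; rewrite Mm ltn_ord.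
Qed.

Let sum_time_cvg (F : nat -> R[i]) w :
  ccvg (fun J => \sum_(m < J) (\1_(E m) w)%:C * F m) ((\1_regular w)%:C * F (M w)).
Proof.
have near : \forall J \near \oo, \sum_(m < J) (\1_(E m) w)%:C * F m = (\1_regular w)%:C * F (M w).
  by exists (M w).+1 => // k /= Mk; rewrite sum_time Mk.
by split; apply: cvg_near_cst; apply: filterS near => k ->.
Qed.

Let sum_time_le J (F : nat -> R[i]) w : (regular w -> cnorm (F (M w)) <= Y w) ->
  cnorm (\sum_(m < J) (\1_(E m) w)%:C * F m) <= Y w.
Proof.
move=> FY; have Y0 : 0 <= Y w by rewrite (le_trans _ (bound_Y w))// mulr_ge0// expR_ge0.
rewrite sum_time cnormZ indicE; have [hw|hw] := pselect (regular w); last first.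
  by rewrite memNset// normr0 mul0r.
rewrite mem_set// normr1 mul1r; case: ifP => _; [exact: FY|by rewrite cnorm0].
Qed.

(** Both sides are limits of sums over the events [M = m] with [m < J], dominated by [Y]; for each
    [J] the sums agree by [cexpectation_walk]. *)
Lemma cexpectation_random_walk :
  cintegrable P (fun w => fourier mu (y + h%:C * partial_sum (M w) w)) /\
  cexpectation P (fun w => fourier mu (y + h%:C * partial_sum (M w) w)) =
  cexpectation P (fun w => walk_mean (M w) y).
Proof.
pose F m w := fourier mu (y + h%:C * partial_sum m w).
have mind m : cmeasurable (fun w => (\1_(E m) w)%:C : R[i]).
  by apply: cmeasurableR; exact: measurable_indic.
have mreg : cmeasurable (fun w => (\1_regular w)%:C : R[i]).
  by apply: cmeasurableR; apply: measurable_indic; exact: measurable_regular.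
have mF J : cmeasurable (fun w => \sum_(m < J) (\1_(E m) w)%:C * F m w).
  by apply: cmeasurable_sum => m; apply: cmeasurableM => //; exact: cmeasurable_fourier_walk.
have mG J : cmeasurable (fun w => \sum_(m < J) (\1_(E m) w)%:C * walk_mean m y).
  by apply: cmeasurable_sum => m; apply: cmeasurableM => //; exact: cmeasurable_cst.
have [|iF cF] := cexpectation_cvg mF (fun w => sum_time_cvg (F ^~ w) w) integrable_Y.
  by move=> J w; apply: (@sum_time_le J (F ^~ w)) => hw; exact: le_trans (fourier_walk_le _ _ hw) (bound_Y w).
have [|iG cG] := cexpectation_cvg mG (fun w => sum_time_cvg (walk_mean ^~ y) w) integrable_Y.
  by move=> J w; apply: (@sum_time_le J (walk_mean ^~ y)) => hw; exact: le_trans (walk_mean_le _ _) (bound_Y w).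
have FG J : cexpectation P (fun w => \sum_(m < J) (\1_(E m) w)%:C * F m w) =
    cexpectation P (fun w => \sum_(m < J) (\1_(E m) w)%:C * walk_mean m y).
  rewrite (cexpectation_sum _ _).2; last by move=> m; apply: cintegrable_walk => // w [].
  rewrite (cexpectation_sum _ _).2; last by move=> m; exact: (cexpectation_indic _ _ _).1.
  apply: eq_bigr => m _; rewrite (cexpectation_indic _ _ _).2// cexpectation_walk//.
  exact: indep_steps_time.
have EFG : cexpectation P (fun w => (\1_regular w)%:C * F (M w) w) =
    cexpectation P (fun w => (\1_regular w)%:C * walk_mean (M w) y).
  rewrite (funext FG) in cF; apply: complexP.
    exact: (cvg_unique _ cF.1 cG.1).
  exact: (cvg_unique _ cF.2 cG.2).
have mFM : cmeasurable (fun w => F (M w) w) by apply: (cmeasurable_random_index measurable_time) => m; exact: cmeasurable_fourier_walk.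
have mGM : cmeasurable (fun w => walk_mean (M w) y) 
  by apply: (cmeasurable_random_index (G := fun m _ => walk_mean m y) measurable_time) => m; exact: cmeasurable_cst.
have regE (G : T -> R[i]) w : ~ (~` regular) w -> G w = (\1_regular w)%:C * G w.
  by move=> /contrapT hw; rewrite indicE mem_set// mul1r.
have mC := measurableC measurable_regular.
have [i1 e1] := cexpectation_ae mC prob_irregular mFM (cmeasurableM mreg mFM) (regE (fun w => F (M w) w)).
have [_ e2] := cexpectation_ae mC prob_irregular mGM (cmeasurableM mreg mGM) (regE (fun w => walk_mean (M w) y)).
by split; [exact: i1|rewrite e1 e2].
Qed.

End RandomTime.

End Walk.

(** * Convergence *)

Section WalkLimit.
Context {R : realType}.
Variables (N : nat) (b : R[i]).
Hypothesis N0 : (0 < N)%N.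
Variables (mu : complex_measure R) (r : R).
Hypothesis r0 : 0 <= r.
Hypothesis supp_mu : forall A : set (measurableTypeR R), measurable A ->
  A `&` `[- r, r]%classic = set0 -> cm_re mu A = 0%E /\ cm_im mu A = 0%E.

Lemma admissibleB (g g' : R -> R[i]) : admissible r g -> admissible r g' ->
  admissible r (fun l => g l - g' l).
Proof.
move=> ag ag'; under eq_fun do rewrite -(mulN1r (g' _)).
by apply: admissibleD => //; apply: admissibleM => //; exact: admissible_cst.
Qed.

(** With [m] of order [n], [z - w] of order [n^-2] and [q^m] bounded, the powers differ by
    [O(1/n)]. *)
Lemma cnorm_subX (z w : R[i]) (q : R) m : 1 <= q -> cnorm z <= q -> cnorm w <= q ->
  cnorm (z ^+ m - w ^+ m) <= m%:R * cnorm (z - w) * q ^+ m.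
Proof.
move=> q1 zq wq; have q0 : 0 <= q by rewrite (le_trans _ q1).
have cX v k : cnorm v <= q -> cnorm (v ^+ k) <= q ^+ k.
  move=> vq; rewrite (le_trans (cnormX _ _))// lerXn2r ?nnegrE ?cnorm_ge0//.
elim: m => [|m ih]; first by rewrite !expr0 subrr cnorm0 mul0r mul0r.
have -> : z ^+ m.+1 - w ^+ m.+1 = z * (z ^+ m - w ^+ m) + (z - w) * w ^+ m.
  by rewrite !exprS; ring.
rewrite (le_trans (cnormD _ _))//.
rewrite [leRHS](_ : _ = q * (m%:R * cnorm (z - w) * q ^+ m) + cnorm (z - w) * (q * q ^+ m)); last first.
  by rewrite exprS -natr1; ring.
apply: lerD; first by rewrite (le_trans (cnormM _ _))// ler_pM ?cnorm_ge0.
rewrite (le_trans (cnormM _ _))// ler_wpM2l ?cnorm_ge0// (le_trans (cX _ m wq))//.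
by rewrite ler_peMl// exprn_ge0.
Qed.

Let p (l : R) : R[i] := iota_ l ^+ N * b ^+ N / N`!%:R.
Let K0 := cnorm (b ^+ N / N`!%:R) * r ^+ N.
Let C1 := (2 * r * cnorm b) ^+ (2 * N) * expR (2 * r * cnorm b).
Let scale (n : nat) : R := n%:R `^ (- N%:R^-1).
Let phi n l := root_mean N b ((scale n)%:C * iota_ l).

Let K0_ge0 : 0 <= K0. Proof. by rewrite mulr_ge0 ?cnorm_ge0// exprn_ge0. Qed.
Let C1_ge0 : 0 <= C1.
Proof. by rewrite mulr_ge0 ?expR_ge0// exprn_ge0// !mulr_ge0// cnorm_ge0. Qed.

Let p_le l : `|l| <= r -> cnorm (p l) <= K0.
Proof.
move=> lr; rewrite /p -mulrA mulrC (le_trans (cnormM _ _))//.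
by rewrite ler_wpM2l ?cnorm_ge0 ?iotaX_le.
Qed.

Let scaleX n : scale n ^+ N = n%:R^-1.
Proof.
rewrite /scale -powR_mulrn ?powR_ge0// -powRrM mulNr mulVf ?pnatr_eq0 -?lt0n//.
by rewrite powR_inv1.
Qed.

Let scale_le1 n : (0 < n)%N -> 0 <= scale n <= 1.
Proof.
move=> n0; rewrite powR_ge0/= leNgt; apply/negP => h.
have : 1 < scale n ^+ N by rewrite exprn_egt1// -lt0n.
by rewrite scaleX ltNge invf_le1 ?ltr0n// ler1n n0.
Qed.

Let phi_expansion n l : (0 < n)%N -> `|l| <= r ->
  cnorm (phi n l - (1 + (n%:R^-1)%:C * p l)) <= n%:R^-1 ^+ 2 * C1.
Proof.
move=> n0 lr.
have := root_mean_expansion N0 (lexx (cnorm b)) r0 (scale_le1 n0) (z := iota_ l).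
rewrite cnorm_iota => /(_ lr); rewrite mulnC exprM scaleX.
by rewrite mulnC.
Qed.

Let phi_le n l : (0 < n)%N -> `|l| <= r -> cnorm (phi n l) <= expR ((K0 + C1) / n%:R).
Proof.
move=> n0 lr; have n1 : n%:R^-1 <= 1 :> R by rewrite invf_le1 ?ltr0n// ler1n.
have ni : 0 <= n%:R^-1 :> R by rewrite invr_ge0.
rewrite -[phi n l](subrK (1 + (n%:R^-1)%:C * p l)) (le_trans (cnormD _ _))//.
rewrite (le_trans (lerD (phi_expansion n0 lr) (cnormD _ _)))//.
rewrite (le_trans _ (expR_ge1Dx _))// cnorm1 cnormZ (ger0_norm ni).
rewrite addrCA lerD2l mulrDl addrC lerD//; first by rewrite mulrC ler_wpM2r// p_le.
by rewrite mulrC ler_wpM2l// expr2 ler_piMr.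
Qed.

(** The second summand pays for replacing [1 + p l / n] by [e^(p l / n)], whose powers are
    explicit. *)
Let C2 := C1 + K0 ^+ 2 * expR K0.

Let phi_exp n l : (0 < n)%N -> `|l| <= r ->
  cnorm (phi n l - cexp ((n%:R^-1)%:C * p l)) <= n%:R^-1 ^+ 2 * C2.
Proof.
move=> n0 lr; have n1 : n%:R^-1 <= 1 :> R by rewrite invf_le1 ?ltr0n// ler1n.
have ni : 0 <= n%:R^-1 :> R by rewrite invr_ge0.
set a := (n%:R^-1)%:C * p l.
have -> : phi n l - cexp a = (phi n l - (1 + a)) - (cexp a - (1 + a)).
  by move: (phi n l) (cexp a) => u v; ring.
rewrite (le_trans (cnormB _ _))// /C2 mulrDr lerD//; first exact: phi_expansion.
have := cexp_taylor 2 a; rewrite (_ : ctaylor 2 a = 1 + a); last first.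
  rewrite /ctaylor !big_ord_recr big_ord0 /= add0r expr0 expr1 fact0 invr1 mulr1.
  by congr (_ + _); exact: mul1r.
move=> /le_trans; apply.
have aK : cnorm a <= n%:R^-1 * K0 by rewrite cnormZ (ger0_norm ni) ler_wpM2l// p_le.
have a0 := cnorm_ge0 a.
rewrite mulrA ler_pM ?expR_ge0 ?divr_ge0 ?exprn_ge0//.
  rewrite -exprMn ler_pdivrMr ?ltr0n ?fact_gt0// (@le_trans _ _ ((n%:R^-1 * K0) ^+ 2))//.
    by apply: lerXn2r => //; rewrite nnegrE mulr_ge0.
  by rewrite ler_peMr ?sqr_ge0// ler1n fact_gt0.
by rewrite ler_expR (le_trans aK)// ler_piMl.
Qed.

(* The limit of the semigroups: [e^(s A) f (x)] for [A = beta / N! d^N]. *)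
Definition walk_limit (x s : R) : R[i] :=
  complex_int mu (fun l => cexp (iota_ l * x%:C) * cexp (s%:C * (iota_ l ^+ N * b ^+ N / N`!%:R))).

Let admissible_cexp_p s : admissible r (fun l => cexp (s%:C * p l)).
Proof.
apply: admissible_cexp; apply: admissibleM; first exact: admissible_cst.
apply: admissibleM; last exact: admissible_cst.
apply: admissibleM; last exact: admissible_cst.
by apply: admissibleX; exact: admissible_iota.
Qed.

(** Two errors of order [1/n], uniform in [l]: replacing each factor by [e^(p l / n)], and replacing
    [m / n] by [s], where [m] is the integer part of [n s]. *)
Let phi_limit n s l : (0 < n)%N -> 0 <= s -> `|l| <= r ->
  cnorm (phi n l ^+ Num.truncn (n%:R * s) - cexp (s%:C * p l)) <=
  n%:R^-1 * (s * C2 * expR (s * (K0 + C1)) + expR (s * K0) * (K0 * expR K0)).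
Proof.
move=> n0 s0 lr; set m := Num.truncn _.
have n1 : n%:R^-1 <= 1 :> R by rewrite invf_le1 ?ltr0n// ler1n.
have nr0 : 0 < n%:R :> R by rewrite ltr0n.
have ni : 0 <= n%:R^-1 :> R by rewrite invr_ge0.
have C20 : 0 <= C2 by rewrite addr_ge0// mulr_ge0 ?expR_ge0// sqr_ge0.
have /andP[ms sm] : m%:R <= n%:R * s < m.+1%:R by apply: truncn_itv; rewrite mulr_ge0.
have mns : m%:R * n%:R^-1 <= s by rewrite ler_pdivrMr// mulrC.
set q := expR ((K0 + C1) / n%:R).
have q1 : 1 <= q by rewrite -[leLHS]expR0 ler_expR divr_ge0// addr_ge0.
set c := cexp ((n%:R^-1)%:C * p l).
have cq : cnorm c <= q.
  rewrite (le_trans (cnorm_cexp _))// ler_expR cnormZ (ger0_norm ni) mulrC ler_wpM2r//.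
  by rewrite (le_trans (p_le lr))// lerDl.
rewrite -[phi n l ^+ m](subrK (c ^+ m)) -addrA mulrDr (le_trans (cnormD _ _))// lerD//.
  rewrite (le_trans (cnorm_subX _ q1 (phi_le n0 lr) cq))//.
  rewrite (le_trans (ler_wpM2r (exprn_ge0 _ (expR_ge0 _)) (ler_wpM2l (ler0n _ _) (phi_exp n0 lr))))//.
  rewrite /q -expRM_natl; set e := expR (m%:R * _).
  rewrite [leLHS](_ : _ = (m%:R * n%:R^-1) * (n%:R^-1 * C2) * e); last by rewrite expr2 !mulrA.
  rewrite [leRHS](_ : _ = s * (n%:R^-1 * C2) * expR (s * (K0 + C1))); last by rewrite -mulrA mulrCA !mulrA.
  have nC2 : 0 <= n%:R^-1 * C2 by rewrite mulr_ge0.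
  have e0 : 0 <= e by exact: expR_ge0.
  apply: ler_pM => //; [by rewrite !mulr_ge0|by rewrite ler_wpM2r|].
  by rewrite ler_expR mulrCA mulrC ler_wpM2r// addr_ge0.
have cE : c ^+ m = cexp ((m%:R * n%:R^-1)%:C * p l).
  by rewrite /c -cexpMn rmorphM /= -mulrA rmorph_nat.
pose v := (s - m%:R * n%:R^-1)%:C * p l.
have d0 : 0 <= s - m%:R * n%:R^-1 by rewrite subr_ge0.
have dn : s - m%:R * n%:R^-1 <= n%:R^-1.
  by rewrite lerBlDl -[X in _ <= _ + X]mul1r -mulrDl natr1 ler_pdivlMr// mulrC ltW.
have vK : cnorm v <= n%:R^-1 * K0.
  by rewrite /v cnormZ (ger0_norm d0) ler_pM ?cnorm_ge0// p_le.
have -> : c ^+ m - cexp (s%:C * p l) = cexp ((m%:R * n%:R^-1)%:C * p l) * - (cexp v - 1).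
  rewrite cE opprB mulrBr mulr1 -cexpD /v -mulrDl -rmorphD /=.
  by rewrite (addrC (m%:R * _)) subrK.
rewrite (le_trans (cnormM _ _))// cnormN [leRHS]mulrCA ler_pM ?cnorm_ge0//.
  rewrite (le_trans (cnorm_cexp _))// ler_expR cnormZ ger0_norm ?mulr_ge0//.
  by rewrite ler_pM ?mulr_ge0 ?cnorm_ge0// p_le.
have := cexp_taylor 1 v; rewrite /ctaylor big_ord_recr big_ord0 /= add0r expr0 mulr1 fact0 invr1.
move=> /le_trans; apply; rewrite expr1 mulr1 mulrA.
rewrite ler_pM ?cnorm_ge0 ?expR_ge0// ler_expR (le_trans vK)// ler_piMl//.
Qed.

(** Since [K] does not depend on [n], this is the dominating function at [s = L t]; it is integrable
    by [inverse_subordinator_expR]. *)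
Lemma walk_mean_le_expR x : exists2 K, 0 <= K & forall n s, (0 < n)%N -> 0 <= s ->
  cnorm (walk_mean N b mu (scale n) (Num.truncn (n%:R * s)) x%:C) <=
  complex_mass mu * 2 * expR (K * s).
Proof.
exists (K0 + C1) => [|n s n0 s0]; first by rewrite addr_ge0.
rewrite -mulrA; apply: (complex_int_le supp_mu); first exact: admissible_walk_mean.
move=> l lr; rewrite (le_trans (cnormM _ _))// ler_pM ?cnorm_ge0 ?cnorm_cexp_iota//.
rewrite (le_trans (cnormX _ _))//.
rewrite (le_trans (lerXn2r _ _ _ (phi_le n0 lr))) ?nnegrE ?cnorm_ge0 ?expR_ge0//.
rewrite -expRM_natl ler_expR mulrCA ler_wpM2l ?addr_ge0//.
by rewrite ler_pdivrMr ?ltr0n// mulrC truncn_le mulr_ge0.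
Qed.

Lemma walk_mean_cvg x s : 0 <= s ->
  ccvg (fun n => walk_mean N b mu (scale n) (Num.truncn (n%:R * s)) x%:C) (walk_limit x s).
Proof.
move=> s0.
set C := s * C2 * expR (s * (K0 + C1)) + expR (s * K0) * (K0 * expR K0).
apply: (@ccvg_cnorm _ _ _ (fun n => complex_mass mu * (2 * C) * n%:R^-1)).
  exists 1%N => // n /= n0; rewrite /walk_mean /walk_limit.
  rewrite -(complex_intB supp_mu); first last.
  - by apply: admissibleM; [exact: admissible_cexp_iota|exact: admissible_cexp_p].
  - exact: admissible_walk_mean.
  rewrite -[leRHS]mulrA -[X in _ <= _ * X]mulrA; apply: (complex_int_le supp_mu).
    apply: admissibleB; first exact: admissible_walk_mean.
    by apply: admissibleM; [exact: admissible_cexp_iota|exact: admissible_cexp_p].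
  move=> l lr; rewrite -mulrBr (le_trans (cnormM _ _))// ler_pM ?cnorm_ge0 ?cnorm_cexp_iota//.
  by rewrite [leRHS]mulrC; exact: phi_limit.
have h : complex_mass mu * (2 * C) * n%:R^-1 @[n --> \oo] --> complex_mass mu * (2 * C) * (0 : R).
  by apply: cvgM; [exact: cvg_cst|rewrite -cvg_shiftS; exact: cvg_harmonic].
by rewrite mulr0 in h.
Qed.

(** Expanding [e^(s p l)] under the integral exhibits the coefficients [ml_term] of the
    Mittag-Leffler solution, so that only powers of [s = L t] remain to be averaged. *)
Lemma walk_limit_series x s : 0 <= s ->
  ccvg (fun k => \sum_(j < k) (s ^+ j / j`!%:R)%:C * ml_term N (b ^+ N) mu 0 x j) (walk_limit x s).
Proof.
move=> s0.
apply: (@ccvg_cnorm _ _ _ (fun k => complex_mass mu * 2 * expR (s * K0) * ((s * K0) ^+ k / k`!%:R))); last first.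
  exact: cvg_exp_tail.
apply: nearW => k.
have am j : admissible r (fun l => (s ^+ j / j`!%:R)%:C * (b ^+ N / N`!%:R) ^+ j * (iota_ l ^+ (N * j + 0) * cexp (iota_ l * x%:C))).
  by apply: admissibleM; [exact: admissible_cst|exact: admissible_moment].
rewrite [X in X - _](_ : _ = complex_int mu (fun l => \sum_(j < k) (s ^+ j / j`!%:R)%:C * (b ^+ N / N`!%:R) ^+ j *
    (iota_ l ^+ (N * j + 0) * cexp (iota_ l * x%:C)))); last first.
  rewrite (complex_int_sum supp_mu)//; apply: eq_bigr => j _.
  rewrite (complex_intZ supp_mu); last exact: admissible_moment.
  by rewrite /ml_term /moment mulrA.
rewrite /walk_limit -(complex_intB supp_mu); first last.
- by apply: admissibleM; [exact: admissible_cexp_iota|exact: admissible_cexp_p].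
- exact: admissible_sum.
rewrite -[leRHS]mulrA -[leRHS]mulrA; apply: (complex_int_le supp_mu).
  apply: admissibleB; first exact: admissible_sum.
  by apply: admissibleM; [exact: admissible_cexp_iota|exact: admissible_cexp_p].
move=> l lr.
have -> : \sum_(j < k) (s ^+ j / j`!%:R)%:C * (b ^+ N / N`!%:R) ^+ j * (iota_ l ^+ (N * j + 0) * cexp (iota_ l * x%:C)) =
    cexp (iota_ l * x%:C) * ctaylor k (s%:C * p l).
  rewrite /ctaylor mulr_sumr; apply: eq_bigr => j _.
  have aux (S J B E F : R[i]) : (S ^+ j * J) * B ^+ j * (E ^+ j * F) = F * (J * (S * (E * B)) ^+ j).
    by rewrite !exprMn; move: (S ^+ j) (B ^+ j) (E ^+ j) => S' B' E'; ring.
  by rewrite addn0 exprM /p -(mulrA (iota_ l ^+ N)) -aux -rmorphXn -rmorphM.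
rewrite -mulrBr (le_trans (cnormM _ _))// ler_pM ?cnorm_ge0 ?cnorm_cexp_iota//.
rewrite -cnormN opprB (le_trans (cexp_taylor _ _))// mulrC.
have pK : cnorm (s%:C * p l) <= s * K0 by rewrite cnormZ ger0_norm// ler_wpM2l// p_le.
rewrite ler_pM ?expR_ge0 ?divr_ge0 ?exprn_ge0 ?cnorm_ge0//; first by rewrite ler_expR.
by rewrite ler_wpM2r// lerXn2r ?nnegrE ?cnorm_ge0// mulr_ge0.
Qed.

End WalkLimit.

Lemma ccvg_shiftS {R : realType} (u : nat -> R[i]) l :
  ccvg (fun n => u n.+1) l <-> ccvg u l.
Proof.
split=> -[h1 h2]; split.
- by rewrite -(cvg_shiftS (fun n => complex.Re (u n))).
- by rewrite -(cvg_shiftS (fun n => complex.Im (u n))).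
- by rewrite (cvg_shiftS (fun n => complex.Re (u n))).
- by rewrite (cvg_shiftS (fun n => complex.Im (u n))).
Qed.

Section Expectation.
Context {d : measure_display} {T : measurableType d} {R : realType}.
Local Notation RT := (measurableTypeR R).
Variables (P : probability T R) (alpha : R).
Hypothesis alpha01 : 0 < alpha < 1.
Variables (N : nat) (b : R[i]) (xi : nat -> T -> R[i]).
Hypothesis N0 : (0 < N)%N.
Hypothesis Hxi : iid_uniform_on_roots P N b xi.
Variable H : R -> {RV P >-> R}.
Hypothesis HH : stable_subordinator alpha H.
Local Notation L := (inverse_subordinator H).
Hypothesis Hindep : indep_systems P
  (sigma_of [set t : R | 0 <= t] (inverse_subordinator H : R -> T -> RT))
  (sigma_of [set: nat] (fun j => cpair \o xi j)).
Variables (mu : complex_measure R) (r : R).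
Hypothesis r0 : 0 <= r.
Hypothesis supp_mu : forall A : set RT, measurable A ->
  A `&` `[- r, r]%classic = set0 -> cm_re mu A = 0%E /\ cm_im mu A = 0%E.
Variable t : R.
Hypothesis t0 : 0 <= t.

Let time (n : nat) (w : T) : nat := Num.truncn (n%:R * L t w).

Let timeE n m : [set w | time n w = m] =
  L t @^-1` [set s : RT | (m%:R <= n%:R * s < m.+1%:R)%R].
Proof.
have nL w : 0 <= n%:R * L t w by rewrite mulr_ge0// inverse_subordinator_ge0.
apply/seteqP; split=> w /=; first by move=> <-; exact: truncn_itv.
by move=> h; rewrite /time (truncn_def h).
Qed.

Let measurable_window n m : measurable [set s : RT | (m%:R <= n%:R * s < m.+1%:R)%R].
Proof.
rewrite -[X in measurable X]setTI.
apply: (@measurable_and _ _ _ (fun s : RT => m%:R <= n%:R * s) (fun s => n%:R * s < m.+1%:R) _ _ measurableT [set true]) => //.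
  by apply: measurable_fun_ler => //; exact: measurable_funM.
by apply: measurable_fun_ltr => //; exact: measurable_funM.
Qed.

Let measurable_time n m : measurable [set w | time n w = m].
Proof.
rewrite timeE -[X in measurable X]setTI.
by apply: (measurable_inverse_subordinator HH t) => //; exact: measurable_window.
Qed.

Let indep_time n m B : sigma_of [set: nat] (fun j => cpair \o xi j) B ->
  P ([set w | time n w = m] `&` B) = (P [set w | time n w = m] * P B)%E.
Proof.
move=> hB; apply: Hindep => //; apply: sub_sigma_algebra; exists t => //.
exists [set s : RT | (m%:R <= n%:R * s < m.+1%:R)%R]; first exact: measurable_window.
by rewrite setTI timeE.
Qed.

Let integrable_expR (C c : R) : 0 <= c ->
  P.-integrable setT (EFin \o (fun w => C * expR (c * L t w))).
Proof.
move=> c0; have := integrableZl measurableT C (inverse_subordinator_expR alpha01 HH c0 t0).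
by apply: eq_integrable.
Qed.

(** The dominating function used here depends on [n] through [c]; it only justifies conditioning on
    the time for a fixed [n]. *)
Lemma cexpectation_walk_time n (x : R) :
  cintegrable P (fun w => fourier mu (x%:C + walk N xi n (L t w) w)) /\
  cexpectation P (fun w => fourier mu (x%:C + walk N xi n (L t w) w)) =
  cexpectation P (fun w => walk_mean N b mu (n%:R `^ (- N%:R^-1)) (time n w) x%:C).
Proof.
set h := n%:R `^ (- N%:R^-1).
have h0 : 0 <= `|h| by [].
pose c : R := `|r| * (`|h| * (n%:R * (cnorm b * 2))).
have c0 : 0 <= c by rewrite !mulr_ge0// cnorm_ge0.
apply: (@cexpectation_random_walk _ _ _ P N b xi N0 Hxi mu r supp_mu h (time n)
  (@measurable_time n) (@indep_time n) x%:C
  (fun w => complex_mass mu * 2 * expR (`|r| * cnorm x%:C) * expR (c * L t w))).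
  exact: integrable_expR.
move=> w; have V0 : 0 <= complex_mass mu * 2 by rewrite mulr_ge0// complex_mass_ge0.
rewrite /walk_bound -[leRHS]mulrA ler_wpM2l//.
have B0 : 0 <= cnorm b * 2 by rewrite mulr_ge0// cnorm_ge0.
rewrite -expRD ler_expR mulrDr lerD2l /c; move: (cnorm b * 2) B0 => B B0.
rewrite -!mulrA ler_wpM2l// ler_wpM2l// [leRHS]mulrCA [leRHS]mulrC ler_wpM2r//.
by rewrite truncn_le mulr_ge0// inverse_subordinator_ge0.
Qed.

Lemma cexpectation_walk_limit (x : R) :
  cintegrable P (fun w => walk_limit N b mu x (L t w)) /\
  ccvg (fun n => cexpectation P (fun w => fourier mu (x%:C + walk N xi n (L t w) w)))
    (cexpectation P (fun w => walk_limit N b mu x (L t w))).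
Proof.
have [K K0 hK] := @walk_mean_le_expR _ N b N0 mu r r0 supp_mu x.
(* The index is shifted by one because the uniform bound holds for [n >= 1]. *)
have [|||iL cL] := @cexpectation_cvg _ _ _ P
    (fun n w => walk_mean N b mu (n.+1%:R `^ (- N%:R^-1)) (time n.+1 w) x%:C)
    (fun w => walk_limit N b mu x (L t w)) _ _ _ (integrable_expR (complex_mass mu * 2) K0).
- move=> n; apply: (cmeasurable_random_index (G := fun m _ => walk_mean N b mu _ m x%:C)).
    by move=> m; exact: measurable_time.
  by move=> m; exact: cmeasurable_cst.
- move=> w; apply: (ccvg_shiftS (fun n => walk_mean N b mu (n%:R `^ (- N%:R^-1)) (time n w) x%:C) _).2.
  exact: (@walk_mean_cvg _ N b N0 mu r r0 supp_mu x _ (inverse_subordinator_ge0 H t w)).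
- by move=> n w; apply: hK => //; exact: inverse_subordinator_ge0.
split=> //.
have E : (fun n => cexpectation P (fun w => fourier mu (x%:C + walk N xi n (L t w) w))) =
  (fun n => cexpectation P (fun w => walk_mean N b mu (n%:R `^ (- N%:R^-1)) (time n w) x%:C)).
  by apply/funext => n; have [] := cexpectation_walk_time n x.
by rewrite E; apply: (ccvg_shiftS _ _).1.
Qed.

Lemma cexpectation_solution (x : R) :
  cexpectation P (fun w => walk_limit N b mu x (L t w)) = ml_solution alpha N (b ^+ N) mu t x.
Proof.
pose c j := ml_term N (b ^+ N) mu 0 x j.
pose K := cnorm (b ^+ N / N`!%:R) * r ^+ N.
have K0 : 0 <= K by rewrite mulr_ge0 ?cnorm_ge0 ?exprn_ge0.
have cK j : cnorm (c j) <= complex_mass mu * 2 * K ^+ j.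
  by have := @ml_term_le _ N (b ^+ N) mu r supp_mu 0 x j; rewrite expr0 mulr1.
have V0 : 0 <= complex_mass mu * 2 by rewrite mulr_ge0// complex_mass_ge0.
have L0 w : 0 <= L t w by exact: inverse_subordinator_ge0.
have mL := measurable_inverse_subordinator HH t.
have mLX j : measurable_fun [set: T] (fun w => L t w ^+ j / j`!%:R).
  by apply: measurable_funM => //; exact: measurable_funX.
have [||_ cS] := @cexpectation_cvg _ _ _ P (fun k w => \sum_(j < k) (L t w ^+ j / j`!%:R)%:C * c j)
   _ _ _ (fun w => @walk_limit_series _ N b mu r r0 supp_mu x _ (L0 w)) (integrable_expR (complex_mass mu * 2) K0).
- move=> k; apply: cmeasurable_sum => j; apply: cmeasurableM; last exact: cmeasurable_cst.
  exact: cmeasurableR.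
- move=> k w; apply: (le_trans (cnorm_sum _ _ _)).
  have KL0 : 0 <= K * L t w by rewrite mulr_ge0.
  apply: (le_trans _ (ler_wpM2l V0 (sum_expR_le k KL0))); rewrite mulr_sumr.
  apply: ler_sum => j _; rewrite cnormZ ger0_norm ?divr_ge0 ?exprn_ge0//.
  rewrite [leRHS](_ : _ = L t w ^+ j / j`!%:R * (complex_mass mu * 2 * K ^+ j)).
    by rewrite ler_wpM2l ?divr_ge0 ?exprn_ge0.
  by rewrite exprMn; ring.
(* The [j!] in the moment cancels the one in the exponential series, which thereby becomes the
   Mittag-Leffler series. *)
have EL j : P.-integrable setT (EFin \o (fun w => L t w ^+ j / j`!%:R)) /\
    (\int[P]_w (L t w ^+ j / j`!%:R))%R = mlcoef alpha j * (t `^ alpha) ^+ j.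
  have iLj : (\int[P]_w (L t w ^+ j / j`!%:R)%:E = (mlcoef alpha j * (t `^ alpha) ^+ j)%:E)%E.
    transitivity ((j`!%:R^-1)%:E * \int[P]_w (L t w ^+ j)%:E)%E.
      rewrite -ge0_integralZl//.
      - by apply: eq_integral => w _; rewrite -EFinM mulrC.
      - by apply/measurable_EFinP; exact: measurable_funX.
      - by move=> w _; rewrite lee_fin exprn_ge0.
    rewrite (inverse_subordinator_moment alpha01 HH)// -EFinM mulKf// pnatr_eq0 -lt0n fact_gt0//.
  split; last by rewrite /Rintegral iLj.
  apply/integrableP; split; first exact/measurable_EFinP.
  rewrite (_ : (\int[P]_w _)%E = (mlcoef alpha j * (t `^ alpha) ^+ j)%:E) ?ltry// -iLj.
  apply: eq_integral => w _; rewrite /= ger0_norm// divr_ge0// exprn_ge0//.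
have SE k : cexpectation P (fun w => \sum_(j < k) (L t w ^+ j / j`!%:R)%:C * c j) =
    \sum_(j < k) (mlcoef alpha j * (t `^ alpha) ^+ j)%:C * c j.
  rewrite (cexpectation_sum _ _).2; last by move=> j; exact: (cexpectation_scale _ (EL j).1).1.
  by apply: eq_bigr => j _; rewrite (cexpectation_scale _ (EL j).1).2 (EL j).2.
rewrite (funext SE) in cS.
have ps (q : R[i] -> R) : (forall z w, q (z + w) = q z + q w) -> (forall a z, q (a%:C * z) = a * q z) ->
    geometric_growth (fun k => q (c k)) ->
    q (\sum_(j < k) (mlcoef alpha j * (t `^ alpha) ^+ j)%:C * c j) @[k --> \oo] -->
    ml alpha (fun k => q (c k)) t.
  move=> qD qZ gq; have := @entire_cvg _ _ (t `^ alpha) (entire_ml alpha01 gq).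
  have q0 : q 0 = 0 by have := qZ 0 0; rewrite !mul0r.
  suff E k : q (\sum_(j < k) (mlcoef alpha j * (t `^ alpha) ^+ j)%:C * c j) =
      pseries (fun k => q (c k) * mlcoef alpha k) (t `^ alpha) k by rewrite (funext E).
  rewrite /pseries /series /= big_mkord (big_morph q qD q0); apply: eq_bigr => j _.
  by rewrite qZ mulrC mulrA.
have hR : geometric_growth (fun k => complex.Re (c k)).
  by exists (complex_mass mu * 2), K => k; exact: le_trans (le_Re_cnorm _) (cK k).
have hI : geometric_growth (fun k => complex.Im (c k)).
  by exists (complex_mass mu * 2), K => k; exact: le_trans (le_Im_cnorm _) (cK k).
apply: complexP.
  exact: (cvg_unique _ cS.1 (ps _ (@ReD R) (@ReZ R) hR)).
exact: (cvg_unique _ cS.2 (ps _ (@ImD R) (@ImZ R) hI)).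
Qed.

End Expectation.

Lemma compact_support_itv (R : realType) (mu : complex_measure R) : compact_support mu ->
  exists2 r, 0 <= r & forall A : set (measurableTypeR R), measurable A ->
    A `&` `[- r, r]%classic = set0 -> cm_re mu A = 0%E /\ cm_im mu A = 0%E.
Proof.
move=> [K /compact_bounded[M [Mr hM]] hK].
exists (`|M| + 1) => [|A mA Ar]; first by rewrite addr_ge0.
apply: hK => //; apply/seteqP; split=> // l [Al Kl].
have lM : `|l| <= `|M| + 1 by apply: (hM (`|M| + 1)) => //; rewrite (le_lt_trans (ler_norm M))// ltrDl.
have : (A `&` `[- (`|M| + 1), (`|M| + 1)]%classic) l by split=> //=; rewrite in_itv/= -ler_norml.
by rewrite Ar.
Qed.

Theorem theorem14 (R : realType) (d : measure_display) (T : measurableType d)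
    (P : probability T R)
    (alpha : R) (alpha01 : 0 < alpha < 1)
    (N : nat) (N_ge2 : (2 <= N)%N)
    (beta : R[i])
    (Hbeta : forall y : R, complex.Re ((- 'i%C) ^+ N * beta * y%:C ^+ N) <= 0)
    (b : R[i]) (Hb : b ^+ N = beta)
    (xi : nat -> T -> R[i]) (Hxi : iid_uniform_on_roots P N b xi)
    (H : R -> {RV P >-> R}) (HH : stable_subordinator alpha H)
    (Hindep : indep_systems P
       (sigma_of [set t : R | 0 <= t]
          (inverse_subordinator H : R -> T -> measurableTypeR R))
       (sigma_of [set: nat] (fun j => cpair \o xi j)))
    (f : R -> R) (mu : complex_measure R) (Hmu : compact_support mu)
    (Hf : forall x : R, (f x)%:C = fourier mu x%:C) :
  exists u : R -> R -> R[i],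
    the_caputo_solution alpha N beta f u /\
    forall t x : R, 0 <= t ->
      let Z n w := fourier mu
        (x%:C + walk N xi n (inverse_subordinator H t w) w) in
      (forall n, cintegrable P (Z n)) /\
      ccvg (fun n => cexpectation P (Z n)) (u t x).
Proof.
have [r r0 supp_mu] := compact_support_itv Hmu.
have N0 : (0 < N)%N by exact: ltn_trans N_ge2.
exists (ml_solution alpha N beta mu); split.
  have sol := @caputo_ml_solution R alpha N beta alpha01 mu r r0 supp_mu f Hf.
  have bnd := @ml_solution_bounded R alpha N beta alpha01 mu r r0 supp_mu.
  split=> // v solv bndv t x t0.
  exact: (caputo_solution_unique alpha01 sol bnd solv bndv).
move=> t x t0 Z; split=> [n|].
  exact: (cexpectation_walk_time alpha01 N0 Hxi HH Hindep supp_mu t0 n x).1.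
rewrite -Hb -(cexpectation_solution alpha01 N b HH r0 supp_mu t0).
exact: (cexpectation_walk_limit alpha01 N0 Hxi HH Hindep r0 supp_mu t0 x).2.
Qed.
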